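(* Let $0<s\le1$ and let $d\ge1$ be an integer. There exists a constant $C>0$, depending only on the fixed model parameters $(s,d,\mathcal U,p_-,p_+,L_s,v_-,v_+,C_4)$, such that, for every $n\ge1$, \[ C^{-1}\bigl(n^{-1/2}\vee n^{-4s/(d+4s)}\bigr) \le\mathfrak r_n\le C\bigl(n^{-1/2}\vee n^{-4s/(d+4s)}\bigr). \]
   Context: Fix $s>0$, an integer $d\ge1$, an open set $\mathcal U\subset\mathbb R^d$ containing $[0,1]^d$, and constants \[ 0<p_-<1<p_+<\infty,\quad L_s>0,\quad 0<v_-<v_+<\infty,\quad v_-^2<C_4<\infty . \] Hölder norm. Set $\ell=\lceil s\rceil-1$ and $\alpha=s-\ell\in(0,1]$. For a scalar function $F$ on an open set $\Omega\subset\mathbb R^d$, \[ [D^\ell F]_{\alpha;\Omega}=\max_{|\gamma|=\ell}\sup_{u\ne v\in\Omega}\frac{|\partial^\gamma F(u)-\partial^\gamma F(v)|}{\|u-v\|^\alpha},\qquad \|F\|_{C^s(\Omega)}=\sum_{|\gamma|\le\ell}\|\partial^\gamma F\|_{L^\infty(\Omega)}+[D^\ell F]_{\alpha;\Omega}, \] with $\|\cdot\|$ the Euclidean norm (so for integer $s$, $C^s$ means $C^{s-1,1}$). Model. For each $n\in\mathbb N$ one observes i.i.d. pairs $(X_i,Y_i)_{i=1}^n$ in $[0,1]^d\times\mathbb R$, whose common law is indexed by $\theta=(p,f,V,Q)$, where $p$ is a probability density on $[0,1]^d$, $f:[0,1]^d\to\mathbb R$, $V>0$, and $Q=(Q_x)_{x\in[0,1]^d}$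 is a measurable probability kernel from $[0,1]^d$ to $\mathbb R$; write $\varepsilon_i=Y_i-f(X_i)$. The class $\Theta=\Theta(s,d,\mathcal U,p_-,p_+,L_s,v_-,v_+,C_4)$ consists of all $\theta$ such that: (i) $X_i$ has Lebesgue density $p$ and $p_-\le p(x)\le p_+$ for a.e. $x\in[0,1]^d$; (ii) $f$ has an extension $\widetilde f$ to $\mathcal U$ with $\|\widetilde f\|_{C^s(\mathcal U)}\le L_s$; (iii) for $p(x)\,dx$-almost every $x$, the conditional law of $\varepsilon_i$ given $X_i=x$ is $Q_x$, with $\int u\,Q_x(du)=0$, $\int u^2\,Q_x(du)=V$, $\int u^4\,Q_x(du)\le C_4$, and $v_-\le V\le v_+$. ($V$ is constant in $x$; $Q_x$ may otherwise depend arbitrarily on $x$.) The minimax root-mean-square risk is \[ \mathfrak r_n=\inf_{\widehat V_n}\sup_{\theta\in\Theta}\bigl\{\mathbb E_\theta(\widehat V_n-V)^2\bigr\}^{1/2}, \] the infimum being over all measurable real-valued functions $\widehat V_n$ of $(X_i,Y_i)_{i=1}^n$. Here $a\vee b=\max\{a,b\}$. *)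

(* Defs.v *)
From HB Require Import structures.
From mathcomp Require Import all_boot all_order all_algebra.
From mathcomp Require Import all_classical all_reals all_analysis.

Set Implicit Arguments.
Unset Strict Implicit.
Unset Printing Implicit Defensive.

Import Order.TTheory GRing.Theory Num.Theory.
Import numFieldNormedType.Exports.

Local Open Scope classical_set_scope.
Local Open Scope ring_scope.

Definition tcons (T : Type) n (x : T * n.-tuple T) : n.+1.-tuple T :=
  [tuple of x.1 :: x.2].

Definition tuncons (T : Type) n (t : n.+1.-tuple T) : T * n.-tuple T :=
  (thead t, [tuple of behead t]).

Lemma tconsK (T : Type) n : cancel (@tcons T n) (@tuncons T n).
Proof. by case=> x t; rewrite /tuncons /tcons theadE; congr pair; exact: val_inj. Qed.

Lemma tunconsK (T : Type) n : cancel (@tuncons T n) (@tcons T n).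
Proof. by move=> t; rewrite [RHS]tuple_eta. Qed.

(* The library proves this, but the subprobability instance on [_ \x _]
   declared there hides it from canonical inference. *)
Lemma product_sigma_finite d1 d2 (T1 : measurableType d1)
    (T2 : measurableType d2) (R : realType)
    (m1 : {sigma_finite_measure set T1 -> \bar R})
    (m2 : {sigma_finite_measure set T2 -> \bar R}) :
  sigma_finite setT (m1 \x m2)%E.
Proof.
have /sigma_finiteP[F [TF ndF Foo]] := sigma_finiteT m1.
have /sigma_finiteP[G [TG ndG Goo]] := sigma_finiteT m2.
exists (fun n => F n `*` G n).
  rewrite -setXTT TF TG predeqE => -[x y]; split.
    move=> [/= [n _ Fnx] [k _ Gky]]; exists (maxn n k) => //; split.
    - by move: x Fnx; exact/subsetPset/ndF/leq_maxl.
    - by move: y Gky; exact/subsetPset/ndG/leq_maxr.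
  by move=> [n _ []/= ? ?]; split; exists n.
move=> k; have [? ?] := Foo k; have [? ?] := Goo k.
split; first exact: measurableX.
by rewrite product_measure1E// lte_mul_pinfty// ge0_fin_numE.
Qed.

Section product_power.
Local Open Scope ereal_scope.
Context d (T : measurableType d) (R : realType).

Lemma measurable_tcons n : measurable_fun [set: T * n.-tuple T] (@tcons T n).
Proof. exact: measurable_cons. Qed.

Lemma measurable_tuncons n :
  measurable_fun [set: n.+1.-tuple T] (@tuncons T n).
Proof.
apply/measurable_fun_pair => /=; first exact: measurable_tnth.
exact: measurable_behead.
Qed.

Section step.
Variables (n : nat) (mu : {sigma_finite_measure set T -> \bar R}).
Variable nu : {sigma_finite_measure set (n.-tuple T) -> \bar R}.

Definition consm : set (n.+1.-tuple T) -> \bar R :=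
  pushforward (mu \x nu) (@tcons T n).

Let consm0 : consm set0 = 0.
Proof. by rewrite /consm /pushforward preimage_set0 measure0. Qed.

Let consm_ge0 A : 0 <= consm A.
Proof. exact: (measure_ge0 (mu \x nu)). Qed.

Let consm_sigma_additive : semi_sigma_additive consm.
Proof.
have mf := @measurable_tcons n.
exact: measure_semi_sigma_additive.
Qed.

HB.instance Definition _ := isMeasure.Build _ _ _ consm
  consm0 consm_ge0 consm_sigma_additive.

Let consm_sigma_finite : sigma_finite setT consm.
Proof.
have [F FT Foo] := product_sigma_finite mu nu.
exists (fun k => @tuncons T n @^-1` F k).
  by rewrite -preimage_bigcup -FT preimage_setT.
move=> k; have [mF Fk] := Foo k; split.
  by rewrite -[X in measurable X]setTI; exact: measurable_tuncons.
rewrite /consm /pushforward -comp_preimage.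
by rewrite (_ : _ \o _ = id) ?preimage_id//; apply/funext; exact: tconsK.
Qed.

HB.instance Definition _ := Measure_isSigmaFinite.Build _ _ _ consm
  consm_sigma_finite.

End step.

Fixpoint powm (mu : {sigma_finite_measure set T -> \bar R}) n :
    {sigma_finite_measure set (n.-tuple T) -> \bar R} :=
  match n with
  | 0 => (\d_[tuple] : {sigma_finite_measure set (0.-tuple T) -> \bar R})
  | m.+1 => (consm mu (powm mu m) :
      {sigma_finite_measure set (m.+1.-tuple T) -> \bar R})
  end.

End product_power.

Section product_power_theory.
Local Open Scope ereal_scope.
Context d (T : measurableType d) (R : realType).

Lemma powm_box (mu : {sigma_finite_measure set T -> \bar R}) n
    (A : 'I_n -> set T) : (forall i, measurable (A i)) ->
  powm mu n [set t | forall i, A i (tnth t i)] = \prod_(i < n) mu (A i).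
Proof.
elim: n A => [|n IH] A mA.
  rewrite big_ord0 /= diracE mem_set//= => -[].
  by [].
rewrite big_ord_recl /= /consm /pushforward.
have -> : @tcons T n @^-1` [set t | forall i, A i (tnth t i)] =
    A ord0 `*` [set t | forall i, A (lift ord0 i) (tnth t i)].
  apply/seteqP; split=> -[x t] /=.
  - move=> h; split; first exact: h ord0.
    by move=> i; have := h (lift ord0 i); rewrite tnthS.
  - move=> [h0 h] i; case: (unliftP ord0 i) => [j|] ->; last by [].
    by rewrite tnthS; exact: h.
rewrite product_measure1E//.
  by rewrite (IH (fun i => A (lift ord0 i))).
have -> : [set t : n.-tuple T | forall i, A (lift ord0 i) (tnth t i)] =
   \bigcap_(i in [set: 'I_n]) ((@tnth n T ^~ i) @^-1` A (lift ord0 i)).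
  by apply/seteqP; split=> t /= h i; [move=> _|]; exact: h.
apply: fin_bigcap_measurable => [|i _]; first exact: finite_finset.
by rewrite -[X in measurable X]setTI; exact: measurable_tnth.
Qed.

Lemma powm_setT (P : probability T R) n : powm P n [set: n.-tuple T] = 1.
Proof.
rewrite (_ : [set: _] = [set t | forall i : 'I_n, [set: T] (tnth t i)]).
  by rewrite (powm_box _ (fun=> measurableT)) big1// => i _; exact: probability_setT.
by apply/seteqP; split.
Qed.

Definition iid (P : probability T R) n : set (n.-tuple T) -> \bar R :=
  powm P n.
Arguments iid : clear implicits.

HB.instance Definition _ P n := Measure.on (iid P n).
HB.instance Definition _ P n :=
  Measure_isProbability.Build _ _ _ (iid P n) (powm_setT P n).

End product_power_theory.
Arguments iid {d T R} P n.

(* The sigma-algebra on 'rV[R]_d generated by the coordinates, as the library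
   does for tuples; it is the Borel sigma-algebra. *)

Definition measure_rV_display : measure_display -> measure_display.
Proof. exact. Qed.

Section measurable_rV.
Context (R : realType) (d : nat).

Let coors : 'I_d -> 'rV[R]_d -> R := fun i x => x ord0 i.

Let rV_set0 : g_sigma_preimage coors set0.
Proof. exact: sigma_algebra0. Qed.

Let rV_setC A : g_sigma_preimage coors A -> g_sigma_preimage coors (~` A).
Proof. exact: sigma_algebraC. Qed.

Let rV_bigcup (F : _^nat) : (forall i, g_sigma_preimage coors (F i)) ->
  g_sigma_preimage coors (\bigcup_i (F i)).
Proof. exact: sigma_algebra_bigcup. Qed.

HB.instance Definition _ :=
  @isMeasurable.Build (measure_rV_display default_measure_display)
    'rV[R]_d (g_sigma_preimage coors) rV_set0 rV_setC rV_bigcup.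

Definition rV_of_tuple (t : d.-tuple (measurableTypeR R)) : 'rV[R]_d :=
  \row_i tnth t i.

Lemma measurable_rV_of_tuple :
  measurable_fun [set: d.-tuple (measurableTypeR R)] rV_of_tuple.
Proof.
move=> _ A mA; rewrite setTI.
suff -> : @measurable _ (d.-tuple (measurableTypeR R)) =
    preimage_set_system setT rV_of_tuple (g_sigma_preimage coors).
  by exists A => //; rewrite setTI.
rewrite -g_sigma_preimage_comp; congr g_sigma_preimage.
by apply/funext => i; apply/funext => t; rewrite /= /coors mxE.
Qed.

Definition lebesgue_rV : set 'rV[R]_d -> \bar R :=
  pushforward (powm lebesgue_measure d) rV_of_tuple.

Let lebesgue_rV0 : lebesgue_rV set0 = 0%E.
Proof. by rewrite /lebesgue_rV /pushforward preimage_set0 measure0. Qed.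

Let lebesgue_rV_ge0 A : (0 <= lebesgue_rV A)%E.
Proof. exact: (measure_ge0 (powm lebesgue_measure d)). Qed.

Let lebesgue_rV_sigma_additive : semi_sigma_additive lebesgue_rV.
Proof.
have mf := measurable_rV_of_tuple.
exact: measure_semi_sigma_additive.
Qed.

HB.instance Definition _ := isMeasure.Build _ _ _ lebesgue_rV
  lebesgue_rV0 lebesgue_rV_ge0 lebesgue_rV_sigma_additive.

Lemma lebesgue_rV_box (A : 'I_d -> set (measurableTypeR R)) :
  (forall i, measurable (A i)) ->
  lebesgue_rV [set x | forall i, A i (x ord0 i)] =
    (\prod_(i < d) lebesgue_measure (A i))%E.
Proof.
move=> mA; rewrite -powm_box// /lebesgue_rV /pushforward; congr (powm _ _ _).
by apply/seteqP; split=> t /= h i; have := h i; rewrite mxE.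
Qed.

End measurable_rV.
Arguments lebesgue_rV : clear implicits.

Definition unit_cube (R : realType) d : set 'rV[R]_d :=
  [set x | forall i, 0 <= x ord0 i <= 1].
Arguments unit_cube : clear implicits.

Section hoelder_norm.
Context (R : realType) (d : nat).
Implicit Types (F : 'rV[R]_d -> R) (Omega : set 'rV[R]_d).

Definition eucl_norm (x : 'rV[R]_d) : R := Num.sqrt (\sum_i x ord0 i ^+ 2).

(* ceil(s) - 1, a natural number for s > 0; note that it is s - 1, not s, when
   s is an integer. *)
Definition hoelder_order (s : R) : nat := absz (Num.ceil s - 1).

Definition hoelder_exponent (s : R) : R := s - (hoelder_order s)%:R.

Definition partial (i : 'I_d) F : 'rV[R]_d -> R :=
  'D_(delta_mx ord0 i : 'rV[R]_d) F.

Definition mpartial (g : 'I_d -> nat) F : 'rV[R]_d -> R :=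
  foldr (fun i => iter (g i) (partial i)) F (enum 'I_d).

(* Continuity of the partial derivatives makes the order of differentiation in
   [mpartial] irrelevant. *)
Fixpoint is_Ck (k : nat) Omega F : Prop :=
  {in Omega, continuous F} /\
  match k with
  | 0 => True
  | k'.+1 => forall i : 'I_d,
      (forall x, Omega x -> derivable F x (delta_mx ord0 i : 'rV[R]_d)) /\
      is_Ck k' Omega (partial i F)
  end.

Definition hoelder_seminorm (alpha : R) Omega F : \bar R :=
  ereal_sup [set r : \bar R | exists u v : 'rV[R]_d,
    [/\ Omega u, Omega v, u != v &
        r = (`|F u - F v| / eucl_norm (u - v) `^ alpha)%:E]].

(* [F] is arbitrary outside of [Omega], hence the restriction [_ \_ Omega]
   (extension by 0) in the L^oo norm. A multi-index of length at most [l]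
   takes its values in {0, ..., l}. *)
Definition hoelder_norm (s : R) Omega F : \bar R :=
  let l := hoelder_order s in
  (\sum_(g : {ffun 'I_d -> 'I_l.+1} | (\sum_i g i <= l)%N)
     Lnorm (lebesgue_rV R d) +oo
       (EFin \o ((mpartial (fun i => g i : nat) F) \_ Omega)) +
   \big[maxe/0]_(g : {ffun 'I_d -> 'I_l.+1} | (\sum_i g i == l)%N)
     hoelder_seminorm (hoelder_exponent s) Omega
       (mpartial (fun i => g i : nat) F))%E.

End hoelder_norm.

Section regression_model.
Context (R : realType) (d : nat).
Local Notation X := 'rV[R]_d.
Local Notation cube := (unit_cube R d).

(* [density], [regression] and [noise] matter on the unit cube only. *)
Record param := MkParam {
  density : X -> R;
  regression : X -> R;
  variance_level : R;
  noise : R.-pker X ~> R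
}.

Definition is_density (p : X -> R) : Prop :=
  [/\ measurable_fun cube p, (forall x, cube x -> 0 <= p x) &
      (\int[lebesgue_rV R d]_(x in cube) (p x)%:E = 1)%E].

Definition design_law (p : X -> R) (A : set X) : \bar R :=
  (\int[lebesgue_rV R d]_(x in A `&` cube) (p x)%:E)%E.

Definition Theta (s : R) (U : set X) (pm pp Ls vm vp C4 : R) :
    set param :=
  [set theta |
    let p := density theta in let f := regression theta in
    let V := variance_level theta in let Q := noise theta in
    [/\ is_density p /\
        {ae lebesgue_rV R d, forall x, cube x -> pm <= p x <= pp},
        exists F : X -> R, [/\ {in cube, F =1 f},
          is_Ck (hoelder_order s) U F &
          (hoelder_norm s U F <= Ls%:E)%E],
        {ae design_law p, forall x,
          [/\ (\int[Q x]_u u%:E = 0)%E,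
              (\int[Q x]_u (u ^+ 2)%:E = V%:E)%E &
              (\int[Q x]_u (u ^+ 4)%:E <= C4%:E)%E]} &
        vm <= V <= vp]].

(* [P] is the law of a pair (x, y) where x has density p on the cube and,
   given x, the error y - f x has law Q x. At most one [P] satisfies this;
   the restriction to subsets of the cube is harmless since x lies in the cube
   almost surely. *)
Definition is_law (theta : param) (P : probability (X * R)%type R) : Prop :=
  forall (A : set X) (B : set R), measurable A -> measurable B ->
    A `<=` cube ->
    P [set z | A z.1 /\ B (z.2 - regression theta z.1)] =
    (\int[lebesgue_rV R d]_(x in A)
       ((density theta x)%:E * noise theta x B))%E.

Definition rms_risk n (P : probability (X * R)%type R)
    (Vhat : n.-tuple (X * R)%type -> R) (V : R) : \bar R :=
  ('E_(iid P n)[fun z => ((Vhat z - V) ^+ 2)%R] `^ (2^-1)%R)%E.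

Definition minimax_risk (s : R) (U : set X) (pm pp Ls vm vp C4 : R) (n : nat) :
    \bar R :=
  ereal_inf [set r | exists2 Vhat : n.-tuple (X * R)%type -> R,
    measurable_fun setT Vhat &
    r = ereal_sup [set q | exists (theta : param)
                                  (P : probability (X * R)%type R),
          [/\ Theta s U pm pp Ls vm vp C4 theta, is_law theta P &
              q = rms_risk P Vhat (variance_level theta)]]].

End regression_model.

Definition minimax_rate (R : realType) (s : R) (d n : nat) : R :=
  Num.max (n%:R `^ (- 2^-1)) (n%:R `^ (- (4 * s / (d%:R + 4 * s)))).

(* Main.v *)
Require Import Defs.
From HB Require Import structures.
From mathcomp Require Import all_boot all_order all_algebra.
From mathcomp Require Import all_classical all_reals all_analysis.
From mathcomp Require Import measurable_realfun ess_sup_inf.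
From mathcomp Require Import ring lra zify.

Import Order.TTheory GRing.Theory Num.Theory.
Import numFieldNormedType.Exports.
Local Open Scope classical_set_scope.
Local Open Scope ring_scope.
Set Implicit Arguments.
Unset Strict Implicit.
Unset Printing Implicit Defensive.

(** Two observations whose designs lie close together nearly share the value
    of the regression function, so that half the squared difference of their
    responses estimates the variance V without any estimate of the regression
    function.  The rate balances the number of such pairs against the
    oscillation of the regression function between them.

    Upper bound.  Cut the cube into about M^d cells of side 1/M, split the
    sample into two halves of size m, and average (Y - Y')^2 / 2 over the pairs
    made of one observation of each half that fall in the same cell
    ([paired_estimator]).  On a cell the regression function oscillates by at
    most rho of order M^-s.  The noise is centred given the design, so that the
    regression function enters the mean only through its squared differences
    ([mean_pair_dev_bias]): the bias is of order rho^2.  The second moment of a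
    two-sample sum is controlled by three moments of its kernel, obtained by
    summing over one half at a time ([two_sample_second_moment]); they
    contribute variances of order M^d / m^2 and 1 / m.  The number of pairs is
    random; it is handled by the same second moment lemma, applied to the
    counting kernel, and by clipping the ratio to the known range of V
    ([clip_ratio_bound], [paired_risk]).  With M of order n^(2/(d+4s)), both
    rho^4 and M^d / n^2 have the order of the square of n^(-4s/(d+4s)).

    Lower bound.  The term n^(-1/2) comes from two models with constant zero
    regression function and variances that differ by a multiple of n^(-1/2).
    For the other term, compare a model with f = 0 and variance V + delta^2 to
    models with variance V whose regression function f has a sign chosen
    independently on each cell of a grid.  If f^2 averages to delta^2 over the
    signs, then Y has on average the same conditional mean and second moment in
    both, and the signs are hidden as long as few pairs of observations share a
    cell.  A Hoelder function has to vanish where it changes its sign; so f is a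
    sum of 2^d signed bump functions delta psi_c, one for each grid shifted by
    half a cell in some of the directions, vanishing on the faces of its own
    grid, with sum_c psi_c^2 = 1 ([bump_sqr_sum]).  As only the first two
    conditional moments matter, the responses live on the four atoms
    -b, -a, a, b, with weights affine in these moments ([model]).

    The bumps are introduced one grid at a time.  Given a test, some choice of
    the signs on the new grid raises the expectation of the test by at most
    eta ([perturbation_step]): averaging over the signs cancels the perturbation
    to first order, and the second moment of the averaged likelihood ratio is
    bounded by a product of hyperbolic cosines ([rademacher_mgf],
    [second_moment_method]).  After 2^d steps ([bump_chain]) the test separates
    no better than with error 1/2 ([two_point_bound]), which forces a risk of
    order delta^2; the Hoelder constraint allows delta of order M^-s. *)

(** * Mixtures and product powers of measures *)

(** Rectangles form a pi-system that generates the product sigma-algebra. *)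
Lemma measure_eq_rectangles d1 d2 (S : measurableType d1) (T : measurableType d2)
    (R : realType) (m1 m2 : {measure set (S * T) -> \bar R}) :
  (m1 setT < +oo)%E ->
  (forall A B, measurable A -> measurable B -> m1 (A `*` B) = m2 (A `*` B)) ->
  forall C, measurable C -> m1 C = m2 C.
Proof.
move=> fin eq12.
apply: (measure_unique [set A `*` B | A in measurable & B in measurable] (fun=> setT)).
- exact: measurable_prod_measurableType.
- move=> _ _ [A mA [B mB <-]] [A' mA' [B' mB' <-]].
  exists (A `&` A'); first exact: measurableI.
  exists (B `&` B'); first exact: measurableI.
  by rewrite setXI.
- by move=> i; exists setT => //; exists setT => //; rewrite setXTT.
- by apply/seteqP; split => // x _; exists 0%N.
- by move=> _ [A mA [B mB <-]]; exact: eq12.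
- by [].
Qed.

Section mixture_measure.
Local Open Scope ereal_scope.
Context dS dZ (S : measurableType dS) (Z : measurableType dZ) (R : realType).
Variables (mu : {measure set S -> \bar R}) (D : set S) (mD : measurable D)
  (k : S -> {measure set Z -> \bar R})
  (mk : forall C, measurable C -> measurable_fun [set: S] (fun x => k x C)).

Definition mixture_measure of measurable D &
    (forall C, measurable C -> measurable_fun [set: S] (fun x => k x C)) :=
  fun C => \int[mu]_(x in D) k x C.
Local Notation m := (mixture_measure mD mk).

Let m0 : m set0 = 0.
Proof. by rewrite /mixture_measure integral0_eq// => x _; rewrite measure0. Qed.

Let m_ge0 C : 0 <= m C.
Proof. exact: integral_ge0. Qed.

Let m_sigma_additive : semi_sigma_additive m.
Proof.
move=> U mU tU mUU; rewrite [X in _ --> X](_ : _ =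
  \int[mu]_(x in D) (\sum_(n <oo) k x (U n))); last first.
  apply: eq_integral => V _.
  by apply/esym/cvg_lim => //; exact/measure_semi_sigma_additive.
apply/cvg_closeP; split.
  by apply: is_cvg_nneseries => n _ _; exact: integral_ge0.
rewrite closeE// integral_nneseries// => n.
exact: measurable_funTS (mk (mU n)).
Qed.

HB.instance Definition _ := isMeasure.Build _ _ R m m0 m_ge0 m_sigma_additive.

Definition mixture_meas : {measure set Z -> \bar R} := m.

End mixture_measure.

Section as_probability.
Context dT (T : measurableType dT) (R : realType).

(** The total mass is an argument so that it can feed the probability
    structure: a value of a probability kernel is only known as a measure. *)
Definition as_probability (m : {measure set T -> \bar R}) of m setT = 1%E :
  set T -> \bar R := m.

HB.instance Definition _ (m : {measure set T -> \bar R}) (m1 : m setT = 1%E) :=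
  Measure.copy (as_probability m1) m.
HB.instance Definition _ (m : {measure set T -> \bar R}) (m1 : m setT = 1%E) :=
  Measure_isProbability.Build _ _ _ (as_probability m1) m1.

End as_probability.

Section mixtures.
Local Open Scope ereal_scope.
Context d d' (S : measurableType d) (Z : measurableType d') (R : realType).
Import HBNNSimple.

(** The identity holds for indicators by assumption, hence for simple
    functions by linearity and for nonnegative functions by monotone
    convergence. *)
Lemma ge0_integral_mixture (mu : {measure set S -> \bar R})
    (D : set S) (mD : measurable D)
    (k : S -> {measure set Z -> \bar R}) (m : {measure set Z -> \bar R}) :
  (forall C, measurable C ->
     measurable_fun [set: S] (fun x => k x C : \bar R)) ->
  (forall C, measurable C -> m C = \int[mu]_(x in D) k x C) ->
  forall f : Z -> \bar R, measurable_fun setT f -> (forall z, 0 <= f z) ->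
  \int[m]_z f z = \int[mu]_(x in D) \int[k x]_z f z.
Proof.
move=> mk mE f mf f0.
have mkI (g : Z -> \bar R) : measurable_fun setT g -> (forall z, 0 <= g z) ->
    measurable_fun D (fun x => \int[k x]_z g z).
  move=> mg g0; apply: measurable_funS (measurable_fun_integral_kernel mk g0 mg) => //.
have Eind C : measurable C ->
    \int[m]_z (\1_C z)%:E = \int[mu]_(x in D) \int[k x]_z (\1_C z)%:E.
  move=> mC; rewrite integral_indic// setIT mE//.
  by apply: eq_integral => x _; rewrite integral_indic// setIT.
have Esf (g : {nnsfun Z >-> R}) :
    \int[m]_z (g z)%:E = \int[mu]_(x in D) \int[k x]_z (g z)%:E.
  have Eg x : \int[k x]_z (g z)%:E =
      \sum_(r \in range g) \int[k x]_z (r * \1_(g @^-1` [set r]) z)%:E.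
    under eq_integral do rewrite fimfunE -fsumEFin//.
    rewrite ge0_integral_fsum//.
      by move=> r; exact/measurable_EFinP/measurableT_comp.
    by move=> r z _; rewrite EFinM nnfun_muleindic_ge0.
  under [LHS]eq_integral do rewrite fimfunE -fsumEFin//.
  rewrite ge0_integral_fsum//; last 2 first.
  - by move=> r; exact/measurable_EFinP/measurableT_comp.
  - by move=> r z _; rewrite EFinM nnfun_muleindic_ge0.
  under [RHS]eq_integral do rewrite Eg.
  have rg0 (r : R) : (exists z, g z = r) \/ g @^-1` [set r] = set0.
    have [->|/set0P[z]] := eqVneq (g @^-1` [set r]) set0; first by right.
    by move=> zr; left; exists z.
  have scal (mm : {measure set Z -> \bar R}) r :
      \int[mm]_z (r * \1_(g @^-1` [set r]) z)%:E =
      r%:E * \int[mm]_z (\1_(g @^-1` [set r]) z)%:E.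
    rewrite (integralZl_indic _ (fun r => g @^-1` [set r]))//.
    by move=> r0; rewrite preimage_nnfun0.
  have ge0 x r : 0 <= \int[k x]_z (r * \1_(g @^-1` [set r]) z)%:E.
    case: (rg0 r) => [[z <-]|->].
      by apply: integral_ge0 => w _; rewrite lee_fin mulr_ge0.
    by rewrite integral0_eq// => w _; rewrite indic0 mulr0.
  rewrite ge0_integral_fsum//; last first.
    move=> r; under eq_fun do rewrite scal.
    apply: measurable_funeM; apply: mkI => //.
    exact/measurable_EFinP.
  apply: eq_fsbigr => r _; rewrite scal Eind//.
  under [RHS]eq_integral do rewrite scal.
  case: (rg0 r) => [[z <-]|->].
    rewrite ge0_integralZl//; first by apply: mkI => //; exact/measurable_EFinP.
      by move=> x _; apply: integral_ge0 => w _; rewrite lee_fin.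
    by rewrite lee_fin.
  rewrite !integral0_eq ?mule0// => x _; rewrite integral0_eq ?mule0// => w _;
   by rewrite indic0.
pose g := nnsfun_approx measurableT mf.
have appr (mm : {measure set Z -> \bar R}) :
    \int[mm]_z f z = limn (fun n => \int[mm]_z (g n z)%:E).
  rewrite -monotone_convergence//; last 3 first.
  - by move=> n; exact/measurable_EFinP.
  - by move=> n z _; rewrite lee_fin.
  - by move=> z _ a b ab; rewrite lee_fin; exact/lefP/nd_nnsfun_approx.
  by apply: eq_integral => z _; apply/esym/cvg_lim => //; exact: cvg_nnsfun_approx.
rewrite appr; under [RHS]eq_integral do rewrite appr.
rewrite monotone_convergence//.
- by congr (limn _); apply/funext => n; exact: Esf.
- move=> n; apply: mkI => [|z]; last by rewrite lee_fin.
  exact/measurable_EFinP.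
- by move=> n x _; apply: integral_ge0 => z _; rewrite lee_fin.
- move=> x _ a b ab; apply: ge0_le_integral => //.
  + by move=> z _; rewrite lee_fin.
  + exact/measurable_EFinP.
  + exact/measurable_EFinP.
  + by move=> z _; rewrite lee_fin; exact/lefP/nd_nnsfun_approx.
Qed.

End mixtures.

Section powers.
Local Open Scope ereal_scope.
Context d (T : measurableType d) (R : realType).

Lemma ge0_integral_powmS (mu : {sigma_finite_measure set T -> \bar R}) n
    (G : n.+1.-tuple T -> \bar R) :
  measurable_fun setT G -> (forall t, 0 <= G t) ->
  \int[powm mu n.+1]_t G t = \int[mu]_x \int[powm mu n]_t G (tcons (x, t)).
Proof.
move=> mG G0.
rewrite -[LHS]/(\int[pushforward (mu \x powm mu n) (@tcons T n)]_t G t).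
have mt := @measurable_tcons _ T n.
rewrite (@ge0_integral_pushforward _ _ _ _ _ _ mt (mu \x powm mu n)%E)//.
rewrite preimage_setT fubini_tonelli1//; first exact: measurableT_comp.
by move=> x; exact: G0.
Qed.

Lemma ge0_integral_powm0 (mu : {sigma_finite_measure set T -> \bar R})
    (G : 0.-tuple T -> \bar R) :
  measurable_fun setT G -> \int[powm mu 0]_t G t = G [tuple].
Proof. by move=> mG; rewrite integral_dirac// diracT mul1e. Qed.

Lemma measurable_powmS_fiber n (mu : {sigma_finite_measure set T -> \bar R})
    (G : n.+1.-tuple T -> \bar R) :
  measurable_fun setT G -> (forall t, 0 <= G t) ->
  measurable_fun setT (fun x => \int[powm mu n]_t G (tcons (x, t))).
Proof.
move=> mG G0.
apply: (@measurable_fun_fubini_tonelli_F _ _ _ _ _ (powm mu n)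
  (fun p => G (tcons p))) => //.
apply: measurableT_comp => //; exact: measurable_tcons.
Qed.

Lemma integral_probability_cst (P : probability T R) (c : \bar R) :
  \int[P]_x c = c.
Proof.
by rewrite integral_cst//= (@probability_setT _ _ _ P) mule1.
Qed.

Lemma measurable_prod_tnth n (h : T -> \bar R) :
  measurable_fun setT h ->
  measurable_fun setT (fun t : n.-tuple T => \prod_(i < n) h (tnth t i)).
Proof.
move=> mh; elim: n => [|n IH].
  apply: (eq_measurable_fun (cst 1)) => // t _.
  by rewrite big_ord0.
have -> : (fun t : n.+1.-tuple T => \prod_(i < n.+1) h (tnth t i)) =
   (fun p : T * n.-tuple T => h p.1 * \prod_(i < n) h (tnth p.2 i)) \o @tuncons T n.
  apply/funext => t /=; rewrite big_ord_recl; congr (_ * _).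
  by apply: eq_bigr => i _; rewrite [in LHS](tuple_eta t) tnthS.
apply: measurableT_comp; last exact: measurable_tuncons.
apply: emeasurable_funM; first exact: measurableT_comp.
exact: (measurableT_comp IH).
Qed.

Lemma prod_tnth_tcons n (h : T -> \bar R) x (t : n.-tuple T) :
  \prod_(i < n.+1) h (tnth (tcons (x, t)) i) = h x * \prod_(i < n) h (tnth t i).
Proof.
by rewrite big_ord_recl; congr (_ * _); apply: eq_bigr => i _; rewrite tnthS.
Qed.

Lemma prode_ge0' n (F : 'I_n -> \bar R) : (forall i, 0 <= F i) ->
  0 <= \prod_i F i.
Proof. by move=> F0; elim/big_ind : _ => // x y; exact: mule_ge0. Qed.

Lemma integral_prod_tnth (P : {sigma_finite_measure set T -> \bar R}) n (h : T -> \bar R) :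
  measurable_fun setT h -> (forall x, 0 <= h x) ->
  \int[powm P n]_t (\prod_(i < n) h (tnth t i)) = (\int[P]_x h x) ^+ n.
Proof.
move=> mh h0; elim: n => [|n IH].
  by rewrite ge0_integral_powm0 ?big_ord0//; exact: measurable_prod_tnth.
rewrite ge0_integral_powmS//; last 2 first.
- exact: measurable_prod_tnth.
- by move=> t; exact: prode_ge0'.
under eq_integral do under eq_integral do rewrite prod_tnth_tcons.
under eq_integral => x _.
  rewrite ge0_integralZl//; last 2 first.
  - exact: measurable_prod_tnth.
  - by move=> t _; exact: prode_ge0'.
  rewrite IH; over.
rewrite ge0_integralZr//.
  by rewrite expeS.
by rewrite expe_ge0// integral_ge0.
Qed.

(** Densities multiply: the likelihood ratio of n independent observations is
    the product of the individual ratios. *)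
Lemma integral_powm_density (P P' : {sigma_finite_measure set T -> \bar R}) (w : T -> \bar R) :
  measurable_fun setT w -> (forall x, 0 <= w x) ->
  (forall f, measurable_fun setT f -> (forall x, 0 <= f x) ->
     \int[P']_x f x = \int[P]_x (w x * f x)) ->
  forall n (G : n.-tuple T -> \bar R), measurable_fun setT G -> (forall t, 0 <= G t) ->
  \int[powm P' n]_t G t =
  \int[powm P n]_t ((\prod_(i < n) w (tnth t i)) * G t).
Proof.
move=> mw w0 dens; elim=> [|n IH] G mG G0.
  rewrite !ge0_integral_powm0//; first by rewrite big_ord0 mul1e.
  apply: emeasurable_funM => //; exact: measurable_prod_tnth.
have mGx x : measurable_fun setT (fun t => G (tcons (x, t))).
  apply: (measurableT_comp mG).
  by apply: (measurableT_comp (@measurable_tcons _ T n)); exact: pair1_measurable.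
have mp := measurable_prod_tnth (n := n) mw.
rewrite !ge0_integral_powmS//; last 2 first.
- by apply: emeasurable_funM => //; exact: measurable_prod_tnth.
- by move=> t; rewrite mule_ge0//; exact: prode_ge0'.
under eq_integral do rewrite IH//.
rewrite dens; last 2 first.
- pose G' t := (\prod_(i < n) w (tnth (tuncons t).2 i)) * G t.
  apply: (eq_measurable_fun (fun x => \int[powm P n]_t G' (tcons (x, t)))).
    by move=> x _; apply: eq_integral => t _; rewrite /G' tconsK.
  apply: measurable_powmS_fiber; last by move=> t; rewrite mule_ge0//; exact: prode_ge0'.
  apply: emeasurable_funM => //.
  apply: (measurableT_comp (f := fun p : T * n.-tuple T => \prod_(i < n) w (tnth p.2 i))).
    exact: (measurableT_comp mp).
  exact: measurable_tuncons.
- by move=> x; apply: integral_ge0 => t _; rewrite mule_ge0//; exact: prode_ge0'.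
apply: eq_integral => x _; rewrite -ge0_integralZl//.
- by apply: eq_integral => t _; rewrite prod_tnth_tcons muleA.
- by apply: emeasurable_funM => //.
- by move=> t _; rewrite mule_ge0//; exact: prode_ge0'.
Qed.

Lemma measurable_cat_tuple k n :
  measurable_fun [set: k.-tuple T * n.-tuple T] (fun p => [tuple of p.1 ++ p.2]).
Proof.
apply/measurable_fun_tnthP => i /=.
have [j ->|j ->] := split_ordP i.
- apply: (eq_measurable_fun (fun p : k.-tuple T * n.-tuple T => tnth p.1 j)).
    by move=> p _ /=; rewrite tnth_lshift.
  by apply: (measurableT_comp (measurable_tnth j)); exact: measurable_fst.
- apply: (eq_measurable_fun (fun p : k.-tuple T * n.-tuple T => tnth p.2 j)).
    by move=> p _ /=; rewrite tnth_rshift.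
  by apply: (measurableT_comp (measurable_tnth j)); exact: measurable_snd.
Qed.

(** Splitting an independent sample into two independent samples. *)
Lemma ge0_integral_powm_cat (P : probability T R) k n (G : (k + n).-tuple T -> \bar R) :
  measurable_fun setT G -> (forall t, 0 <= G t) ->
  \int[powm P (k + n)]_t G t =
  \int[powm P k]_s \int[powm P n]_t G [tuple of s ++ t].
Proof.
elim: k G => [|k IH] G mG G0.
  rewrite ge0_integral_powm0.
    by apply: eq_integral => t _; congr G; exact: val_inj.
  apply: (@measurable_fun_fubini_tonelli_F _ _ _ _ _ (powm P n)
    (fun p : 0.-tuple T * n.-tuple T => G [tuple of p.1 ++ p.2])) => //.
  by apply: measurableT_comp => //; exact: measurable_cat_tuple.
have mC : measurable_fun setT (fun p : k.+1.-tuple T * n.-tuple T => G [tuple of p.1 ++ p.2]).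
  by apply: measurableT_comp => //; exact: measurable_cat_tuple.
rewrite [RHS]ge0_integral_powmS//; last 2 first.
- exact: (@measurable_fun_fubini_tonelli_F _ _ _ _ _ (powm P n) (fun p : k.+1.-tuple T * n.-tuple T => G [tuple of p.1 ++ p.2])).
- by move=> t; exact: integral_ge0.
rewrite (@ge0_integral_powmS P (k + n) G)//.
have mGx x : measurable_fun setT (fun t => G (tcons (x, t))).
  by apply: measurableT_comp => //; apply: measurableT_comp; [exact: measurable_tcons|exact: pair1_measurable].
apply: eq_integral => x _; apply: (eq_trans (IH _ (mGx x) (fun t => G0 _))).
by apply: eq_integral => s _; apply: eq_integral => t _; congr G; exact: val_inj.
Qed.

Lemma ge0_integral_powm_widen (P : probability T R) k n (le_kn : (k <= n)%N)
    (G : k.-tuple T -> \bar R) :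
  measurable_fun setT G -> (forall t, 0 <= G t) ->
  \int[powm P n]_t G [tuple tnth t (widen_ord le_kn i) | i < k] = \int[powm P k]_t G t.
Proof.
move=> mG G0; have [m nE] : exists m, n = (k + m)%N by exists (n - k)%N; rewrite subnKC.
subst n; pose pr (t : (k + m).-tuple T) := [tuple tnth t (widen_ord le_kn i) | i < k].
have mpr : measurable_fun setT pr.
  apply/measurable_fun_tnthP => i /=.
  apply: (eq_measurable_fun (fun t : (k + m).-tuple T => tnth t (widen_ord le_kn i))).
    by move=> t _; rewrite /= tnth_mktuple.
  exact: measurable_tnth.
rewrite (ge0_integral_powm_cat P (G := fun t => G (pr t)))//; last exact: measurableT_comp.
apply: eq_integral => s _; transitivity (\int[powm P m]_t G s).
  apply: eq_integral => t _; congr G; apply: eq_from_tnth => i.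
  rewrite tnth_mktuple (_ : widen_ord le_kn i = lshift m i) ?tnth_lshift//.
  exact: val_inj.
by rewrite (integral_cst (powm P m))//= (@powm_setT _ _ _ P) mule1.
Qed.

End powers.

(** * Averaging over random signs *)

Section rademacher.
Variable R : realType.

(** Both exponentials are bounded through e^y <= 1 / (1 - y), whose symmetric
    sum is 2 / (1 - x^2). *)
Lemma cosh_le_expR (x : R) : x ^+ 2 <= 2^-1 ->
  expR x + expR (- x) <= 2 * expR (2 * x ^+ 2).
Proof.
move=> x2.
have x21 : x ^+ 2 < 1 by lra.
have x1 : -1 < x < 1 by apply/andP; split; nra.
have [xl xr] := andP x1.
have inv_le (y : R) : y < 1 -> expR y <= (1 - y)^-1.
  move=> y1; rewrite -[leLHS]invrK lef_pV2 ?posrE; last 2 first.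
  - by rewrite invr_gt0 expR_gt0.
  - by rewrite subr_gt0.
  by rewrite -expRN; exact: expR_ge1Dx.
have e1 := inv_le _ xr.
have e2 : expR (- x) <= (1 + x)^-1 by rewrite -[in leRHS](opprK x); apply: inv_le; lra.
apply: (@le_trans _ _ (2 / (1 - x ^+ 2))).
  apply: (le_trans (lerD e1 e2)).
  rewrite le_eqVlt; apply/orP; left; apply/eqP; field.
  by apply/and3P; split; apply/eqP => h; nra.
rewrite ler_pM2l//.
apply: (@le_trans _ _ (1 + 2 * x ^+ 2)); last exact: expR_ge1Dx.
rewrite -[leLHS]mul1r ler_pdivrMr; last lra.
by have := sqr_ge0 x; nra.
Qed.

(** A family of signs is encoded by booleans. *)
Definition sgb (b : bool) : R := (-1) ^+ b.

Lemma sgb_sqr b : sgb b * sgb b = 1.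
Proof. by rewrite -expr2 sqrr_sign. Qed.

(** After 1 + u <= e^u the sum over r' factorizes over j into hyperbolic
    cosines of n a_j.  The signs of r are absorbed by the symmetry of cosh. *)
Lemma rademacher_mgf (I : finType) (a : I -> R) (n : nat) :
  (forall j, (n%:R * a j) ^+ 2 <= 2^-1) ->
  (forall r r' : {ffun I -> bool},
     0 <= 1 + \sum_j sgb (r j) * sgb (r' j) * a j) ->
  \sum_(r : {ffun I -> bool}) \sum_(r' : {ffun I -> bool})
     (1 + \sum_j sgb (r j) * sgb (r' j) * a j) ^+ n
  <= (#|{ffun I -> bool}|%:R) ^+ 2 * expR (2 * n%:R ^+ 2 * \sum_j a j ^+ 2).
Proof.
move=> an pos.
have Ncard : #|{ffun I -> bool}|%:R = \prod_(j : I) 2 :> R.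
  by rewrite card_ffun card_bool prodr_const natrX.
rewrite expr2 -mulrA mulr_natl -sumr_const.
apply: ler_sum => r _.
apply: (@le_trans _ _ (\sum_(r' : {ffun I -> bool}) \prod_j
    expR (n%:R * (sgb (r j) * sgb (r' j) * a j)))).
  apply: ler_sum => r' _.
  apply: (@le_trans _ _ (expR (\sum_j sgb (r j) * sgb (r' j) * a j) ^+ n)).
    by rewrite lerXn2r ?nnegrE ?expR_ge0// expR_ge1Dx.
  rewrite -expRM_natl mulr_sumr expR_sum//.
rewrite -(bigA_distr_bigA (fun j (b : bool) => expR (n%:R * (sgb (r j) * sgb b * a j)))).
rewrite Ncard mulr_sumr expR_sum -big_split/=.
apply: ler_prod => j _; apply/andP; split; first by apply: sumr_ge0 => b _; exact: expR_ge0.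
rewrite big_bool/=.
apply: (@le_trans _ _ (expR (n%:R * a j) + expR (- (n%:R * a j)))).
  rewrite /sgb; case: (r j); rewrite !(expr0, expr1) ?(mulN1r, mulr1, mul1r, opprK, mulrN).
    by [].
  by rewrite addrC.
by rewrite -mulrA -exprMn; exact: cosh_le_expR.
Qed.

End rademacher.

Section second_moment.
Context d (T : measurableType d) (R : realType) (P : probability T R).
Context (I : finType) (h : {ffun I -> bool} -> T -> R) (a : I -> R).
Local Open Scope ereal_scope.
Hypothesis mh : forall r, measurable_fun setT (h r).
Hypothesis h0 : forall r x, (0 <= h r x)%R.
Hypothesis h1 : forall r, \int[P]_x (h r x)%:E = 1.
Hypothesis h2 : forall r r', \int[P]_x (h r x * h r' x)%:E =
  (1 + \sum_j sgb R (r j) * sgb R (r' j) * a j)%R%:E.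

Local Notation N := (#|{ffun I -> bool}|%:R : R).

Let N0 : (0 < N)%R.
Proof. by rewrite ltr0n card_ffun card_bool expn_gt0. Qed.

Let H n r (t : n.-tuple T) : R := (\prod_(i < n) h r (tnth t i))%R.

Let H0 n r (t : n.-tuple T) : (0 <= H r t)%R.
Proof. by apply: prodr_ge0 => i _; exact: h0. Qed.

Let EH n r (t : n.-tuple T) : (H r t)%:E = \prod_(i < n) (h r (tnth t i))%:E.
Proof. by rewrite prodEFin. Qed.

Let mH n r : measurable_fun setT (@H n r).
Proof.
apply/measurable_EFinP.
apply: (eq_measurable_fun (fun t : n.-tuple T => \prod_(i < n) (h r (tnth t i))%:E)).
  by move=> t _; rewrite /= EH.
by apply: (measurable_prod_tnth (h := EFin \o h r)); exact/measurable_EFinP.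
Qed.

Let intH n r : \int[powm P n]_t (@H n r t)%:E = 1.
Proof.
under eq_integral do rewrite EH.
rewrite (integral_prod_tnth P n (h := EFin \o h r))//=.
- by rewrite h1 -EFin_expe expr1n.
- exact/measurable_EFinP.
- by move=> x; rewrite lee_fin.
Qed.

Let intHH n r r' : \int[powm P n]_t (@H n r t * @H n r' t)%:E =
  ((1 + \sum_j sgb R (r j) * sgb R (r' j) * a j) ^+ n)%R%:E.
Proof.
transitivity (\int[powm P n]_t \prod_(i < n)
   ((fun x => (h r x * h r' x)%:E) (tnth t i))).
  by apply: eq_integral => t _; rewrite prodEFin big_split.
rewrite (integral_prod_tnth P n (h := fun x => (h r x * h r' x)%:E))//=.
- by rewrite h2 EFin_expe.
- by apply/measurable_EFinP; exact: measurable_funM.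
- by move=> x; rewrite lee_fin mulr_ge0.
Qed.

Let pos (r r' : {ffun I -> bool}) : (0 <= 1 + \sum_j sgb R (r j) * sgb R (r' j) * a j)%R.
Proof.
by rewrite -lee_fin -h2; apply: integral_ge0 => x _; rewrite lee_fin mulr_ge0.
Qed.

Let L n (t : n.-tuple T) : R := (N^-1 * \sum_r H r t)%R.

Let L0 n (t : n.-tuple T) : (0 <= L t)%R.
Proof. by rewrite mulr_ge0 ?invr_ge0 ?(ltW N0)// sumr_ge0. Qed.

Let mL n : measurable_fun setT (@L n).
Proof. by apply: measurable_funM => //; apply: measurable_sum => r; exact: mH. Qed.

Let intL n : \int[powm P n]_t (@L n t)%:E = 1.
Proof.
under eq_integral do rewrite EFinM.
rewrite ge0_integralZl//; last 2 first.
- by apply/measurable_EFinP; apply: measurable_sum => r; exact: mH.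
- by move=> t _; rewrite lee_fin sumr_ge0.
under eq_integral do rewrite -sumEFin.
rewrite ge0_integral_sum//; last 2 first.
- by move=> r; apply/measurable_EFinP; exact: mH.
- by move=> r t _; rewrite lee_fin.
under eq_bigr do rewrite intH.
rewrite sumEFin -EFinM; congr (_%:E).
by rewrite sumr_const -mulr_natl mulr1 mulVf// gt_eqF.
Qed.

Let intLL n : (forall j, (n%:R * a j) ^+ 2 <= 2^-1)%R ->
  \int[powm P n]_t (@L n t ^+ 2)%:E <= (expR (2 * n%:R ^+ 2 * \sum_j a j ^+ 2))%:E.
Proof.
move=> an.
have E (t : n.-tuple T) : (L t ^+ 2 =
    N^-1 ^+ 2 * \sum_(r : {ffun I -> bool}) \sum_(r' : {ffun I -> bool}) H r t * H r' t)%R.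
  rewrite exprMn; congr (_ * _)%R; rewrite expr2 mulr_suml.
  by apply: eq_bigr => r _; rewrite mulr_sumr.
under eq_integral do rewrite E EFinM.
rewrite ge0_integralZl//; last 2 first.
- apply/measurable_EFinP; apply: measurable_sum => r; apply: measurable_sum => r'.
  by apply: measurable_funM; exact: mH.
- by move=> t _; rewrite lee_fin; apply: sumr_ge0 => r _; apply: sumr_ge0 => r' _; rewrite mulr_ge0.
under eq_integral do rewrite -sumEFin.
rewrite ge0_integral_sum//; last 2 first.
- move=> r; apply/measurable_EFinP; apply: measurable_sum => r'.
  by apply: measurable_funM; exact: mH.
- by move=> r t _; rewrite lee_fin; apply: sumr_ge0 => r' _; rewrite mulr_ge0.
have E2 (r : {ffun I -> bool}) : \int[powm P n]_t (\sum_(r' : {ffun I -> bool}) @H n r t * @H n r' t)%R%:E =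
    (\sum_(r' : {ffun I -> bool}) (1 + \sum_j sgb R (r j) * sgb R (r' j) * a j) ^+ n)%R%:E.
  under eq_integral do rewrite -sumEFin.
  rewrite ge0_integral_sum//; last 2 first.
  - by move=> r'; apply/measurable_EFinP; apply: measurable_funM; exact: mH.
  - by move=> r' t _; rewrite lee_fin mulr_ge0.
  by rewrite -sumEFin; apply: eq_bigr => r' _; rewrite intHH.
under eq_bigr do rewrite E2.
rewrite sumEFin -EFinM lee_fin.
rewrite exprVn ler_pdivrMl ?exprn_gt0//.
exact: rademacher_mgf.
Qed.

(** Ingster's method.  Write L for the average over r of the likelihood ratios
    of the n-samples.  Averaged over r, the expectation of phi under the tilted
    laws exceeds its expectation under P by at most E |L - 1|, which is at most
    lam / 2 + E (L - 1)^2 / (2 lam); and E L^2 is the Rademacher sum above.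
    Some r does no worse than the average. *)
Lemma second_moment_method n (phi : n.-tuple T -> R) (lam : R) :
  (0 < lam)%R ->
  (forall j, (n%:R * a j) ^+ 2 <= 2^-1)%R ->
  measurable_fun setT phi -> (forall t, 0 <= phi t <= 1)%R ->
  exists r, \int[powm P n]_t ((\prod_(i < n) h r (tnth t i)) * phi t)%:E <=
    \int[powm P n]_t (phi t)%:E +
    (lam / 2 + (expR (2 * n%:R ^+ 2 * \sum_j a j ^+ 2) - 1) / (2 * lam))%:E.
Proof.
move=> lam0 an mphi phi01.
set X := expR _.
have mL1 : measurable_fun setT (fun t : n.-tuple T => 1 - L t)%R.
  by apply: measurable_funB => //; exact: mL.
have phi0 t : (0 <= phi t)%R by have /andP[] := phi01 t.
have chi : \int[powm P n]_t ((1 - L t) ^+ 2)%:E <= (X - 1)%:E.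
  have : \int[powm P n]_t ((1 - L t) ^+ 2)%:E + \int[powm P n]_t (2 * L t)%:E =
      \int[powm P n]_t 1 + \int[powm P n]_t (L t ^+ 2)%:E.
    rewrite -!ge0_integralD//.
    - by apply: eq_integral => t _; rewrite -!EFinD; congr (_%:E); ring.
    - by move=> t _; rewrite lee_fin sqr_ge0.
    - by apply/measurable_EFinP; apply: measurable_funX; exact: mL.
    - by move=> t _; rewrite lee_fin sqr_ge0.
    - by apply/measurable_EFinP; exact: measurable_funX.
    - by move=> t _; rewrite lee_fin mulr_ge0.
    - by apply/measurable_EFinP; apply: measurable_funM => //; exact: mL.
  under [X in _ + X = _]eq_integral do rewrite EFinM.
  rewrite ge0_integralZl//; last 2 first.
  - by apply/measurable_EFinP; exact: mL.
  - by move=> t _; rewrite lee_fin.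
  rewrite intL mule1 (integral_cst (powm P n))//= (@powm_setT _ _ _ P) mule1.
  move=> E; have : \int[powm P n]_t ((1 - L t) ^+ 2)%:E + 2%:E <= 1 + X%:E.
    by rewrite E leeD2l// intLL.
  have : 0 <= \int[powm P n]_t ((1 - L t) ^+ 2)%:E.
    by apply: integral_ge0 => t _; rewrite lee_fin sqr_ge0.
  move: (\int[powm P n]_t ((1 - L t) ^+ 2)%:E) => [x||]//= _.
  by rewrite -EFinD !lee_fin; lra.
have absL : \int[powm P n]_t (`|1 - L t|)%:E <= (lam / 2 + (X - 1) / (2 * lam))%:E.
  apply: (@le_trans _ _ (\int[powm P n]_t ((lam / 2)%:E + ((2 * lam)^-1)%:E * ((1 - L t) ^+ 2)%:E))).
    apply: ge0_le_integral => //.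
    - by apply/measurable_EFinP; exact: measurableT_comp.
    - apply: emeasurable_funD => //; apply: measurable_funeM.
      by apply/measurable_EFinP; exact: measurable_funX.
    - move=> t _; rewrite -EFinM -EFinD lee_fin.
      have : (0 <= (`|1 - L t| - lam) ^+ 2 / (2 * lam))%R.
        by rewrite divr_ge0 ?sqr_ge0// mulr_ge0 ?ltW.
      have -> : ((`|1 - L t| - lam) ^+ 2 / (2 * lam) =
        lam / 2 + (2 * lam)^-1 * (1 - L t) ^+ 2 - `|1 - L t|)%R.
        by rewrite -(real_normK (num_real (1 - L t)%R)); field; rewrite gt_eqF.
      lra.
  rewrite ge0_integralD//; last 3 first.
  - by move=> t _; rewrite lee_fin divr_ge0 ?ltW.
  - by move=> t _; rewrite mule_ge0// lee_fin ?sqr_ge0 ?invr_ge0 ?mulr_ge0 ?ltW.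
  - apply: measurable_funeM.
    by apply/measurable_EFinP; exact: measurable_funX.
  rewrite (integral_cst (powm P n))//= (@powm_setT _ _ _ P) mule1.
  rewrite ge0_integralZl//; last 3 first.
  - by apply/measurable_EFinP; exact: measurable_funX.
  - by move=> t _; rewrite lee_fin sqr_ge0.
  - by rewrite lee_fin invr_ge0 mulr_ge0 ?ltW.
  rewrite [leRHS]EFinD leeD2l// (mulrC (X - 1)%R) [leRHS]EFinM.
  by rewrite lee_wpmul2l// lee_fin invr_ge0 mulr_ge0 ?ltW.
have phi1 : \int[powm P n]_t (phi t)%:E <= 1.
  have -> : 1 = \int[powm P n]_t 1 by rewrite (integral_cst (powm P n))//= (@powm_setT _ _ _ P) mule1.
  apply: ge0_le_integral => //; first by move=> t _; rewrite lee_fin.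
  - exact/measurable_EFinP.
  - by move=> t _; rewrite lee_fin; have /andP[] := phi01 t.
have fphi : \int[powm P n]_t (phi t)%:E \is a fin_num.
  rewrite ge0_fin_numE; first exact: le_lt_trans phi1 (ltry _).
  by apply: integral_ge0 => t _; rewrite lee_fin.
set B := (lam / 2 + _)%R.
have mean : \sum_r \int[powm P n]_t (H r t * phi t)%:E <=
    N%:E * (\int[powm P n]_t (phi t)%:E + B%:E).
  rewrite -ge0_integral_sum//; last 2 first.
  - by move=> r; apply/measurable_EFinP; apply: measurable_funM => //; exact: mH.
  - by move=> r t _; rewrite lee_fin mulr_ge0.
  apply: (@le_trans _ _ (\int[powm P n]_t (N%:E * ((phi t)%:E + (`|1 - L t|)%:E)))).
    apply: ge0_le_integral => //.
    - by move=> t _; apply: sume_ge0 => r _; rewrite lee_fin mulr_ge0.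
    - by apply: emeasurable_sum => r; apply/measurable_EFinP; apply: measurable_funM => //; exact: mH.
    - apply: measurable_funeM; apply: emeasurable_funD; first exact/measurable_EFinP.
      by apply/measurable_EFinP; exact: measurableT_comp.
    - move=> t _; rewrite sumEFin -EFinD -EFinM lee_fin -mulr_suml.
      have -> : (\sum_r H r t = N * L t)%R by rewrite /L mulrA divff ?mul1r// gt_eqF.
      rewrite -mulrA ler_pM2l//.
      have /andP[p0 p1] := phi01 t.
      have : (L t - 1 <= `|1 - L t|)%R by rewrite -normrN opprB ler_norm.
      have := normr_ge0 (1 - L t)%R.
      nra.
  rewrite ge0_integralZl//; last 2 first.
  - apply: emeasurable_funD; first exact/measurable_EFinP.
    by apply/measurable_EFinP; exact: measurableT_comp.
  - by move=> t _; rewrite -EFinD lee_fin addr_ge0.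
  rewrite lee_pmul2l ?lte_fin// ge0_integralD//; last 3 first.
  - by move=> t _; rewrite lee_fin.
  - exact/measurable_EFinP.
  - by apply/measurable_EFinP; exact: measurableT_comp.
  by rewrite leeD2l.
have fH r : \int[powm P n]_t (H r t * phi t)%:E \is a fin_num.
  rewrite ge0_fin_numE; last by apply: integral_ge0 => t _; rewrite lee_fin mulr_ge0.
  apply: (@le_lt_trans _ _ 1); last exact: ltry.
  rewrite -(intH n r); apply: ge0_le_integral => //.
  - by move=> t _; rewrite lee_fin mulr_ge0.
  - by apply/measurable_EFinP; apply: measurable_funM => //; exact: mH.
  - by apply/measurable_EFinP; exact: mH.
  - by move=> t _; rewrite lee_fin ler_piMr//; have /andP[] := phi01 t.
apply: contrapT => /forallNP no.
move: mean; apply/negP; rewrite -ltNge.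
rewrite -(fineK fphi) -EFinD -EFinM.
under eq_bigr do rewrite -(fineK (fH _)).
rewrite sumEFin lte_fin.
have -> : (N * (fine (\int[powm P n]_t (phi t)%:E) + B) =
   \sum_(r : {ffun I -> bool}) (fine (\int[powm P n]_t (phi t)%:E) + B))%R.
  by rewrite sumr_const mulr_natl.
apply: ltr_sum; last first.
  move=> r _; rewrite -lte_fin EFinD !fineK//.
  by rewrite ltNge; apply/negP; exact: no.
by apply/hasP; exists [ffun=> true] => //; rewrite mem_index_enum.
Qed.

End second_moment.

(** * The grid on the unit cube *)

Section grid.
Variable R : realType.

Definition clamp (t : R) : R := Num.min (Num.max t 0) 1.

Lemma clamp_itv t : 0 <= clamp t <= 1.
Proof.
rewrite /clamp /Order.max /Order.min.
by case: (ltP t 0) => t0; [rewrite ltr01 lexx ler01|case: (ltP t 1) => t1]; lra.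
Qed.

Lemma clamp_id t : 0 <= t <= 1 -> clamp t = t.
Proof. by case/andP => t0 t1; rewrite /clamp max_l// min_l. Qed.

Lemma clamp_lip t u : `|clamp t - clamp u| <= `|t - u|.
Proof.
have := ler_norm (t - u); have := ler_norm (u - t); rewrite (distrC u t).
move=> h1 h2; rewrite /clamp /Order.max /Order.min ler_norml.
case: (ltP t 0) => t0; case: (ltP u 0) => u0; rewrite ?ltr01;
  case: (ltP t 1) => t1; case: (ltP u 1) => u1; apply/andP; split; lra.
Qed.

Lemma measurable_clamp : measurable_fun [set: R] clamp.
Proof. by apply: measurable_minr => //; apply: measurable_maxr. Qed.

(** The coordinate in units of the cell width, shifted by half a cell when b
    holds; clamping makes it, and the cell index, total functions. *)
Definition level (M : nat) (b : bool) (t : R) : R := M%:R * clamp t + b%:R / 2.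

Lemma level_ge0 M b t : 0 <= level M b t.
Proof.
have /andP[c0 _] := clamp_itv t; rewrite /level addr_ge0// mulr_ge0//.
Qed.

Lemma level_trunc M b t : (Num.truncn (level M b t) <= M)%N.
Proof.
rewrite truncn_le_nat; have /andP[_ c1] := clamp_itv t; rewrite /level.
have : (M%:R : R) * clamp t <= M%:R by rewrite ler_piMr.
by rewrite -(natr1 M); case: b => /=; lra.
Qed.

Lemma level_lip M b t u : `|level M b t - level M b u| <= M%:R * `|t - u|.
Proof.
rewrite /level.
have -> : M%:R * clamp t + b%:R / 2 - (M%:R * clamp u + b%:R / 2) =
  M%:R * (clamp t - clamp u) by ring.
by rewrite normrM ger0_norm// ler_wpM2l// clamp_lip.
Qed.

Lemma measurable_level M b : measurable_fun [set: R] (level M b).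
Proof.
apply: measurable_funD => //; apply: measurable_funM => //; exact: measurable_clamp.
Qed.

Variable d : nat.
Local Notation X := 'rV[R]_d.
Local Notation lam := (lebesgue_rV R d).
Local Notation cube := (unit_cube R d).

Lemma measurable_coord (i : 'I_d) : measurable_fun [set: X] (fun x : X => x ord0 i).
Proof.
move=> _ A mA; apply: sub_sigma_algebra.
by rewrite (bigD1 i)//=; left; exists A.
Qed.

Lemma measurable_box (A : 'I_d -> set R) : (forall i, measurable (A i)) ->
  measurable [set x : X | forall i, A i (x ord0 i)].
Proof.
move=> mA.
have -> : [set x : X | forall i, A i (x ord0 i)] =
    \bigcap_(i in [set: 'I_d]) ((fun x : X => x ord0 i) @^-1` A i).
  by apply/seteqP; split=> t /= h i; [move=> _|]; exact: h.
apply: fin_bigcap_measurable => [|i _]; first exact: finite_finset.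
by rewrite -[X in measurable X]setTI; exact: measurable_coord.
Qed.

Lemma cubeE : cube = [set x : X | forall i, `[0%R, 1%R]%classic (x ord0 i)].
Proof. by apply/seteqP; split => x /= h i; have := h i; rewrite /= in_itv/=. Qed.

Lemma measurable_cube : measurable cube.
Proof. rewrite cubeE; apply: (@measurable_box (fun=> `[0%R, 1%R]%classic)) => i.
exact: measurable_itv. Qed.

Lemma lebesgue_cube : lam cube = 1%E.
Proof.
rewrite cubeE (lebesgue_rV_box (A := fun=> `[0%R, 1%R]%classic))//.
by rewrite big1// => i _; rewrite lebesgue_measure_itv/= lte_fin ltr01 oppr0 adde0.
Qed.

(** The bits of c say along which axes the grid is shifted by half a cell.
    There are M + 1 slabs along each axis: a shift cuts the two extreme cells
    in half, and without shift the last slab is the face where the coordinate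
    is 1. *)
Definition cell_index (M : nat) (c : {ffun 'I_d -> bool}) (x : X) : {ffun 'I_d -> 'I_M.+1} :=
  [ffun i => inord (Num.truncn (level M (c i) (x ord0 i)))].

Lemma cell_indexE M c x i :
  cell_index M c x i = Num.truncn (level M (c i) (x ord0 i)) :> nat.
Proof. by rewrite ffunE inordK// ltnS level_trunc. Qed.

Let slab M b (j : nat) : set R := [set t | j%:R <= level M b t < j.+1%:R].

Let mslab M b j : measurable (slab M b j).
Proof.
have -> : slab M b j = (level M b) @^-1` `[j%:R, j.+1%:R[%classic.
  by apply/seteqP; split => t /=; rewrite in_itv.
by rewrite -[X in measurable X]setTI; exact: measurable_level.
Qed.

Lemma cellE M c j : [set x | cell_index M c x = j] =
  [set x | forall i, slab M (c i) (j i) (x ord0 i)].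
Proof.
apply/seteqP; split => x /=.
  move=> xj i; rewrite /slab/=.
  by rewrite -truncn_eq ?level_ge0// -cell_indexE xj.
move=> xj; apply/ffunP => i; apply/val_inj; rewrite /= cell_indexE.
by apply/eqP; rewrite truncn_eq ?level_ge0//; exact: xj.
Qed.

Lemma measurable_cell M c j : measurable [set x | cell_index M c x = j].
Proof. rewrite cellE; apply: (@measurable_box (fun i => slab M (c i) (j i))) => i.
exact: mslab. Qed.

Lemma lebesgue_cell M c j : (0 < M)%N ->
  (lam (cube `&` [set x | cell_index M c x = j]) <= ((M%:R^-1) ^+ d)%:E)%E.
Proof.
move=> M0.
have -> : cube `&` [set x | cell_index M c x = j] =
   [set x | forall i, (`[0%R, 1%R]%classic `&` slab M (c i) (j i)) (x ord0 i)].
  rewrite cellE cubeE; apply/seteqP; split => x /=.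
    by move=> [h1 h2] i; split.
  by move=> h; split => i; have [] := h i.
rewrite (lebesgue_rV_box (A := fun i => `[0%R, 1%R]%classic `&` slab M (c i) (j i)))//; last first.
  by move=> i; apply: measurableI => //; exact: mslab.
have -> : ((M%:R^-1) ^+ d)%:E = (\prod_(i < d) (M%:R^-1 : R)%:E)%E.
  by rewrite prodEFin prodr_const card_ord.
have leb i : (lebesgue_measure (`[0%R, 1%R]%classic `&` slab M (c i) (j i) : set (measurableTypeR R)) <= (M%:R^-1 : R)%:E)%E.
  pose a : R := ((j i)%:R - (c i)%:R / 2) / M%:R.
  have M0' : (0 < M%:R :> R) by rewrite ltr0n.
  apply: (@le_trans _ _ (lebesgue_measure (`[a, a + M%:R^-1]%classic : set (measurableTypeR R)))).
    apply: le_measure; rewrite ?inE//; first by apply: measurableI => //; exact: mslab.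
    move=> t /= []; rewrite !in_itv/= => t01.
    rewrite /slab/= /level clamp_id// -natr1 => /andP[l1 l2].
    have Mi : M%:R * M%:R^-1 = 1 :> R by rewrite divff// gt_eqF.
    have -> : a + M%:R^-1 = ((j i)%:R - (c i)%:R / 2 + 1) / M%:R.
      by rewrite /a [RHS]mulrDl mul1r.
    rewrite /a ler_pdivrMr// ler_pdivlMr// (mulrC t).
    apply/andP; split; first by rewrite lerBlDr.
    by rewrite addrAC lerBrDr natr1 ltW.
  rewrite lebesgue_measure_itv/=; case: ifP => // _.
  by rewrite -EFinB addrAC subrr add0r.
suff : (0 <= \prod_(i < d) lebesgue_measure
    (`[0%R, 1%R] `&` slab M (c i) (j i) : set (measurableTypeR R)) <=
  \prod_(i < d) (M%:R^-1 : R)%:E)%E by case/andP.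
elim/big_ind2 : _ => //=; first by rewrite lexx lee01.
  by move=> x y x' y' /andP[x0 xy] /andP[x'0 xy']; rewrite mule_ge0//= lee_pmul.
by move=> i _; rewrite measure_ge0 leb.
Qed.

Lemma coord_le_eucl (x : X) i : `|x ord0 i| <= eucl_norm x.
Proof.
rewrite /eucl_norm -sqrtr_sqr ler_wsqrtr// (bigD1 i)//= lerDl.
by apply: sumr_ge0 => j _; exact: sqr_ge0.
Qed.

Lemma eucl_le_sum (x : X) : eucl_norm x <= \sum_i `|x ord0 i|.
Proof.
rewrite /eucl_norm -[leRHS]ger0_norm ?sumr_ge0// -sqrtr_sqr ler_wsqrtr//.
rewrite [leRHS]expr2 mulr_suml; apply: ler_sum => i _.
rewrite -real_normK ?num_real// expr2 ler_wpM2l//.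
by rewrite (bigD1 i)//= lerDl sumr_ge0.
Qed.

Lemma eucl_gt0 (x : X) : x != 0 -> 0 < eucl_norm x.
Proof.
move=> x0; have [i xi] : exists i, x ord0 i != 0.
  apply: contrapT => /forallNP h; move: x0 => /eqP; apply.
  by apply/rowP => i; rewrite mxE; apply/eqP; move: (h i) => /negP/negPn.
by apply: lt_le_trans (coord_le_eucl x i); rewrite normr_gt0.
Qed.

Lemma same_cell_dist M c x y : (0 < M)%N -> cube x -> cube y ->
  cell_index M c x = cell_index M c y -> eucl_norm (x - y) <= d%:R / M%:R.
Proof.
move=> M0 xc yc xy; apply: (le_trans (eucl_le_sum _)).
have -> : d%:R / M%:R = \sum_(i < d) (M%:R^-1 : R).
  by rewrite sumr_const card_ord -[RHS]mulr_natl.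
apply: ler_sum => i _; rewrite !mxE.
have : Num.truncn (level M (c i) (x ord0 i)) = Num.truncn (level M (c i) (y ord0 i)).
  by rewrite -!cell_indexE xy.
have M0' : (0 < M%:R :> R) by rewrite ltr0n.
have /andP[] := truncn_itv (level_ge0 M (c i) (x ord0 i)).
have /andP[] := truncn_itv (level_ge0 M (c i) (y ord0 i)).
move=> h1 h2 h3 h4 E; rewrite E in h3 h4; move: h1 h2 h3 h4.
rewrite /level !clamp_id// -natr1 => h1 h2 h3 h4.
rewrite -(ler_pM2l M0') divff ?gt_eqF// -{1}(ger0_norm (ltW M0')) -normrM.
by rewrite ler_norml mulrBr; apply/andP; split; lra.
Qed.

Definition no_shift : {ffun 'I_d -> bool} := [ffun=> false].

Definition grid_point M (j : {ffun 'I_d -> 'I_M.+1}) : X := \row_i ((j i)%:R / M%:R).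

Lemma grid_point_cube M j : (0 < M)%N -> cube (@grid_point M j).
Proof.
move=> M0 i; rewrite mxE divr_ge0//= ler_pdivrMr ?ltr0n// mul1r ler_nat.
by rewrite -ltnS.
Qed.

Lemma cell_grid_point M j : (0 < M)%N -> cell_index M no_shift (@grid_point M j) = j.
Proof.
move=> M0; apply/ffunP => i; apply: val_inj; rewrite /= cell_indexE ffunE /level.
rewrite clamp_id; last by have := @grid_point_cube M j M0 i.
rewrite mxE mulrC divfK ?pnatr_eq0 -?lt0n// mul0r addr0.
exact: natrK.
Qed.

Lemma measurable_fun_cell (M : nat) c d' (T : measurableType d') (F : {ffun 'I_d -> 'I_M.+1} -> T) :
  measurable_fun [set: X] (fun x => F (cell_index M c x)).
Proof.
move=> _ A mA; rewrite setTI.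
have -> : (fun x => F (cell_index M c x)) @^-1` A =
   \bigcup_(j in [set j | A (F j)]) [set x | cell_index M c x = j].
  apply/seteqP; split => [x Ax|x [j Aj /= jE]]; first by exists (cell_index M c x).
  by rewrite /preimage/= jE.
apply: fin_bigcup_measurable; first exact: finite_finset.
by move=> j _; exact: measurable_cell.
Qed.

(** F is the pointwise limit of its values at the grid points of ever finer
    grids, which take finitely many values on measurable cells. *)
Lemma hoelder_measurable (F : X -> R) (L s : R) : 0 < s ->
  (forall x y, cube x -> cube y -> `|F x - F y| <= L * eucl_norm (x - y) `^ s) ->
  measurable_fun cube F.
Proof.
move=> s0 FL.
(* the value at the corner of the cell of x *)
pose h (k : nat) x := F (grid_point (cell_index k.+1 no_shift x)).
apply: (@measurable_fun_cvg _ _ _ _ h).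
  move=> k; apply: measurable_funTS.
  exact: (@measurable_fun_cell k.+1 no_shift _ _ (fun j => F (grid_point j))).
move=> x xc.
have dist k : `|F x - h k x| <= `|L| * (d%:R / k.+1%:R) `^ s.
  apply: (le_trans (FL _ _ xc (grid_point_cube _ _))) => //.
  apply: (@le_trans _ _ (`|L| * eucl_norm (x - grid_point (cell_index k.+1 no_shift x)) `^ s)).
    by rewrite ler_wpM2r ?powR_ge0// ler_norm.
  rewrite ler_wpM2l// ge0_ler_powR ?nnegrE//; first exact: ltW.
  - by rewrite /eucl_norm sqrtr_ge0.
  - apply: (@same_cell_dist _ no_shift) => //; first exact: grid_point_cube.
    by rewrite cell_grid_point.
apply/cvgrPdist_le => e e0.
pose eta := (e / (`|L| + 1)) `^ s^-1.
have L1 : 0 < `|L| + 1 by rewrite ltr_wpDl.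
have eta0 : 0 < eta by rewrite powR_gt0// divr_gt0.
near=> k; apply: (le_trans (dist k)).
have kd : d%:R / eta <= k%:R by near: k; exact: nbhs_infty_ger.
have dk : d%:R / k.+1%:R <= eta.
  rewrite ler_pdivrMr// mulrC -ler_pdivrMr//; apply: (le_trans kd).
  by rewrite ler_nat.
have le1 : (d%:R / k.+1%:R) `^ s <= e / (`|L| + 1).
  have -> : e / (`|L| + 1) = eta `^ s.
    by rewrite -powRrM mulVf ?gt_eqF// powRr1// divr_ge0 ?ltW.
  by rewrite ge0_ler_powR ?nnegrE//; exact: ltW.
apply: (@le_trans _ _ (`|L| * (e / (`|L| + 1)))); first by rewrite ler_wpM2l.
by rewrite mulrCA ger_pMr// ler_pdivrMr// mul1r lerDl.
Unshelve. all: by end_near.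
Qed.

End grid.

(** * Hoelder functions and signed bumps *)

Section hoelder_space.
Variables (R : realType) (d : nat) (s : R).
Hypotheses (s0 : 0 < s) (s1 : s <= 1).
Local Notation X := 'rV[R]_d.

Lemma hoelder_order0 : hoelder_order s = 0%N.
Proof. by rewrite /hoelder_order (_ : Num.ceil s = 1)//; apply: ceil_def; rewrite s0 s1. Qed.

Lemma hoelder_exponentE : hoelder_exponent s = s.
Proof. by rewrite /hoelder_exponent hoelder_order0 subr0. Qed.

Let ord_zero (g : {ffun 'I_d -> 'I_(hoelder_order s).+1}) i : g i = 0%N :> nat.
Proof.
have := ltn_ord (g i); move: (g i : nat) => k.
by rewrite hoelder_order0 ltnS leqn0 => /eqP.
Qed.

Lemma mpartial0 (g : {ffun 'I_d -> 'I_(hoelder_order s).+1}) (F : X -> R) :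
  mpartial (fun i => g i : nat) F = F.
Proof.
rewrite /mpartial; elim: (enum 'I_d) => //= i l ->.
by rewrite ord_zero.
Qed.

Lemma hoelder_norm_dist (U : set X) (F : X -> R) (L : R) :
  (hoelder_norm s U F <= L%:E)%E ->
  forall u v, U u -> U v -> `|F u - F v| <= L * eucl_norm (u - v) `^ s.
Proof.
move=> FL u v Uu Uv.
have [->|uv] := eqVneq u v.
  rewrite !subrr normr0 /eucl_norm big1 ?sqrtr0; last by move=> i _; rewrite mxE expr0n.
  rewrite powR0 ?gt_eqF// mulr0//.
have e0 : 0 < eucl_norm (u - v) by rewrite eucl_gt0// subr_eq0.
rewrite -ler_pdivrMr ?powR_gt0// -lee_fin; apply: le_trans FL.
rewrite /hoelder_norm.
apply: (@le_trans _ _ (hoelder_seminorm s U F)).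
  by apply: ereal_sup_ubound; exists u, v.
set S1 := (X in (_ <= X + _)%E).
have S10 : (0 <= S1)%E by apply: sume_ge0 => g _; exact: Lnorm_ge0.
apply: (le_trans _ (leeDr _ S10)).
pose g0 : {ffun 'I_d -> 'I_(hoelder_order s).+1} := [ffun=> ord0].
rewrite (bigD1 g0)/=; last first.
  by rewrite big1 ?hoelder_order0// => i _; rewrite ffunE.
by rewrite le_max mpartial0 hoelder_exponentE lexx.
Qed.

(** The topology of row vectors comes from the sup norm, the Hoelder condition
    from the Euclidean norm; the latter is at most d times the former. *)
Lemma hoelder_continuous (F : X -> R) (L : R) :
  (forall x y, `|F x - F y| <= L * eucl_norm (x - y) `^ s) -> continuous F.
Proof.
move=> FL x; apply/(@cvgrPdist_le _ _ _ (nbhs x) (nbhs_filter x)) => e e0.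
have L1 : 0 < `|L| + 1 by rewrite ltr_wpDl.
pose eta := (e / (`|L| + 1)) `^ s^-1.
have eta0 : 0 < eta by rewrite powR_gt0// divr_gt0.
apply/nbhs_ballP; exists (eta / d.+1%:R) => /=; first by rewrite divr_gt0.
move=> y [_ xy].
have le_eta : eucl_norm (x - y) <= eta.
  apply: (le_trans (eucl_le_sum _)).
  apply: (@le_trans _ _ (\sum_(i < d) eta / d.+1%:R)).
    apply: ler_sum => i _; rewrite !mxE.
    by have := xy ord0 i; rewrite /ball/= => /ltW.
  rewrite sumr_const card_ord -[leLHS]mulr_natl mulrCA ger_pMr// ler_pdivrMr// mul1r.
  by rewrite ler_nat.
apply: (le_trans (FL x y)).
apply: (@le_trans _ _ (`|L| * eta `^ s)).
  apply: (@le_trans _ _ (`|L| * eucl_norm (x - y) `^ s)).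
    by rewrite ler_wpM2r ?powR_ge0// ler_norm.
  rewrite ler_wpM2l// ge0_ler_powR ?nnegrE//; first exact: ltW.
    by rewrite /eucl_norm sqrtr_ge0.
  exact: ltW.
rewrite -powRrM mulVf ?gt_eqF// powRr1; last by rewrite divr_ge0 ?ltW.
by rewrite mulrCA ger_pMr// ler_pdivrMr// mul1r lerDl.
Qed.

Lemma hoelder_norm_le (U : set X) (F : X -> R) (B L : R) :
  0 <= B -> 0 <= L ->
  (forall x, `|F x| <= B) ->
  (forall x y, `|F x - F y| <= L * eucl_norm (x - y) `^ s) ->
  is_Ck (hoelder_order s) U F /\ (hoelder_norm s U F <= (B + L)%:E)%E.
Proof.
move=> B0 L0 FB FL; split.
  by rewrite hoelder_order0; split => // x _; exact: hoelder_continuous.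
rewrite /hoelder_norm EFinD; apply: leeD.
  have Lb : (Lnorm (lebesgue_rV R d) +oo (EFin \o (F \_ U)) <= B%:E)%E.
    rewrite unlock; case: ifPn => // _; apply/ess_supP/nearW => x /=.
    by rewrite lee_fin patchE; case: ifPn => // _; rewrite normr0.
  under eq_bigr do rewrite mpartial0.
  pose g0 : {ffun 'I_d -> 'I_(hoelder_order s).+1} := [ffun=> ord0].
  rewrite (bigD1 g0)/=; last by rewrite big1// => i _; rewrite ffunE.
  rewrite big1 ?adde0// => g /andP[_ /eqP]; case.
  apply/ffunP => i; apply: val_inj => /=; rewrite ffunE/=.
  exact: ord_zero.
apply: (big_ind (fun x => (x <= L%:E)%E)) => //.
- by move=> x y xL yL; rewrite ge_max xL yL.
- move=> g _; rewrite mpartial0 hoelder_exponentE.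
  apply: ge_ereal_sup => _ [u [v [Uu Uv uv ->]]].
  by rewrite lee_fin ler_pdivrMr ?powR_gt0 ?eucl_gt0 ?subr_eq0.
Qed.

End hoelder_space.

Section bumps.
Variable R : realType.

(** This profile vanishes at the integers, so that a sign constant between
    integers can be attached to it without creating a jump; its square and the
    square of its half-period translate add up to 1. *)
Definition tooth (u : R) : R := `|sin (pi * u)|.

Lemma sin_lip (a b : R) : `|sin a - sin b| <= `|a - b|.
Proof.
wlog ab : a b / a <= b.
  by move=> h; case/orP: (le_total a b) => ab; [exact: h|rewrite distrC [leRHS]distrC; exact: h].
move: ab; rewrite le_eqVlt => /predU1P[->|ab]; first by rewrite !subrr.
have [|c _ E] := @MVT _ (@sin R) (@cos R) a b ab.
  by apply: continuous_subspaceT => x; exact: continuous_sin.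
rewrite distrC E normrM [leRHS]distrC ler_piMl//.
by rewrite ler_norml cos_geN1 cos_le1.
Qed.

Lemma tooth_itv u : 0 <= tooth u <= 1.
Proof. by rewrite /tooth normr_ge0/= ler_norml sin_geN1 sin_le1. Qed.

Lemma tooth_lip u v : `|tooth u - tooth v| <= pi * `|u - v|.
Proof.
apply: (le_trans (ler_dist_dist _ _)); apply: (le_trans (sin_lip _ _)).
by rewrite -mulrBr normrM ger0_norm ?pi_ge0.
Qed.

Lemma tooth_nat (k : nat) : tooth k%:R = 0.
Proof.
rewrite /tooth; apply/eqP; rewrite normr_eq0; apply/eqP.
elim: k => [|k IH]; first by rewrite mulr0 sin0.
by rewrite -natr1 mulrDr mulr1 sinDpi IH oppr0.
Qed.

(** An integer separates u from v, and tooth vanishes there. *)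
Lemma tooth_jump u v : 0 <= u -> 0 <= v -> Num.truncn u != Num.truncn v ->
  tooth u <= pi * `|u - v|.
Proof.
move=> u0 v0 uv.
have [k ku] : exists k : nat, `|u - k%:R| <= `|u - v|.
  have /andP[u1 u2] := truncn_itv u0.
  have /andP[v1 v2] := truncn_itv v0.
  case: (ltngtP (Num.truncn u) (Num.truncn v)) uv => // uv _.
    exists (Num.truncn v).
    have : (Num.truncn u).+1%:R <= (Num.truncn v)%:R :> R by rewrite ler_nat.
    move=> h; rewrite distrC [leRHS]distrC !ger0_norm; lra.
  exists (Num.truncn u).
  have : (Num.truncn v).+1%:R <= (Num.truncn u)%:R :> R by rewrite ler_nat.
  move=> h; rewrite !ger0_norm; lra.
have := tooth_lip u k%:R; rewrite tooth_nat subr0 ger0_norm ?(andP (tooth_itv u)).1//.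
move=> h; apply: (le_trans h); rewrite ler_wpM2l// pi_ge0//.
Qed.

Lemma tooth_sqr u : tooth u ^+ 2 + tooth (u + 2^-1) ^+ 2 = 1.
Proof.
rewrite /tooth !real_normK ?num_real// mulrDr.
rewrite sinDpihalf addrC.
exact: cos2Dsin2.
Qed.

Lemma measurable_tooth : measurable_fun [set: R] tooth.
Proof.
apply: measurableT_comp => //; apply: continuous_measurable_fun.
move=> x; apply: continuous_comp; last exact: continuous_sin.
by apply: continuousM => //; exact: cst_continuous.
Qed.

Variable d : nat.
Local Notation X := 'rV[R]_d.
Variable M : nat.

Definition cell_bump (c : {ffun 'I_d -> bool}) (x : X) : R :=
  \prod_i tooth (level M (c i) (x ord0 i)).

Lemma bump_itv c x : 0 <= cell_bump c x <= 1.
Proof.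
rewrite /cell_bump; apply/andP; split.
  by apply: prodr_ge0 => i _; have /andP[] := tooth_itv (level M (c i) (x ord0 i)).
by apply: prodr_ile1 => i _; exact: tooth_itv.
Qed.

(** Expanding the product over the axes of the sum of the two squared profiles,
    each of which is cos^2 + sin^2. *)
Lemma bump_sqr_sum x : \sum_c cell_bump c x ^+ 2 = 1.
Proof.
rewrite /cell_bump; under eq_bigr do rewrite -prodrXl.
rewrite -(bigA_distr_bigA (fun i b => tooth (level M b (x ord0 i)) ^+ 2)).
apply: big1 => i _; rewrite big_bool/= /level mul0r addr0 addrC div1r.
exact: tooth_sqr.
Qed.

Lemma measurable_bump c : measurable_fun [set: X] (cell_bump c).
Proof.
apply: measurable_prod => i _.
apply: (measurableT_comp measurable_tooth).
apply: (measurableT_comp (measurable_level M (c i))).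
exact: measurable_coord.
Qed.

(** Telescoping: replace one factor at a time. *)
Lemma dist_prod (I : Type) (r : seq I) (a b : I -> R) :
  (forall i, 0 <= a i <= 1) -> (forall i, 0 <= b i <= 1) ->
  `|\prod_(i <- r) a i - \prod_(i <- r) b i| <= \sum_(i <- r) `|a i - b i|.
Proof.
move=> a01 b01; elim: r => [|i r IH]; first by rewrite !big_nil subrr normr0.
rewrite !big_cons.
have -> : a i * \prod_(j <- r) a j - b i * \prod_(j <- r) b j =
  (a i - b i) * \prod_(j <- r) a j + b i * (\prod_(j <- r) a j - \prod_(j <- r) b j) by ring.
apply: (le_trans (ler_normD _ _)); rewrite !normrM; apply: lerD.
  rewrite ler_piMr// ger0_norm; last by apply: prodr_ge0 => j _; have /andP[] := a01 j.
  by apply: prodr_ile1 => j _; exact: a01.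
apply: (le_trans _ IH); rewrite ler_piMl// ger0_norm; by have /andP[] := b01 i.
Qed.

Definition signed_bump (p : {ffun 'I_d -> bool} * {ffun {ffun 'I_d -> 'I_M.+1} -> bool}) (x : X) : R :=
  sgb R (p.2 (cell_index M p.1 x)) * cell_bump p.1 x.

Lemma sgb_norm b : `|sgb R b| = 1.
Proof. by rewrite /sgb normrX normrN1 expr1n. Qed.

Lemma signed_bump_bound p x : `|signed_bump p x| <= 1.
Proof.
have /andP[h0 h1] := bump_itv p.1 x.
by rewrite /signed_bump normrM sgb_norm mul1r ger0_norm.
Qed.

(** Within a cell the sign is constant.  Across cells both bumps are small,
    since one of their factors vanishes between the two points. *)
Lemma signed_bump_lip p x y :
  `|signed_bump p x - signed_bump p y| <= 2 * pi * M%:R * \sum_i `|x ord0 i - y ord0 i|.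
Proof.
have pM (i : 'I_d) : pi * `|level M (p.1 i) (x ord0 i) - level M (p.1 i) (y ord0 i)| <=
   pi * M%:R * `|x ord0 i - y ord0 i|.
  by rewrite -mulrA ler_wpM2l ?pi_ge0// level_lip.
have [E|] := eqVneq (cell_index M p.1 x) (cell_index M p.1 y).
  rewrite /signed_bump E -mulrBr normrM sgb_norm mul1r.
  apply: (le_trans (dist_prod _ _ _)); try by move=> i; exact: tooth_itv.
  rewrite mulr_sumr; apply: ler_sum => i _.
  apply: (le_trans (tooth_lip _ _)); apply: (le_trans (pM i)).
  have : 0 <= pi * M%:R * `|x ord0 i - y ord0 i| by rewrite !mulr_ge0// pi_ge0.
  lra.
move=> E; have [i iE] : exists i, Num.truncn (level M (p.1 i) (x ord0 i)) !=
    Num.truncn (level M (p.1 i) (y ord0 i)).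
  apply: contrapT => /forallNP h; move: E => /eqP; apply; apply/ffunP => i.
  apply: val_inj; rewrite /= !cell_indexE; apply/eqP.
  by move: (h i) => /negP/negPn.
have le_tooth z j : cell_bump p.1 z <= tooth (level M (p.1 j) (z ord0 j)).
  rewrite /cell_bump (bigD1 j)//= ler_piMr//; first by have /andP[] := tooth_itv (level M (p.1 j) (z ord0 j)).
  by apply: prodr_ile1 => k _; exact: tooth_itv.
have bnd : cell_bump p.1 x + cell_bump p.1 y <= 2 * pi * M%:R * `|x ord0 i - y ord0 i|.
  have h1 := tooth_jump (level_ge0 _ _ _) (level_ge0 _ _ _) iE.
  rewrite eq_sym in iE.
  have h2 := tooth_jump (level_ge0 _ _ _) (level_ge0 _ _ _) iE.
  rewrite distrC in h2.
  have := pM i; have := le_tooth x i; have := le_tooth y i => g1 g2 g3; lra.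
apply: (@le_trans _ _ (cell_bump p.1 x + cell_bump p.1 y)).
  apply: (le_trans (ler_normB _ _)); rewrite /signed_bump !normrM !sgb_norm !mul1r.
  by rewrite !ger0_norm//; [have /andP[] := bump_itv p.1 y|have /andP[] := bump_itv p.1 x].
apply: (le_trans bnd); rewrite ler_wpM2l ?mulr_ge0 ?pi_ge0//.
by rewrite (bigD1 i)//= lerDl sumr_ge0.
Qed.

Lemma measurable_signed_bump p : measurable_fun [set: X] (signed_bump p).
Proof.
apply: measurable_funM; last exact: measurable_bump.
exact: (@measurable_fun_cell R d M p.1 _ _ (fun j => sgb R (p.2 j))).
Qed.

Definition bump_sum rs (x : X) : R := \sum_(p <- rs) signed_bump p x.

Lemma measurable_bump_sum rs : measurable_fun [set: X] (bump_sum rs).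
Proof. by apply: measurable_sum => p; exact: measurable_signed_bump. Qed.

Lemma bump_sum_bound rs x : `|bump_sum rs x| <= (size rs)%:R.
Proof.
rewrite /bump_sum; apply: (le_trans (ler_norm_sum _ _ _)).
rewrite -sum1_size natr_sum; apply: ler_sum => p _; exact: signed_bump_bound.
Qed.

(** Interpolates between the Lipschitz bound at distances below 1 / M and the
    trivial bound beyond. *)
Lemma bump_sum_hoelder rs x y (s : R) : 0 < s -> s <= 1 -> (0 < M)%N ->
  `|bump_sum rs x - bump_sum rs y| <=
    (size rs)%:R * (2 * pi * d%:R + 2) * M%:R `^ s * eucl_norm (x - y) `^ s.
Proof.
move=> s0 s1 M0.
set e := eucl_norm (x - y).
have e0 : 0 <= e by rewrite /e /eucl_norm sqrtr_ge0.
have M0' : 0 < M%:R :> R by rewrite ltr0n.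
rewrite -[leRHS]mulrA -powRM//.
have lip p : `|signed_bump p x - signed_bump p y| <= 2 * pi * d%:R * (M%:R * e).
  apply: (le_trans (signed_bump_lip p x y)).
  have -> : 2 * pi * d%:R * (M%:R * e) = 2 * pi * M%:R * (d%:R * e) by ring.
  rewrite ler_wpM2l ?mulr_ge0 ?pi_ge0//.
  have -> : d%:R * e = \sum_(i < d) e by rewrite sumr_const card_ord mulr_natl.
  apply: ler_sum => i _; have := coord_le_eucl (x - y) i; by rewrite !mxE.
have bd p : `|signed_bump p x - signed_bump p y| <= 2.
  apply: (le_trans (ler_normB _ _)).
  have := signed_bump_bound p x; have := signed_bump_bound p y; lra.
have main p : `|signed_bump p x - signed_bump p y| <= (2 * pi * d%:R + 2) * (M%:R * e) `^ s.
  have pd : 0 <= 2 * pi * d%:R :> R by rewrite !mulr_ge0 ?pi_ge0.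
  have Me0 : 0 <= M%:R * e by rewrite mulr_ge0// ltW.
  have [le1|ge1] := leP (M%:R * e) 1.
    apply: (le_trans (lip p)); apply: (@le_trans _ _ ((2 * pi * d%:R + 2) * (M%:R * e))).
      by rewrite ler_wpM2r//; lra.
    rewrite ler_wpM2l//; first lra.
    move: Me0; rewrite le_eqVlt => /predU1P[<-|Me0]; first by rewrite powR_ge0.
    rewrite -{1}(powRr1 (ltW Me0)) -[leLHS]/(_ `^ _).
    by rewrite ger_powR// Me0 le1.
  apply: (le_trans (bd p)).
  have : 1 <= (M%:R * e) `^ s.
    by have := ler_powR (ltW ge1) (ltW s0); rewrite powRr0.
  move=> h; apply: (@le_trans _ _ ((2 * pi * d%:R + 2) * 1)); first lra.
  by rewrite ler_wpM2l//; lra.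
rewrite /bump_sum -sumrB; apply: (le_trans (ler_norm_sum _ _ _)).
rewrite -sum1_size natr_sum mulr_suml mulr_suml; apply: ler_sum => p _.
by rewrite mul1r.
Qed.

End bumps.

(** * A four-atom regression model *)

Section atomic_kernel.
Local Open Scope ereal_scope.
Context dX dZ (X : measurableType dX) (Z : measurableType dZ) (R : realType).
Variables (N : nat) (W : nat -> X -> R) (y : nat -> X -> Z).
Hypotheses (mW : forall k, measurable_fun setT (W k))
  (my : forall k, measurable_fun setT (y k))
  (W0 : forall k x, (0 <= W k x)%R) (W1 : forall x, (\sum_(k < N) W k x = 1)%R).

Definition atoms of (forall k, measurable_fun setT (W k)) &
  (forall k, measurable_fun setT (y k)) & (forall x, (\sum_(k < N) W k x = 1)%R) :=
  fun x : X =>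
  msum (fun k => mscale (NngNum (W0 k x)) (dirac (y k x) : {measure set Z -> \bar R})) N
  : {measure set Z -> \bar R}.

Local Notation K := (atoms mW my W1).

Lemma atomsE x C : K x C = (\sum_(k < N) W k x * \1_C (y k x))%:E.
Proof.
rewrite /atoms/= /msum -sumEFin; apply: eq_bigr => k _.
by rewrite /mscale/= /dirac/= indicE EFinM.
Qed.

Let measurable_atoms C : measurable C -> measurable_fun setT (fun x => K x C).
Proof.
move=> mC; apply: (eq_measurable_fun (fun x => (\sum_(k < N) W k x * \1_C (y k x))%:E)).
  by move=> x _; rewrite atomsE.
apply/measurable_EFinP; apply: measurable_sum => k; apply: measurable_funM => //.
by apply: measurableT_comp => //; exact: measurable_indic.
Qed.

HB.instance Definition _ := isKernel.Build _ _ X Z R K measurable_atoms.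

Let atoms_prob x : K x setT = 1.
Proof. by rewrite atomsE; under eq_bigr do rewrite indicT mulr1; rewrite W1. Qed.

HB.instance Definition _ := Kernel_isProbability.Build _ _ X Z R K atoms_prob.

Definition katoms : R.-pker X ~> Z := K.

Lemma ge0_integral_atoms x (f : Z -> \bar R) : measurable_fun setT f ->
  (forall z, 0 <= f z) ->
  \int[K x]_z f z = \sum_(k < N) (W k x)%:E * f (y k x).
Proof.
move=> mf f0; rewrite /atoms ge0_integral_measure_sum//; apply: eq_bigr => k _.
rewrite ge0_integral_mscale//=.
by rewrite integral_dirac// diracT mul1e.
Qed.

Lemma integral_atoms x (f : Z -> R) : measurable_fun setT f ->
  \int[K x]_z (f z)%:E = (\sum_(k < N) W k x * f (y k x))%:E.
Proof.
move=> mf; rewrite integralE.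
rewrite !ge0_integral_atoms//; last 2 first.
- by apply: measurable_funeneg; exact/measurable_EFinP.
- by apply: measurable_funepos; exact/measurable_EFinP.
under eq_bigr do rewrite funeposE -EFin_max -EFinM.
under [X in _ - X]eq_bigr do rewrite funenegE -EFinN -EFin_max -EFinM.
rewrite !sumEFin -EFinB -sumrB; congr (_%:E); apply: eq_bigr => k _.
rewrite -mulrBr; congr (_ * _)%R.
by rewrite /Order.max; case: ltP => h1; case: ltP => h2; lra.
Qed.

Variables (mu : {measure set X -> \bar R}) (D : set X) (mD : measurable D)
  (muD : mu D = 1).

Let atoms_mixture : {measure set Z -> \bar R} := mixture_meas mu mD measurable_atoms.

Let atoms_mixtureT : atoms_mixture setT = 1.
Proof.
rewrite /atoms_mixture /mixture_meas/= /mixture_measure.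
under eq_integral do rewrite atoms_prob.
by rewrite integral_cst// mul1e.
Qed.

Definition mixture : probability Z R := as_probability atoms_mixtureT.

Lemma ge0_integral_mixture_atoms (f : Z -> \bar R) : measurable_fun setT f ->
  (forall z, 0 <= f z) ->
  \int[mixture]_z f z = \int[mu]_(x in D) \sum_(k < N) (W k x)%:E * f (y k x).
Proof.
move=> mf f0; rewrite (@ge0_integral_mixture _ _ _ _ _ mu D mD K mixture measurable_atoms)//.
by apply: eq_integral => x _; rewrite ge0_integral_atoms.
Qed.

End atomic_kernel.

Section model.
Variables (R : realType) (d : nat) (a b : R).
Hypotheses (a0 : 0 < a) (ab : a < b).
Local Notation X := 'rV[R]_d.
Local Notation lam := (lebesgue_rV R d).
Local Notation cube := (unit_cube R d).

Let b0 : 0 < b. Proof. exact: lt_trans a0 ab. Qed.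
Definition gap : R := b ^+ 2 - a ^+ 2.
Lemma gap_gt0 : 0 < gap.
Proof. by rewrite /gap subr_sqr mulr_gt0 ?subr_gt0// addr_gt0. Qed.
Definition mid : R := (a ^+ 2 + b ^+ 2) / 2.

Definition atom (k : nat) : R :=
  match k with 0 => a | 1 => - a | 2 => b | _ => - b end.
(** [tilt1] and [tilt2] are the score functions of the conditional mean and of
    the conditional second moment: under the uniform law on the atoms they have
    mean 0, and a density 1 + f tilt1 + e tilt2 has mean f and second moment
    mid + e. *)
Definition tilt1 (y : R) : R := 2 / a * (\1_[set a] y - \1_[set (- a)] y).
Definition tilt2 (y : R) : R :=
  2 / gap * (2 * (\1_[set b] y + \1_[set (- b)] y) - 1).

Let ind1 (x y : R) : \1_[set x] y = (y == x)%:R :> R.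
Proof. by rewrite indicE; congr (nat_of_bool _)%:R; apply/idP/eqP; rewrite inE. Qed.

Let neqs : [/\ (a == - a) = false, (b == - b) = false, (b == a) = false,
  (b == - a) = false & (- b == a) = false].
Proof. by have := ab; have := a0; have := b0; split; apply/eqP => h; lra. Qed.

Lemma tilt1E : [/\ tilt1 (atom 0) = 2 / a, tilt1 (atom 1) = - (2 / a),
  tilt1 (atom 2) = 0 & tilt1 (atom 3) = 0].
Proof.
have [aa bb ba bNa Nba] := neqs.
rewrite /tilt1 /atom !ind1 !eqxx eqr_opp (eq_sym (- a)) aa ba bNa Nba /=.
by split; ring.
Qed.

Lemma tilt2E : [/\ tilt2 (atom 0) = - (2 / gap), tilt2 (atom 1) = - (2 / gap),
  tilt2 (atom 2) = 2 / gap & tilt2 (atom 3) = 2 / gap].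
Proof.
have [aa bb ba bNa Nba] := neqs.
rewrite /tilt2 /atom !ind1 !eqxx eqr_opp (eq_sym (- b)) (eq_sym a b) (eq_sym a (- b))
  (eq_sym (- a) b) bb ba bNa Nba /=.
by split; ring.
Qed.

Lemma tilt1_bound y : `|tilt1 y| <= 2 / a.
Proof.
rewrite /tilt1 normrM ger0_norm; last by rewrite divr_ge0 ?ltW.
rewrite -[leRHS]mulr1; apply: ler_wpM2l; first by rewrite divr_ge0// ltW.
rewrite !ind1.
by case: eqVneq => _; case: eqVneq => _ /=; rewrite ?subrr ?subr0 ?sub0r ?normrN ?normr1 ?normr0.
Qed.

Lemma tilt2_bound y : `|tilt2 y| <= 2 / gap.
Proof.
have g0 := gap_gt0.
rewrite /tilt2 normrM ger0_norm; last by rewrite divr_ge0 ?ltW.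
rewrite -[leRHS]mulr1; apply: ler_wpM2l; first by rewrite divr_ge0// ltW.
rewrite !ind1.
have [_ bb _ _ _] := neqs.
have n1 : `|2 * 1 - 1 : R| = 1 by rewrite ger0_norm; lra.
have [->|yb] := eqVneq y b; first by rewrite bb /= addr0 n1.
by case: eqVneq => _ /=; rewrite add0r ?n1// mulr0 sub0r normrN normr1.
Qed.

Lemma measurable_tilt1 : measurable_fun [set: R] tilt1.
Proof.
by apply: measurable_funM => //; apply: measurable_funB; exact: measurable_indic.
Qed.

Lemma measurable_tilt2 : measurable_fun [set: R] tilt2.
Proof.
apply: measurable_funM => //; apply: measurable_funB => //.
by apply: measurable_funM => //; apply: measurable_funD; exact: measurable_indic.
Qed.

Lemma sum4 (F : nat -> R) : \sum_(k < 4) F k = F 0%N + F 1%N + F 2%N + F 3%N.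
Proof. by rewrite !big_ord_recr big_ord0 /= add0r. Qed.

(** The conditional law of Y given x on the atoms, through its mean and the
    excess of its second moment over [mid].  Smallness keeps the density
    between 1/2 and 3/2. *)
Record model := Model {
  mean : X -> R;
  excess : X -> R;
  measurable_mean : measurable_fun setT mean;
  measurable_excess : measurable_fun setT excess;
  model_small : forall x, `|mean x| * (2 / a) + `|excess x| * (2 / gap) <= 2^-1
}.

Section law.
Variable m : model.
Local Notation f := (mean m).
Local Notation e := (excess m).

Definition dens (x : X) (y : R) : R := 1 + f x * tilt1 y + e x * tilt2 y.

Lemma dens_itv x y : 2^-1 <= dens x y <= 3 / 2.
Proof.
have h := model_small m x; rewrite /dens.
have h1 : `|f x * tilt1 y| <= `|f x| * (2 / a).
  by rewrite normrM ler_wpM2l// tilt1_bound.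
have h2 : `|e x * tilt2 y| <= `|e x| * (2 / gap).
  by rewrite normrM ler_wpM2l// tilt2_bound.
move: h1 h2; rewrite !ler_norml => /andP[? ?] /andP[? ?].
apply/andP; split; lra.
Qed.

Lemma dens_gt0 x y : 0 < dens x y.
Proof. by have /andP[h _] := dens_itv x y; apply: lt_le_trans h. Qed.

Definition weight (k : nat) (x : X) : R := dens x (atom k) / 4.

Lemma weight_ge0 k x : 0 <= weight k x.
Proof. by rewrite divr_ge0// ltW// dens_gt0. Qed.

Lemma weightE x : [/\ weight 0 x = (1 + f x * (2 / a) - e x * (2 / gap)) / 4,
  weight 1 x = (1 - f x * (2 / a) - e x * (2 / gap)) / 4,
  weight 2 x = (1 + e x * (2 / gap)) / 4 & weight 3 x = (1 + e x * (2 / gap)) / 4].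
Proof.
rewrite /weight /dens.
have [-> -> -> ->] := tilt1E; have [-> -> -> ->] := tilt2E.
by split; congr (_ / _); ring.
Qed.

Lemma weight_sum x : \sum_(k < 4) weight k x = 1.
Proof.
rewrite (sum4 (weight^~ x)); have [-> -> -> ->] := weightE x.
field; by rewrite !gt_eqF ?gap_gt0.
Qed.

Lemma measurable_dens : measurable_fun setT (fun z : X * R => dens z.1 z.2).
Proof.
apply: measurable_funD; first apply: measurable_funD => //.
  apply: measurable_funM.
    exact: (measurableT_comp (measurable_mean m) measurable_fst).
  exact: (measurableT_comp measurable_tilt1 measurable_snd).
apply: measurable_funM.
  exact: (measurableT_comp (measurable_excess m) measurable_fst).
exact: (measurableT_comp measurable_tilt2 measurable_snd).
Qed.

Lemma measurable_weight k : measurable_fun setT (weight k).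
Proof.
apply: measurable_funM => //.
exact: (measurableT_comp measurable_dens (@pair2_measurable _ _ _ _ (atom k))).
Qed.

Definition noise_atom (k : nat) (x : X) : R := atom k - f x.

Lemma measurable_noise_atom k : measurable_fun setT (noise_atom k).
Proof. by apply: measurable_funB => //; exact: measurable_mean. Qed.

Lemma measurable_obs_atom k : measurable_fun [set: X] (fun x => (x, atom k)).
Proof. exact: pair2_measurable. Qed.

Definition model_noise : R.-pker X ~> R :=
  katoms (N := 4) measurable_weight measurable_noise_atom weight_ge0 weight_sum.

Definition model_law : probability (X * R)%type R :=
  mixture (N := 4) measurable_weight measurable_obs_atom weight_ge0 weight_sum
   (mu := lam) (@measurable_cube R d) (@lebesgue_cube R d).

Lemma ge0_integral_model_law (phi : X * R -> \bar R) : measurable_fun setT phi ->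
  (forall z, 0 <= phi z)%E ->
  (\int[model_law]_z phi z =
   \int[lam]_(x in cube) \sum_(k < 4) (weight k x)%:E * phi (x, atom k))%E.
Proof. exact: ge0_integral_mixture_atoms. Qed.

Lemma weighted_moment1 x : \sum_(k < 4) weight k x * (atom k - f x) = 0.
Proof.
rewrite (sum4 (fun k => weight k x * (atom k - f x))).
have [-> -> -> ->] := weightE x; rewrite /atom.
field; by rewrite !gt_eqF ?gap_gt0.
Qed.

(** The variance is the second moment of Y minus the square of its mean. *)
Lemma weighted_moment2 x :
  \sum_(k < 4) weight k x * (atom k - f x) ^+ 2 = mid + e x - f x ^+ 2.
Proof.
rewrite (sum4 (fun k => weight k x * (atom k - f x) ^+ 2)).
have [-> -> -> ->] := weightE x; rewrite /atom /mid.
have g0 : b ^+ 2 - a ^+ 2 != 0 by have := gap_gt0; rewrite /gap => h; rewrite gt_eqF.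
rewrite /gap; field; by rewrite g0 gt_eqF.
Qed.

Lemma weighted_moment4 x (eta C4 : R) : `|f x| <= eta -> (b + eta) ^+ 4 <= C4 ->
  \sum_(k < 4) weight k x * (atom k - f x) ^+ 4 <= C4.
Proof.
move=> fe bC; have eta0 : 0 <= eta by exact: le_trans fe.
have ak k : `|atom k - f x| <= b + eta.
  apply: (le_trans (ler_normB _ _)); apply: lerD => //.
  have := ltW ab; have := a0; have := b0 => *.
  by case: k => [|[|[|k]]] /=; rewrite ?normrN ger0_norm// ltW.
have ak4 k : (atom k - f x) ^+ 4 <= C4.
  apply: le_trans bC; rewrite -[X in X <= _]ger0_norm ?exprn_even_ge0// normrX.
  by rewrite lerXn2r ?nnegrE//; apply: addr_ge0 => //; exact: ltW.
apply: (@le_trans _ _ (\sum_(k < 4) weight k x * C4)).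
  by apply: ler_sum => k _; rewrite ler_wpM2l ?weight_ge0.
by rewrite -mulr_suml weight_sum mul1r.
Qed.

Definition model_param (V : R) : param R d := MkParam (fun=> 1) f V model_noise.

Lemma model_is_law V : is_law (model_param V) model_law.
Proof.
move=> A B mA mB Acube /=.
have mAB : measurable [set z : X * R | A z.1 /\ B (z.2 - f z.1)].
  have -> : [set z : X * R | A z.1 /\ B (z.2 - f z.1)] =
    (fst @^-1` A) `&` ((fun z => z.2 - f z.1) @^-1` B) by [].
  apply: measurableI.
    by rewrite -[X in measurable X]setTI; exact: measurable_fst.
  rewrite -[X in measurable X]setTI.
  apply: (measurable_funB measurable_snd (measurableT_comp (measurable_mean m) measurable_fst)) => //.
rewrite -[LHS]/(\int[lam]_(x in cube) (atoms (N := 4) weight_ge0 measurable_weight measurable_obs_atom weight_sum x _))%E.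
rewrite [RHS](_ : _ = \int[lam]_(x in A) model_noise x B)%E; last first.
  by apply: eq_integral => x _; rewrite mul1e.
have AE : A = cube `&` A by apply/seteqP; split => [x Ax|x []//]; split => //; exact: Acube.
rewrite [in RHS]AE integral_mkcondr; apply: eq_integral => x xc.
rewrite atomsE patchE.
case: ifPn => xA.
  rewrite [RHS]atomsE; congr (_%:E); apply: eq_bigr => k _; congr (_ * _).
  rewrite !indicE; congr (nat_of_bool _)%:R; apply/idP/idP; rewrite !inE/=.
    by case.
  by move=> h; split => //; rewrite inE in xA.
transitivity (0%R%:E : \bar R) => //; congr (_%:E).
rewrite big1// => k _; rewrite indicE memNset ?mulr0//= => -[Ax _].
by move/negP: xA; apply; rewrite inE.
Qed.

Lemma model_Theta (s : R) (U : set X) (pm pp Ls vm vp C4 V eta : R) :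
  0 < s -> s <= 1 -> pm < 1 -> 1 < pp -> vm <= V <= vp ->
  (forall x, `|f x| <= eta) -> (b + eta) ^+ 4 <= C4 ->
  (forall x, mid + e x - f x ^+ 2 = V) ->
  is_Ck (hoelder_order s) U f -> (hoelder_norm s U f <= Ls%:E)%E ->
  Theta s U pm pp Ls vm vp C4 (model_param V).
Proof.
move=> s0 s1 pm1 pp1 Vv feta bC fV fC fL; split => //=.
- split.
    split => //.
    rewrite (integral_cst lam (@measurable_cube R d) 1%E) mul1e.
    exact: lebesgue_cube.
  by apply/nearW => x _; rewrite !ltW.
- by exists f; split.
- suff good x : [/\ (\int[model_noise x]_u u%:E = 0)%E,
      (\int[model_noise x]_u (u ^+ 2)%:E = V%:E)%E &
      (\int[model_noise x]_u (u ^+ 4)%:E <= C4%:E)%E].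
    exists set0; split => //; last by move=> x /= /(_ (good x)).
    by rewrite /design_law set0I integral_set0.
  split.
  + rewrite (integral_atoms _ _ _ _ _ (f := id))//=.
    by rewrite /noise_atom weighted_moment1.
  + rewrite (integral_atoms _ _ _ _ _ (f := fun u : R => u ^+ 2))//=.
    by rewrite /noise_atom weighted_moment2 fV.
  + rewrite (integral_atoms _ _ _ _ _ (f := fun u : R => u ^+ 4))//= lee_fin.
    by rewrite /noise_atom; exact: (weighted_moment4 (feta x)).
Qed.

End law.
End model.

(** * Perturbing a model by random signs *)

Section perturbation.
Variables (R : realType) (d : nat) (a b : R).
Hypotheses (a0 : 0 < a) (ab : a < b).
Local Notation X := 'rV[R]_d.
Local Notation lam := (lebesgue_rV R d).
Local Notation cube := (unit_cube R d).
Local Notation model := (model d a b).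
Local Notation T1 := (tilt1 a).
Local Notation T2 := (tilt2 a b).
Local Notation law := (model_law a0 ab).

Variables (I : finType) (J : X -> I) (m : model) (A B : X -> R)
  (mr : {ffun I -> bool} -> model) (tau vol : R).
Hypotheses (mJ : forall j, measurable [set x | J x = j])
  (Jvol : forall j, (lam (cube `&` [set x | J x = j]) <= vol%:E)%E)
  (mA : measurable_fun setT A) (mB : measurable_fun setT B)
  (tau0 : 0 <= tau) (ABtau : forall x, `|A x| * (2 / a) + `|B x| * (2 / gap a b) <= tau)
  (meanr : forall r x, mean (mr r) x = mean m x + sgb R (r (J x)) * A x)
  (excessr : forall r x, excess (mr r) x = excess m x + sgb R (r (J x)) * B x).

Let g (x : X) (y : R) : R := (A x * T1 y + B x * T2 y) / dens m x y.
Let h (r : {ffun I -> bool}) (z : X * R) : R := dens (mr r) z.1 z.2 / dens m z.1 z.2.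

Let dgt0 x y := dens_gt0 a0 ab m x y.

Let dens_mr r x y : dens (mr r) x y = dens m x y + sgb R (r (J x)) * (A x * T1 y + B x * T2 y).
Proof. by rewrite /dens meanr excessr; ring. Qed.

Let hE r x y : h r (x, y) = 1 + sgb R (r (J x)) * g x y.
Proof.
rewrite /h /g/= dens_mr mulrDl divff ?gt_eqF//; congr (_ + _); ring.
Qed.

Let measurable_dens_inv : measurable_fun setT (fun z : X * R => (dens m z.1 z.2)^-1).
Proof.
apply: (eq_measurable_fun (fun z : X * R => dens m z.1 z.2 `^ (- 1))).
  by move=> z _; rewrite powR_inv1// ltW.
by apply: (measurableT_comp (@measurable_powR R (- 1))); exact: measurable_dens.
Qed.

Let mh r : measurable_fun setT (h r).
Proof.
apply: measurable_funM; first exact: measurable_dens.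
exact: measurable_dens_inv.
Qed.

Let h0 r z : 0 <= h r z.
Proof. by rewrite /h divr_ge0// ltW// (dens_gt0 a0 ab (mr r)). Qed.

Let weight_h r k x : weight m k x * h r (x, atom a b k) = weight (mr r) k x.
Proof.
rewrite /weight /h/=; field; by rewrite gt_eqF.
Qed.

Lemma law_density r (phi : X * R -> \bar R) : measurable_fun setT phi ->
  (forall z, 0 <= phi z)%E ->
  (\int[law (mr r)]_z phi z = \int[law m]_z ((h r z)%:E * phi z))%E.
Proof.
move=> mphi phi0; rewrite !ge0_integral_model_law//; last 2 first.
- by apply: emeasurable_funM => //; apply/measurable_EFinP; exact: mh.
- by move=> z; rewrite mule_ge0// lee_fin; exact: h0.
apply: eq_integral => x _; apply: eq_bigr => k _.
by rewrite muleA -EFinM weight_h.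
Qed.

(** The conditional chi-square increment: the inner product of the likelihood
    ratios of two sign patterns is 1 + sum_j r_j r'_j [Iv j], where [Iv j]
    integrates q over the cell j. *)
Let q (x : X) : R := \sum_(k < 4) weight m k x * g x (atom a b k) ^+ 2.

Let num_bound x y : `|A x * T1 y + B x * T2 y| <= tau.
Proof.
apply: le_trans (ABtau x); apply: (le_trans (ler_normD _ _)).
rewrite (normrM (A x)) (normrM (B x)).
by apply: lerD; apply: ler_wpM2l => //; [exact: tilt1_bound|exact: tilt2_bound].
Qed.

Let q0 x : 0 <= q x.
Proof. by apply: sumr_ge0 => k _; rewrite mulr_ge0 ?sqr_ge0// weight_ge0. Qed.

Let q_bound x : q x <= 2 * tau ^+ 2.
Proof.
apply: (@le_trans _ _ (\sum_(k < 4) tau ^+ 2 / 2)).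
  apply: ler_sum => k _; rewrite /weight /g.
  set y := atom a b k; set D := dens m x y; set t := _ + _.
  have D0 : 0 < D by exact: dgt0.
  have /andP[Dl _] := dens_itv a0 ab m x y; rewrite -/D in Dl.
  have -> : D / 4 * (t / D) ^+ 2 = t ^+ 2 / (4 * D) by field; rewrite gt_eqF.
  have t2 : t ^+ 2 <= tau ^+ 2.
    rewrite -(real_normK (num_real t)) lerXn2r ?nnegrE//; exact: num_bound.
  apply: (@le_trans _ _ (tau ^+ 2 / (4 * D))).
    by rewrite ler_wpM2r// invr_ge0 mulr_ge0// ltW.
  rewrite ler_wpM2l ?sqr_ge0// lef_pV2 ?posrE ?mulr_gt0//; lra.
by rewrite sumr_const card_ord -mulr_natl; lra.
Qed.

Let mg k : measurable_fun setT (fun x => g x (atom a b k)).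
Proof.
apply: measurable_funM.
  apply: measurable_funD; apply: measurable_funM => //.
exact: (measurableT_comp measurable_dens_inv (@pair2_measurable _ _ _ _ _)).
Qed.

Let mq : measurable_fun setT q.
Proof.
apply: measurable_sum => k; apply: measurable_funM; first exact: measurable_weight.
by apply: measurable_funX; exact: mg.
Qed.

(** The perturbation has mean 0 under the unperturbed conditional law, which
    removes the terms linear in the signs. *)
Let sum_g x : \sum_(k < 4) weight m k x * g x (atom a b k) = 0.
Proof.
have E k : weight m k x * g x (atom a b k) = (A x * T1 (atom a b k) + B x * T2 (atom a b k)) / 4.
  by rewrite /weight /g; field; rewrite gt_eqF.
under eq_bigr do rewrite E.
rewrite (sum4 (fun k => (A x * T1 (atom a b k) + B x * T2 (atom a b k)) / 4)).
have [-> -> -> ->] := tilt1E a0 ab; have [-> -> -> ->] := tilt2E a0 ab.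
ring.
Qed.

Let cell j := [set x : X | J x = j].
Let Iv j : R := fine (\int[lam]_(x in cube `&` cell j) (q x)%:E).

Let mcc j : measurable (cube `&` cell j).
Proof. by apply: measurableI; [exact: measurable_cube|exact: mJ]. Qed.

Let Ifin j : (\int[lam]_(x in cube `&` cell j) (q x)%:E <= (2 * tau ^+ 2 * vol)%:E)%E.
Proof.
apply: (@le_trans _ _ (\int[lam]_(x in cube `&` cell j) (2 * tau ^+ 2)%:E)%E).
  apply: ge0_le_integral => //.
  - by move=> x _; rewrite lee_fin.
  - by apply/measurable_EFinP; exact: measurable_funTS.
  - by move=> x _; rewrite lee_fin.
rewrite (integral_cst lam (mcc j)) [leRHS]EFinM; apply: lee_wpmul2l; last exact: Jvol.
by rewrite lee_fin mulr_ge0// sqr_ge0.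
Qed.

Let IvE j : (\int[lam]_(x in cube `&` cell j) (q x)%:E = (Iv j)%:E)%E.
Proof.
rewrite /Iv fineK// ge0_fin_numE; first exact: le_lt_trans (Ifin j) (ltry _).
by apply: integral_ge0 => x _; rewrite lee_fin.
Qed.

Let Iv0 j : 0 <= Iv j.
Proof. by rewrite -lee_fin -IvE; apply: integral_ge0 => x _; rewrite lee_fin. Qed.

Let Iv_le j : Iv j <= 2 * tau ^+ 2 * vol.
Proof. by rewrite -lee_fin -IvE. Qed.

Let h1 r : (\int[law m]_z (h r z)%:E = 1)%E.
Proof.
rewrite -[RHS](integral_probability_cst (law (mr r))) (@law_density r (cst 1)%E)//.
by apply: eq_integral => z _; rewrite mule1.
Qed.

Let h2 r r' : (\int[law m]_z (h r z * h r' z)%:E =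
  (1 + \sum_j sgb R (r j) * sgb R (r' j) * Iv j)%:E)%E.
Proof.
rewrite ge0_integral_model_law; last 2 first.
- by apply/measurable_EFinP; apply: measurable_funM; exact: mh.
- by move=> z; rewrite lee_fin mulr_ge0//; exact: h0.
transitivity (\int[lam]_(x in cube) (1 + sgb R (r (J x)) * sgb R (r' (J x)) * q x)%:E)%E.
  apply: eq_integral => x _; under eq_bigr do rewrite -EFinM.
  rewrite sumEFin; congr (_%:E).
  under eq_bigr do rewrite !hE.
  have -> : 1 + sgb R (r (J x)) * sgb R (r' (J x)) * q x =
     \sum_(k < 4) weight m k x + (sgb R (r (J x)) + sgb R (r' (J x))) *
       (\sum_(k < 4) weight m k x * g x (atom a b k)) + sgb R (r (J x)) * sgb R (r' (J x)) * q x.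
    by rewrite weight_sum// sum_g mulr0 addr0.
  by rewrite /q !mulr_sumr -!big_split/=; apply: eq_bigr => k _; ring.
have lamc : (lam cube < +oo)%E by rewrite (@lebesgue_cube R d) ltry.
have mc := @measurable_cube R d.
pose F j x := (sgb R (r j) * sgb R (r' j)) * (q x * \1_(cell j) x).
have sq x : sgb R (r (J x)) * sgb R (r' (J x)) * q x = \sum_j F j x.
  rewrite (bigD1 (J x))//= big1 ?addr0.
    by rewrite /F indicE mem_set ?mulr1.
  by move=> j jx; rewrite /F indicE memNset ?mulr0//= => E; rewrite E eqxx in jx.
have mF j : measurable_fun cube (fun x => q x * \1_(cell j) x).
  apply: measurable_funTS; apply: measurable_funM => //.
  by apply: measurable_indic; exact: mJ.
have iF j : lam.-integrable cube (EFin \o (fun x => q x * \1_(cell j) x)).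
  apply: measurable_bounded_integrable => //.
  exists (2 * tau ^+ 2); split; first exact: num_real.
  move=> M bM x _; apply: ltW; apply: le_lt_trans bM.
  rewrite normrM (ger0_norm (q0 x)) -[leRHS]mulr1; apply: ler_pM => //.
  by rewrite indicE; case: (_ \in _); rewrite ?normr1 ?normr0.
under eq_integral do rewrite sq EFinD -sumEFin.
rewrite integralD//; last 2 first.
- apply: (measurable_bounded_integrable (f := cst 1)) => //.
  exists 1; split; first exact: num_real.
  by move=> M M1 x _ /=; rewrite normr1; exact: ltW.
- apply: integrable_sum => // j _; under eq_fun do rewrite /F EFinM.
  exact: (integrableZl mc _ (iF j)).
rewrite EFinD; congr (_ + _)%E.
  rewrite (integral_cst lam mc 1%E) mul1e; exact: lebesgue_cube.
rewrite integral_sum//; last first.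
  by move=> j; under eq_fun do rewrite /F EFinM; exact: (integrableZl mc _ (iF j)).
rewrite -sumEFin; apply: eq_bigr => j _.
under eq_integral do rewrite /F EFinM.
rewrite [RHS]EFinM; apply: etrans (integralZl mc (iF j) _) _; congr (_ * _)%E.
rewrite -IvE integral_mkcondr; apply: eq_integral => x _.
by rewrite patchE /= indicE; case: ifPn => _; rewrite ?mulr1// mulr0.
Qed.

(** The perturbation changes mean and excess by one unknown sign per cell.
    With tau bounding the change of the density and vol the volume of
    a cell, the chi-square contribution of a cell is at most 2 tau^2 vol; the
    second moment method is applied with lam = eta. *)
Lemma perturbation_step n (phi : n.-tuple (X * R)%type -> R) (eta : R) :
  0 < eta -> eta <= 1 ->
  2 * n%:R ^+ 2 * (#|I|%:R * (2 * tau ^+ 2 * vol) ^+ 2) <= eta ^+ 2 / 2 ->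
  measurable_fun setT phi -> (forall t, 0 <= phi t <= 1) ->
  exists r, (\int[iid (law (mr r)) n]_t (phi t)%:E <=
     \int[iid (law m) n]_t (phi t)%:E + eta%:E)%E.
Proof.
move=> eta0 eta1 small mphi phi01.
have vol0 (j : I) : 0 <= 2 * tau ^+ 2 * vol by exact: le_trans (Iv_le j).
have sumI : \sum_j Iv j ^+ 2 <= #|I|%:R * (2 * tau ^+ 2 * vol) ^+ 2.
  rewrite mulr_natl -sumr_const; apply: ler_sum => j _.
  by rewrite lerXn2r ?nnegrE//; exact: (vol0 j).
clear vol0.
have n20 : 0 <= 2 * n%:R ^+ 2 :> R by rewrite mulr_ge0// sqr_ge0.
pose Y := 2 * n%:R ^+ 2 * \sum_j Iv j ^+ 2.
have Y0 : 0 <= Y by rewrite mulr_ge0// sumr_ge0// => j _; exact: sqr_ge0.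
have Yeta : Y <= eta ^+ 2 / 2.
  by apply: le_trans small; rewrite /Y ler_wpM2l.
have eta21 : eta ^+ 2 <= 1 by rewrite expr_le1// ltW.
have Ivn j : (n%:R * Iv j) ^+ 2 <= 2^-1.
  rewrite exprMn.
  have : Iv j ^+ 2 <= \sum_j Iv j ^+ 2.
    by rewrite (bigD1 j)//= lerDl sumr_ge0// => i _; exact: sqr_ge0.
  move=> /(ler_wpM2l n20); rewrite -/Y => h3; lra.
have [r hr] := second_moment_method mh h0 h1 h2 eta0 Ivn mphi phi01.
exists r; rewrite -[X in (X <= _)%E]/(\int[powm (law (mr r)) n]_t (phi t)%:E)%E.
rewrite (@integral_powm_density _ _ R (law m) (law (mr r)) (EFin \o h r)); last 5 first.
- by apply/measurable_EFinP; exact: mh.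
- by move=> x; rewrite lee_fin.
- by move=> f mf f0; rewrite law_density.
- exact/measurable_EFinP.
- by move=> t; rewrite lee_fin; have /andP[] := phi01 t.
under eq_integral do rewrite /= prodEFin -EFinM.
apply: (le_trans hr); apply: leeD2l; rewrite lee_fin -/Y.
have eY : expR Y <= 1 + 2 * Y.
  rewrite -[leLHS]invrK -expRN.
  apply: (@le_trans _ _ (1 - Y)^-1).
    rewrite lef_pV2 ?posrE ?expR_gt0//; last lra.
    exact: expR_ge1Dx.
  rewrite -[leLHS]mul1r ler_pdivrMr; last lra.
  nra.
have : (expR Y - 1) / (2 * eta) <= eta / 2.
  rewrite ler_pdivrMr; last by rewrite mulr_gt0.
  have -> : eta / 2 * (2 * eta) = eta ^+ 2 by field.
  lra.
lra.
Qed.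

End perturbation.

(** * The lower bounds *)

Section resolution.
Variable R : realType.

(** M is one more than the integer part of n^(2/(d+4s)). *)
Lemma choose_resolution (s : R) (d n : nat) : 0 < s -> (0 < n)%N ->
  exists M : nat, [/\ (0 < M)%N,
    n%:R ^+ 2 <= M%:R ^+ d * M%:R `^ (4 * s) &
    M%:R <= 2 * n%:R `^ (2 / (d%:R + 4 * s))].
Proof.
move=> s0 n0; set q := 2 / (d%:R + 4 * s).
have ds : 0 < d%:R + 4 * s by rewrite ltr_wpDl// mulr_gt0.
have q0 : 0 < q by rewrite divr_gt0.
set x := n%:R `^ q.
have n1 : 1 <= n%:R :> R by rewrite ler1n.
have x1 : 1 <= x by have := ler_powR n1 (ltW q0); rewrite powRr0.
exists (Num.truncn x).+1; split => //.
- have xM : x <= (Num.truncn x).+1%:R by apply/ltW/truncnS_gt.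
  have -> : n%:R ^+ 2 = x `^ (d%:R + 4 * s).
    by rewrite -powRrM /q divfK ?gt_eqF// -powR_mulrn.
  rewrite -powR_mulrn// -powRD; last by apply/implyP => _; rewrite pnatr_eq0.
  by rewrite ge0_ler_powR ?nnegrE ?(ltW ds)//; lra.
- rewrite -natr1; have : (Num.truncn x)%:R <= x by rewrite truncn_le; lra.
  lra.
Qed.

(** The witness is the inverse of one plus the sum of the ratios X_i / Y_i. *)
Lemma small_scale (n : nat) (X Y : 'I_n -> R) : (forall i, 0 <= X i) -> (forall i, 0 < Y i) ->
  exists c : R, [/\ 0 < c, c <= 1 & forall i, c * X i <= Y i].
Proof.
move=> X0 Y0; pose D := 1 + \sum_i X i / Y i.
have S0 : 0 <= \sum_i X i / Y i.
  by apply: sumr_ge0 => i _; rewrite divr_ge0// ltW.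
have D0 : 0 < D by rewrite /D; lra.
exists D^-1; split.
- by rewrite invr_gt0.
- by rewrite invf_le1// /D; lra.
- move=> i; rewrite mulrC ler_pdivrMr// -ler_pdivrMl//.
  rewrite mulrC /D (bigD1 i)//=.
  have : 0 <= \sum_(j < n | j != i) X j / Y j.
    by apply: sumr_ge0 => j _; rewrite divr_ge0// ltW.
  lra.
Qed.

Lemma le_root (c : R) (x : \bar R) : 0 <= c -> ((c ^+ 2)%:E <= x)%E -> (c%:E <= x `^ 2^-1)%E.
Proof.
move=> c0 cx; have -> : (c%:E = ((c ^+ 2)%:E) `^ 2^-1)%E.
  by rewrite poweR_EFin powR12_sqrt ?sqr_ge0// sqrtr_sqr ger0_norm.
apply: gt0_ler_poweR => //; rewrite in_itv/= ?leey ?andbT ?lee_fin ?sqr_ge0//.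
by apply: le_trans cx; rewrite lee_fin sqr_ge0.
Qed.

Lemma root_le (c : R) (x : \bar R) : 0 <= c -> (0 <= x)%E -> (x <= (c ^+ 2)%:E)%E ->
  (x `^ 2^-1 <= c%:E)%E.
Proof.
move=> c0 x0 xc; have -> : (c%:E = ((c ^+ 2)%:E) `^ 2^-1)%E.
  by rewrite poweR_EFin powR12_sqrt ?sqr_ge0// sqrtr_sqr ger0_norm.
by apply: gt0_ler_poweR => //; rewrite in_itv/= ?leey ?andbT ?lee_fin ?sqr_ge0.
Qed.

Lemma norm_onem_le (t k : R) : 0 <= t -> t <= k -> 1 <= k -> `|1 - t| <= k.
Proof. by move=> t0 tk k1; rewrite ler_norml; apply/andP; split; lra. Qed.

End resolution.

Section two_points.
Local Open Scope ereal_scope.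
Context (R : realType) (d : nat).
Local Notation Z := ('rV[R]_d * R)%type.

Lemma rms_riskE n (P : probability Z R) (Vh : n.-tuple Z -> R) (V : R) :
  rms_risk P Vh V = (\int[iid P n]_z ((Vh z - V) ^+ 2)%:E) `^ 2^-1.
Proof. by rewrite /rms_risk unlock. Qed.

(** Le Cam's argument with the test that asks whether the estimator is at
    distance at least Del / 2 from V0.  Either the test rejects under P0 with
    probability at least 1/4, and the estimator errs under P0; or it accepts
    under P1 with probability at least 1/4, and the estimator errs under P1. *)
Lemma two_point_bound n (P0 P1 : probability Z R) (Vh : n.-tuple Z -> R)
    (V0 V1 rho : R) (Del : R) :
  measurable_fun setT Vh -> (0 < Del)%R -> (Del <= `|V0 - V1|)%R ->
  (forall phi : n.-tuple Z -> R, measurable_fun setT phi ->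
     phi = (fun t => (Del / 2 <= `|Vh t - V0|)%R%:R) ->
     \int[iid P1 n]_t (phi t)%:E <= \int[iid P0 n]_t (phi t)%:E + (2^-1)%:E) ->
  rms_risk P0 Vh V0 <= rho%:E -> rms_risk P1 Vh V1 <= rho%:E -> (Del / 4 <= rho)%R.
Proof.
move=> mV D0 DV test r0 r1.
pose phi (t : n.-tuple Z) : R := (Del / 2 <= `|Vh t - V0|)%R%:R.
have phi01 t : (0 <= phi t <= 1)%R by rewrite /phi; case: (Del / 2 <= _)%R; rewrite /= ?lexx ?ler01.
have mphi : measurable_fun setT phi.
  have mb : measurable_fun setT (fun t : n.-tuple Z => (Del / 2 <= `|Vh t - V0|)%R).
    apply: measurable_fun_ler => //; apply: measurableT_comp => //.
    by apply: measurable_funB.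
  apply: (measurableT_comp (f := fun b : bool => b%:R : R)) => //.
have := test phi mphi erefl.
set p0 := \int[iid P0 n]_t (phi t)%:E; set p1 := \int[iid P1 n]_t (phi t)%:E => p01.
have D2 : (0 <= (Del / 2) ^+ 2)%R by exact: sqr_ge0.
have e0 : ((Del / 2) ^+ 2)%:E * p0 <= \int[iid P0 n]_t ((Vh t - V0) ^+ 2)%:E.
  rewrite -ge0_integralZl//; last 2 first.
  - exact/measurable_EFinP.
  - by move=> t _; rewrite lee_fin; have /andP[] := phi01 t.
  apply: ge0_le_integral => //.
  - by move=> t _; rewrite -EFinM lee_fin mulr_ge0//; have /andP[] := phi01 t.
  - by apply: measurable_funeM; exact/measurable_EFinP.
  - apply/measurable_EFinP; apply: measurable_funX; exact: measurable_funB.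
  - move=> t _; rewrite -EFinM lee_fin /phi; case: (boolP (Del / 2 <= _)%R) => h; last by rewrite mulr0 sqr_ge0.
    rewrite mulr1 -[leRHS](real_normK (num_real _)) lerXn2r ?nnegrE//.
    by rewrite divr_ge0// ltW.
have e1 : ((Del / 2) ^+ 2)%:E * \int[iid P1 n]_t (1 - phi t)%:E <= \int[iid P1 n]_t ((Vh t - V1) ^+ 2)%:E.
  have m1 : measurable_fun setT (fun t => 1 - phi t)%R by exact: measurable_funB.
  have p1t t : (0 <= 1 - phi t)%R by rewrite subr_ge0; have /andP[] := phi01 t.
  rewrite -ge0_integralZl//; last 2 first.
  - exact/measurable_EFinP.
  - by move=> t _; rewrite lee_fin.
  apply: ge0_le_integral => //.
  - by move=> t _; rewrite -EFinM lee_fin mulr_ge0.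
  - by apply: measurable_funeM; exact/measurable_EFinP.
  - apply/measurable_EFinP; apply: measurable_funX; exact: measurable_funB.
  - move=> t _; rewrite -EFinM lee_fin /phi; case: (boolP (Del / 2 <= _)%R) => h /=.
      by rewrite subrr mulr0 sqr_ge0.
    rewrite subr0 mulr1 -[leRHS](real_normK (num_real _)) lerXn2r ?nnegrE//.
      by rewrite divr_ge0// ltW.
    move: h; rewrite -ltNge => h.
    have : (`|V0 - V1| <= `|Vh t - V1| + `|Vh t - V0|)%R.
      by rewrite [leRHS]addrC (distrC (Vh t) V0); exact: ler_distD.
    lra.
have fin1 (P : probability Z R) : \int[iid P n]_t (phi t)%:E + \int[iid P n]_t (1 - phi t)%:E = 1.
  rewrite -ge0_integralD//.
  - under eq_integral do rewrite -EFinD addrC subrK.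
    by rewrite (integral_cst (iid P n))//= (@probability_setT _ _ _ (iid P n)) mule1.
  - by move=> t _; rewrite lee_fin; have /andP[] := phi01 t.
  - exact/measurable_EFinP.
  - by move=> t _; rewrite lee_fin subr_ge0; have /andP[] := phi01 t.
  - by apply/measurable_EFinP; exact: measurable_funB.
have ge0p (P : probability Z R) : 0 <= \int[iid P n]_t (phi t)%:E.
  by apply: integral_ge0 => t _; rewrite lee_fin; have /andP[] := phi01 t.
have ge0q (P : probability Z R) : 0 <= \int[iid P n]_t (1 - phi t)%:E.
  by apply: integral_ge0 => t _; rewrite lee_fin subr_ge0; have /andP[] := phi01 t.
have Dq : ((Del / 4) ^+ 2 = (Del / 2) ^+ 2 * 4^-1)%R by field.
have conclude (P : probability Z R) V : rms_risk P Vh V <= rho%:E ->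
    ((Del / 4) ^+ 2)%:E <= \int[iid P n]_t ((Vh t - V) ^+ 2)%:E -> (Del / 4 <= rho)%R.
  rewrite rms_riskE => le_rho /le_root h; rewrite -lee_fin; apply: le_trans le_rho.
  by apply: h; rewrite divr_ge0// ltW.
have finx (P : probability Z R) : exists p q : R,
    [/\ \int[iid P n]_t (phi t)%:E = p%:E, \int[iid P n]_t (1 - phi t)%:E = q%:E &
      (p + q = 1)%R].
  move: (fin1 P) (ge0p P) (ge0q P).
  case: (\int[iid P n]_t (phi t)%:E) => [p||]; case: (\int[iid P n]_t (1 - phi t)%:E) => [q||] //.
  by rewrite -EFinD => -[pq] _ _; exists p, q.
have [x0 [y0 [E0 F0 s0]]] := finx P0; have [x1 [y1 [E1 F1 s1]]] := finx P1.
move: p01 e0 e1; rewrite /p0 /p1 E0 E1 F1 -EFinD -!EFinM !lee_fin => p01 e0 e1.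
have [p0g|p0l] := leP 4^-1%R x0.
  apply: (conclude _ _ r0); apply: le_trans e0; rewrite lee_fin Dq.
  exact: ler_wpM2l.
apply: (conclude _ _ r1); apply: le_trans e1; rewrite lee_fin Dq.
by apply: ler_wpM2l => //; lra.
Qed.

End two_points.

Section lower_bounds.
Variables (R : realType) (d : nat) (a b : R).
Hypotheses (a0 : 0 < a) (ab : a < b).
Local Notation X := 'rV[R]_d.
Local Notation color := {ffun 'I_d -> bool}.
Local Notation K := #|{ffun 'I_d -> bool}|.
Local Notation gp := (gap a b).
Local Notation md := (mid a b).

Let gap0 : 0 < gp. Proof. exact: gap_gt0. Qed.
Let b0 : 0 < b. Proof. exact: lt_trans a0 ab. Qed.

Section constant_model.
Variable e : R.
Hypothesis e_small : `|e| * (2 / gp) <= 2^-1.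

Let small (x : X) : `|(fun=> 0 : R) x| * (2 / a) + `|(fun=> e) x| * (2 / gp) <= 2^-1.
Proof. by rewrite /= normr0 mul0r add0r. Qed.

Definition constant_model : model d a b :=
  @Model R d a b (fun=> 0) (fun=> e) (@measurable_cst _ _ _ _ _ _) (@measurable_cst _ _ _ _ _ _) small.
End constant_model.

Lemma zero_hoelder (s : R) (U : set X) (Ls : R) : 0 < s -> s <= 1 -> 0 <= Ls ->
  is_Ck (hoelder_order s) U ((fun=> 0) : X -> R) /\
  (hoelder_norm s U ((fun=> 0%R) : X -> R) <= Ls%:E)%E.
Proof.
move=> s0 s1 Ls0.
have [||||] := @hoelder_norm_le R d s s0 s1 U (fun=> 0) 0 0 => //.
- by move=> x; rewrite normr0.
- by move=> x y; rewrite subrr normr0 mul0r.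
- by rewrite addr0 => h1 h2; split => //; apply: le_trans h2 _; rewrite lee_fin.
Qed.

(** A perturbation step with a single cell: the second moment of Y is moved by a
    multiple e of n^(-1/2), upwards or downwards, whichever the step selects.
    Both models have zero regression function, so the variance moves with it. *)
Lemma parametric_lower_bound (s : R) (U : set X) (pm pp Ls vm vp C4 : R)
    (n : nat) (Vh : n.-tuple (X * R)%type -> R) (rho : R) :
  0 < s -> s <= 1 -> pm < 1 -> 1 < pp -> 0 < Ls ->
  vm <= a ^+ 2 -> b ^+ 2 <= vp -> b ^+ 4 <= C4 -> (0 < n)%N ->
  measurable_fun setT Vh ->
  (forall theta P, Theta s U pm pp Ls vm vp C4 theta -> is_law theta P ->
     (rms_risk P Vh (variance_level theta) <= rho%:E)%E) ->
  gp / 32 * n%:R `^ (- 2^-1) <= rho.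
Proof.
move=> s0 s1 pm1 pp1 Ls0 va vb bC n0 mV risk.
set w := n%:R `^ (- 2^-1).
have n0' : 0 < n%:R :> R by rewrite ltr0n.
have w0 : 0 < w by rewrite powR_gt0.
have w2 : w ^+ 2 = n%:R^-1.
  by rewrite -powR_mulrn ?(ltW w0)// -powRrM mulNr mulVf// powR_inv1// ltW.
have w1 : w <= 1.
  by rewrite -(@ler_pXn2r _ 2) ?nnegrE ?(ltW w0)// w2 expr1n invf_le1// ler1n.
pose e := gp / 8 * w.
have e0 : 0 < e by rewrite mulr_gt0// divr_gt0.
have eg : e * (2 / gp) = w / 4 by rewrite /e; field; rewrite gt_eqF.
have small (c : R) : `|c| <= e -> `|c| * (2 / gp) <= 2^-1.
  move=> ce; apply: (@le_trans _ _ (e * (2 / gp))).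
    by rewrite ler_wpM2r// divr_ge0// ltW.
  by rewrite eg; lra.
have e00 : `|0 : R| <= e by rewrite normr0 ltW.
have ee bb : `|sgb R bb * e| <= e by rewrite normrM sgb_norm mul1r ger0_norm// ltW.
pose m0 := constant_model (small _ e00).
pose mr (r : {ffun unit -> bool}) := constant_model (small _ (ee (r tt))).
have eb : e <= gp / 2.
  by rewrite /e -mulrA ler_pM2l//; lra.
have member V (c : R) (cs : `|c| * (2 / gp) <= 2^-1) : md + c = V -> `|c| <= e ->
    Theta s U pm pp Ls vm vp C4 (model_param a0 ab (constant_model cs) V).
  move=> cV ce; have [h1 h2] := @zero_hoelder s U Ls s0 s1 (ltW Ls0).
  apply: (@model_Theta R d a b a0 ab (constant_model cs) s U pm pp Ls vm vp C4 V 0) => //.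
  - move: ce eb; rewrite ler_norml /gap => /andP[c1 c2] eb'.
    by rewrite -cV /mid; apply/andP; split; lra.
  - by move=> x; rewrite normr0.
  - by rewrite addr0.
  - by move=> x; rewrite /= expr0n subr0.
pose phi (t : n.-tuple (X * R)%type) : R := (e / 2 <= `|Vh t - md|)%R%:R.
have mphi : measurable_fun setT phi.
  apply: (measurableT_comp (f := fun b : bool => b%:R : R)) => //.
  apply: measurable_fun_ler => //; apply: measurableT_comp => //.
  exact: measurable_funB.
have [r hr] : exists r,
    (\int[iid (model_law a0 ab (mr r)) n]_t (phi t)%:E <=
     \int[iid (model_law a0 ab m0) n]_t (phi t)%:E + (2^-1)%:E)%E.
  apply: (@perturbation_step R d a b a0 ab unit (fun=> tt) m0 (fun=> 0) (fun=> e) mr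
    (w / 4) 1) => //.
  - by move=> j; rewrite (_ : [set x | tt = j] = setT)//; apply/seteqP; split => // x _; case: j.
  - move=> j; rewrite -(@lebesgue_cube R d); apply: le_measure; rewrite ?inE.
    + apply: measurableI; first exact: measurable_cube.
      by rewrite (_ : [set x | tt = j] = setT)//; apply/seteqP; split => // x _; case: j.
    + exact: measurable_cube.
    + exact: subIsetl.
  - by rewrite divr_ge0// ltW.
  - by move=> x; rewrite normr0 mul0r add0r ger0_norm ?eg// ltW.
  - by move=> r x; rewrite /= mulr0 addr0.
  - by move=> r x; rewrite /= add0r.
  - by lra.
  - rewrite card_unit mul1r mulr1.
    have -> : 2 * n%:R ^+ 2 * (2 * (w / 4) ^+ 2) ^+ 2 = (n%:R * w ^+ 2) ^+ 2 / 32 by field.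
    by rewrite w2 divff ?gt_eqF// expr1n; lra.
  - by move=> t; rewrite /phi; case: (e / 2 <= _); rewrite /= ?lexx ?ler01.
have := @two_point_bound R d n (model_law a0 ab m0) (model_law a0 ab (mr r)) Vh
  md (md + sgb R (r tt) * e) rho e mV e0.
have -> : gp / 32 * w = e / 4 by rewrite /e; field.
apply.
- have -> : md - (md + sgb R (r tt) * e) = - (sgb R (r tt) * e) by ring.
  by rewrite normrN normrM sgb_norm mul1r ger0_norm// ltW.
- by move=> phi' _ ->; exact: hr.
- apply: (risk (model_param a0 ab m0 md)); last exact: model_is_law.
  by apply: member => //; rewrite addr0.
- apply: (risk (model_param a0 ab (mr r) (md + sgb R (r tt) * e))); last exact: model_is_law.
  exact: member.
Qed.

Section bump_model.
Variables (M : nat) (delta : R).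
Hypotheses (M0 : (0 < M)%N) (delta0 : 0 < delta) (delta1 : delta <= 1).
Hypothesis delta_small :
  delta * (K%:R * (2 / a) + (K%:R ^+ 2 + K%:R) * (2 / gp)) <= 2^-1.
Local Notation sign := {ffun {ffun 'I_d -> 'I_M.+1} -> bool}.

Let K1 : 1 <= K%:R :> R.
Proof. by rewrite ler1n card_ffun card_bool expn_gt0. Qed.

Definition bump_mean (rs : seq (color * sign)) (x : X) : R :=
  delta * bump_sum rs x.
(** With these values the conditional variance
    mid + excess - mean^2 is mid + delta^2 (1 - sum psi_c^2): it equals
    mid + delta^2 without bumps and mid once all the bumps are there, and it does
    not depend on the signs.  Adding the bump of one grid with signs s changes
    the mean by s delta psi and the excess by 2 s mean delta psi, both
    linear in s as [perturbation_step] requires, because the square of the new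
    bump cancels. *)
Definition bump_excess (rs : seq (color * sign)) (x : X) : R :=
  bump_mean rs x ^+ 2 + delta ^+ 2 * (1 - \sum_(p <- rs) cell_bump M p.1 x ^+ 2).

Lemma bump_mean_bound rs x : (size rs <= K)%N -> `|bump_mean rs x| <= delta * K%:R.
Proof.
move=> rsK; rewrite /bump_mean normrM (ger0_norm (ltW delta0)) ler_pM2l//.
by apply: (le_trans (bump_sum_bound _ _)); rewrite ler_nat.
Qed.

Lemma bump_excess_bound rs x : (size rs <= K)%N ->
  `|bump_excess rs x| <= delta ^+ 2 * (K%:R ^+ 2 + K%:R).
Proof.
move=> rsK; rewrite /bump_excess; apply: (le_trans (ler_normD _ _)).
have d2 : 0 <= delta ^+ 2 by exact: sqr_ge0.
rewrite [leRHS]mulrDr; apply: lerD.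
  rewrite normrX -exprMn lerXn2r ?nnegrE//; first by rewrite mulr_ge0// ltW.
  exact: bump_mean_bound.
rewrite normrM (ger0_norm d2) ler_wpM2l//.
have S0 : 0 <= \sum_(p <- rs) cell_bump M p.1 x ^+ 2 by apply: sumr_ge0 => p _; exact: sqr_ge0.
have SK : \sum_(p <- rs) cell_bump M p.1 x ^+ 2 <= K%:R.
  apply: (@le_trans _ _ (size rs)%:R); last by rewrite ler_nat.
  rewrite -sum1_size natr_sum; apply: ler_sum => p _.
  by have /andP[h0 h1] := bump_itv M p.1 x; rewrite expr_le1.
have k1 : 1 <= K%:R :> R := K1.
exact: norm_onem_le.
Qed.

Lemma measurable_bump_mean rs : measurable_fun setT (bump_mean rs).
Proof. by apply: measurable_funM => //; exact: measurable_bump_sum. Qed.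

Lemma measurable_bump_excess rs : measurable_fun setT (bump_excess rs).
Proof.
apply: measurable_funD; first by apply: measurable_funX; exact: measurable_bump_mean.
apply: measurable_funM => //; apply: measurable_funB => //.
by apply: measurable_sum => p; apply: measurable_funX; exact: measurable_bump.
Qed.

Lemma bump_small rs x : (size rs <= K)%N ->
  `|bump_mean rs x| * (2 / a) + `|bump_excess rs x| * (2 / gp) <= 2^-1.
Proof.
move=> rsK; apply: le_trans delta_small; rewrite mulrDr.
have h1 := bump_mean_bound x rsK; have h2 := bump_excess_bound x rsK.
apply: lerD; rewrite !mulrA; apply: ler_wpM2r; try by rewrite invr_ge0 ltW.
  by rewrite ler_wpM2r.
rewrite ler_wpM2r//; apply: (le_trans h2).
rewrite ler_wpM2r//.
by rewrite expr2 ler_piMl// ltW.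
Qed.

Definition bump_model rs (rsK : (size rs <= K)%N) : model d a b :=
  @Model R d a b (bump_mean rs) (bump_excess rs) (measurable_bump_mean rs)
    (measurable_bump_excess rs) (fun x => bump_small x rsK).

(** delta times this bounds the change of the conditional density caused by one
    bump of height delta. *)
Definition tilt_slope : R := 2 / a + 2 * K%:R * (2 / gp).

Lemma bump_step (c : color) rs (rsK : (size rs <= K)%N) n
    (phi : n.-tuple (X * R)%type -> R) (eta : R) :
  0 < eta -> eta <= 1 ->
  8 * 2 ^+ d * tilt_slope ^+ 4 * (n%:R ^+ 2 * delta ^+ 4 / M%:R ^+ d) <= eta ^+ 2 / 2 ->
  measurable_fun setT phi -> (forall t, 0 <= phi t <= 1) ->
  forall rsK' : (size rs < K)%N,
  exists r : sign, (\int[iid (model_law a0 ab (@bump_model ((c, r) :: rs) rsK')) n]_t (phi t)%:E <=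
     \int[iid (model_law a0 ab (bump_model rsK)) n]_t (phi t)%:E + eta%:E)%E.
Proof.
move=> eta0 eta1 small mphi phi01 rsK'.
have M0' : 0 < M%:R :> R by rewrite ltr0n.
have [bump0 bump1] : (forall x : X, 0 <= cell_bump M c x) /\ (forall x : X, cell_bump M c x <= 1).
  by split => x; have /andP[] := bump_itv M c x.
apply: (@perturbation_step R d a b a0 ab _ (cell_index M c) (bump_model rsK)
  (fun x => delta * cell_bump M c x) (fun x => 2 * bump_mean rs x * (delta * cell_bump M c x))
  (fun r => @bump_model ((c, r) :: rs) rsK') (delta * tilt_slope) ((M%:R^-1) ^+ d)) => //.
- by move=> j; exact: measurable_cell.
- by move=> j; exact: lebesgue_cell.
- by apply: measurable_funM => //; exact: measurable_bump.
- apply: measurable_funM; first by apply: measurable_funM => //; exact: measurable_bump_mean.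
  by apply: measurable_funM => //; exact: measurable_bump.
- by rewrite mulr_ge0 ?(ltW delta0)// addr_ge0 ?mulr_ge0 ?invr_ge0// ltW.
- move=> x; have db : `|delta * cell_bump M c x| <= delta.
    by rewrite normrM !ger0_norm ?(ltW delta0)// ger_pMr.
  rewrite /tilt_slope mulrDr; apply: lerD.
    by rewrite ler_wpM2r// divr_ge0// ltW.
  rewrite [leRHS]mulrA; apply: ler_wpM2r; first by rewrite divr_ge0// ltW.
  rewrite normrM mulrC; apply: ler_pM => //.
  rewrite normrM ger0_norm// ler_pM2l//; apply: (le_trans (bump_mean_bound x rsK)).
  by rewrite ger_pMl// (lt_le_trans _ K1).
- by move=> r x; rewrite /= /bump_mean /bump_sum big_cons /signed_bump/=; ring.
- move=> r x; rewrite /= /bump_excess /bump_mean /bump_sum !big_cons /signed_bump/=.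
  have := sgb_sqr R (r (cell_index M c x)).
  move: (sgb R _) (cell_bump M c x) (\sum_(j <- rs) _) (\sum_(j <- rs) _) => s B S1 S2 s2.
  rewrite (_ : (delta * (s * B + S2)) ^+ 2 = delta ^+ 2 * ((s * s) * B ^+ 2 + 2 * s * B * S2 + S2 ^+ 2));
    last by ring.
  by rewrite s2; ring.
- apply: le_trans small.
  have -> : 2 * n%:R ^+ 2 * (#|{ffun 'I_d -> 'I_M.+1}|%:R *
      (2 * (delta * tilt_slope) ^+ 2 * M%:R^-1 ^+ d) ^+ 2) =
    (8 * tilt_slope ^+ 4 * (n%:R ^+ 2 * delta ^+ 4)) *
     (#|{ffun 'I_d -> 'I_M.+1}|%:R * (M%:R^-1 ^+ d) ^+ 2) by ring.
  have -> : 8 * 2 ^+ d * tilt_slope ^+ 4 * (n%:R ^+ 2 * delta ^+ 4 / M%:R ^+ d) =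
    (8 * tilt_slope ^+ 4 * (n%:R ^+ 2 * delta ^+ 4)) * (2 ^+ d / M%:R ^+ d) by ring.
  apply: ler_wpM2l.
    by rewrite mulr_ge0// mulr_ge0// ?sqr_ge0 ?exprn_even_ge0.
  rewrite card_ffun !card_ord natrX expr2 mulrA exprVn ler_pM2r ?invr_gt0 ?exprn_gt0//.
  rewrite ler_pdivrMr ?exprn_gt0// -exprMn lerXn2r ?nnegrE ?mulr_ge0//.
  rewrite -natrM ler_nat mul2n -addnn -add1n leq_add2r//.
Qed.

(** The signs of the grids already treated are fixed when those of the next one
    are selected, and each selection depends on the test. *)
Lemma bump_chain n (phi : n.-tuple (X * R)%type -> R) (eta : R) (cs : seq color) :
  0 < eta -> eta <= 1 ->
  8 * 2 ^+ d * tilt_slope ^+ 4 * (n%:R ^+ 2 * delta ^+ 4 / M%:R ^+ d) <= eta ^+ 2 / 2 ->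
  measurable_fun setT phi -> (forall t, 0 <= phi t <= 1) -> (size cs <= K)%N ->
  exists rs (rsK : (size rs <= K)%N), map fst rs = cs /\
    (\int[iid (model_law a0 ab (bump_model rsK)) n]_t (phi t)%:E <=
     \int[iid (model_law a0 ab (@bump_model [::] isT)) n]_t (phi t)%:E + ((size cs)%:R * eta)%:E)%E.
Proof.
move=> eta0 eta1 small mphi phi01; elim: cs => [|c cs IH] csK.
  by exists [::], isT; split => //; rewrite mul0r adde0.
have [rs [rsK [rscs le_rs]]] := IH (ltnW csK).
have rsK' : (size rs < K)%N by rewrite -(size_map fst) rscs.
have [r hr] := bump_step c rsK eta0 eta1 small mphi phi01 rsK'.
exists ((c, r) :: rs), rsK'; split; first by rewrite /= rscs.
apply: (le_trans hr); apply: (le_trans (leeD2r _ le_rs)).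
rewrite -addeA -EFinD; apply: leeD2l; rewrite lee_fin.
rewrite (_ : size (c :: cs) = (size cs).+1)// -natr1 mulrDl mul1r//.
Qed.

End bump_model.

Lemma mid_range (e vm vp : R) : 0 <= e -> e <= gp / 2 -> vm <= a ^+ 2 -> b ^+ 2 <= vp ->
  vm <= md + e <= vp.
Proof.
by move=> e0 eg va vb; move: gap0 eg; rewrite /mid /gap => g0 eg; apply/andP; split; lra.
Qed.

(** All constraints on the height are linear in its scale c0 once c0 <= 1: the
    fourth moment, the variance range, the Hoelder norm, the positivity of the
    density, and the smallness of the chi-square increments. *)
Lemma nonparametric_lower_bound (s : R) (U : set X) (pm pp Ls vm vp C4 zeta : R) :
  0 < s -> s <= 1 -> pm < 1 -> 1 < pp -> 0 < Ls ->
  vm <= a ^+ 2 -> b ^+ 2 <= vp -> 0 < zeta -> (b + zeta) ^+ 4 <= C4 ->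
  exists2 c : R, 0 < c & forall (n : nat) (Vh : n.-tuple (X * R)%type -> R) (rho : R),
  (0 < n)%N -> measurable_fun setT Vh ->
  (forall theta P, Theta s U pm pp Ls vm vp C4 theta -> is_law theta P ->
     (rms_risk P Vh (variance_level theta) <= rho%:E)%E) ->
  c * n%:R `^ (- (4 * s / (d%:R + 4 * s))) <= rho.
Proof.
move=> s0 s1 pm1 pp1 Ls0 va vb zeta0 bC.
have K1 : 1 <= K%:R :> R by rewrite ler1n card_ffun card_bool expn_gt0.
have K0 : 0 < K%:R :> R by exact: lt_le_trans K1.
have pi0 : 0 <= 2 * pi * d%:R + 2 :> R by rewrite addr_ge0// !mulr_ge0// pi_ge0.
have ia0 : 0 <= 2 / a by rewrite divr_ge0// ltW.
have ig0 : 0 <= 2 / gp by rewrite divr_ge0// ltW.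
have T0 : 0 <= tilt_slope.
  by rewrite /tilt_slope addr_ge0// mulr_ge0// mulr_ge0// ltW.
pose H := 2 * pi * d%:R + 2 :> R.
pose D := K%:R * (2 / a) + (K%:R ^+ 2 + K%:R) * (2 / gp).
pose E := 8 * 2 ^+ d * tilt_slope ^+ 4.
have E0 : 0 <= E by rewrite /E !mulr_ge0// exprn_ge0.
pose A : 'I_5 -> R := tnth [tuple K%:R; 1; K%:R + K%:R * H; D; E].
pose B : 'I_5 -> R := tnth [tuple zeta; gp / 2; Ls; 2^-1; (2 * K%:R)^-1 ^+ 2 / 2].
have [||c0 [c00 c01 cAB]] := @small_scale R 5 A B.
- move=> i; have : all (fun x => 0 <= x) [tuple K%:R; 1; K%:R + K%:R * H; D; E].
    have KK : 0 <= K%:R :> R by exact: ltW.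
    have h1 : 0 <= K%:R + K%:R * H by rewrite addr_ge0// mulr_ge0.
    have h2 : 0 <= D by rewrite /D addr_ge0// mulr_ge0// addr_ge0// sqr_ge0.
    by rewrite /= KK ler01 h1 h2 E0.
  by move=> /all_tnthP; apply.
- move=> i; have : all (fun x => 0 < x) [tuple zeta; gp / 2; Ls; 2^-1; (2 * K%:R)^-1 ^+ 2 / 2].
    have h1 : 0 < gp / 2 by rewrite divr_gt0.
    have h2 : 0 < (2 * K%:R)^-1 ^+ 2 / 2 :> R.
      by rewrite divr_gt0// exprn_gt0// invr_gt0 mulr_gt0.
    have h3 : 0 < 2^-1 :> R by rewrite invr_gt0.
    by rewrite /= zeta0 Ls0 h1 h2 h3.
  by move=> /all_tnthP; apply.
have c0K : c0 * K%:R <= zeta := cAB (@Ordinal 5 0 isT).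
have c0g : c0 * 1 <= gp / 2 := cAB (@Ordinal 5 1 isT).
have c0L : c0 * (K%:R + K%:R * H) <= Ls := cAB (@Ordinal 5 2 isT).
have c0D : c0 * D <= 2^-1 := cAB (@Ordinal 5 3 isT).
have c0E : c0 * E <= (2 * K%:R)^-1 ^+ 2 / 2 := cAB (@Ordinal 5 4 isT).
(* delta = c0 M^-s, the risk is at least delta^2 / 4, and the rate is at most
     4 M^(-2s) *)
exists (c0 ^+ 2 / 16); first by rewrite divr_gt0// exprn_gt0.
move=> n Vh rho n0 mV risk.
have [M [M0 Mn Mle]] := @choose_resolution R s d n s0 n0.
have M0' : 0 < M%:R :> R by rewrite ltr0n.
pose q := M%:R `^ (- s) : R.
have q0 : 0 < q by rewrite powR_gt0.
have q1 : q <= 1.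
  by rewrite /q -[leRHS](@powRr0 _ M%:R) ler_powR ?ler1n// oppr_le0 ltW.
have qs : q * M%:R `^ s = 1.
  by rewrite /q powRN mulVf// gt_eqF// powR_gt0.
have q4 : q ^+ 4 * M%:R `^ (4 * s) = 1.
  rewrite /q -powR_mulrn ?powR_ge0// -powRrM mulNr (mulrC s) powRN mulVf//.
  by rewrite gt_eqF// powR_gt0.
pose delta := c0 * q.
have delta0 : 0 < delta by rewrite mulr_gt0.
have delta_c : delta <= c0 by rewrite ger_pMr.
have delta1 : delta <= 1 by exact: le_trans c01.
have D0 : 0 <= D.
  have KK : 0 <= K%:R :> R by exact: ltW.
  by rewrite /D addr_ge0// mulr_ge0// addr_ge0// sqr_ge0.
have dsmall : delta * D <= 2^-1 by apply: le_trans c0D; rewrite ler_wpM2r.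
(* the 2^d steps together cost 1/2 *)
pose eta := (2 * K%:R)^-1 : R.
have eta0 : 0 < eta by rewrite invr_gt0 mulr_gt0.
have eta1 : eta <= 1.
  by rewrite /eta invf_le1 ?mulr_gt0//; apply: (le_trans K1); rewrite mulr_natl mulr2n lerDl ltW.
have step_small : 8 * 2 ^+ d * tilt_slope ^+ 4 * (n%:R ^+ 2 * delta ^+ 4 / M%:R ^+ d) <= eta ^+ 2 / 2.
  apply: le_trans c0E; rewrite -/E mulrC ler_wpM2r//.
  rewrite ler_pdivrMr ?exprn_gt0// /delta exprMn.
  apply: (@le_trans _ _ (M%:R ^+ d * M%:R `^ (4 * s) * (c0 ^+ 4 * q ^+ 4))).
    by rewrite ler_wpM2r// mulr_ge0// exprn_ge0// ltW.
  rewrite (_ : _ * _ * _ = c0 ^+ 4 * M%:R ^+ d * (q ^+ 4 * M%:R `^ (4 * s))); last by ring.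
  rewrite q4 mulr1 ler_pM2r ?exprn_gt0//.
  by rewrite exprS ger_pMr// exprn_ile1// ltW.
have dm2 : delta ^+ 2 <= gp / 2.
  apply: le_trans c0g; rewrite mulr1; apply: le_trans delta_c.
  by rewrite expr2 ger_pMr.
pose V0 := md + delta ^+ 2.
pose phi (t : n.-tuple (X * R)%type) : R := (delta ^+ 2 / 2 <= `|Vh t - V0|)%R%:R.
have mphi : measurable_fun setT phi.
  apply: (measurableT_comp (f := fun b : bool => b%:R : R)) => //.
  apply: measurable_fun_ler => //; apply: measurableT_comp => //.
  exact: measurable_funB.
have phi01 t : 0 <= phi t <= 1.
  by rewrite /phi; case: (delta ^+ 2 / 2 <= _); rewrite /= ?lexx ?ler01.
have csK : (size (enum {ffun 'I_d -> bool}) <= K)%N by rewrite -cardT.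
have [rs [rsK [rscs hrs]]] :=
  @bump_chain M delta M0 delta0 delta1 dsmall n phi eta (enum {ffun 'I_d -> bool})
    eta0 eta1 step_small mphi phi01 csK.
have member (rs' : seq ({ffun 'I_d -> bool} * {ffun {ffun 'I_d -> 'I_M.+1} -> bool})) (rsK' : (size rs' <= K)%N) V : vm <= V <= vp ->
    (forall x, md + bump_excess delta rs' x - bump_mean delta rs' x ^+ 2 = V) ->
    Theta s U pm pp Ls vm vp C4 (model_param a0 ab (bump_model delta0 delta1 dsmall rsK') V).
  move=> Vv HV.
  have [||||h1 h2] := @hoelder_norm_le R d s s0 s1 U (bump_mean delta rs') (delta * K%:R) (c0 * K%:R * H).
  - by rewrite mulr_ge0// ltW.
  - by rewrite mulr_ge0// mulr_ge0// ltW.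
  - by move=> x; exact: bump_mean_bound.
  - move=> x y; rewrite /bump_mean -mulrBr normrM (ger0_norm (ltW delta0)).
    have hh := @bump_sum_hoelder R d M rs' x y s s0 s1 M0.
    apply: (@le_trans _ _ (delta * ((size rs')%:R * H * M%:R `^ s * eucl_norm (x - y) `^ s))).
      by rewrite ler_wpM2l// ltW.
    rewrite (_ : delta * _ = c0 * (size rs')%:R * H * eucl_norm (x - y) `^ s * (q * M%:R `^ s));
      last by rewrite /delta; ring.
    rewrite qs mulr1 ler_wpM2r ?powR_ge0// ler_wpM2r// ler_wpM2l ?ler_nat//.
    exact: ltW.
  apply: (@model_Theta R d a b a0 ab _ s U pm pp Ls vm vp C4 V zeta) => //.
  - move=> x; apply: (le_trans (bump_mean_bound delta0 x rsK')).
    by apply: le_trans c0K; rewrite ler_wpM2r// ltW.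
  - apply: (le_trans h2); rewrite lee_fin; apply: le_trans c0L.
    by rewrite [leRHS]mulrDr mulrA; apply: lerD => //; rewrite ler_wpM2r// ltW.
have := @two_point_bound R d n (model_law a0 ab (@bump_model M delta delta0 delta1 dsmall [::] isT))
  (model_law a0 ab (bump_model delta0 delta1 dsmall rsK)) Vh
  V0 md rho (delta ^+ 2) mV.
have half : (size (enum {ffun 'I_d -> bool}))%:R * eta = 2^-1.
  rewrite -cardT /eta invfM mulrCA mulfV ?mulr1// gt_eqF//.
move=> tp; have : delta ^+ 2 / 4 <= rho.
  apply: tp.
  - by rewrite exprn_gt0.
  - by rewrite /V0 addrAC subrr add0r ger0_norm// sqr_ge0.
  - by move=> phi' _ ->; move: hrs; rewrite half.
  - apply: (risk (model_param a0 ab (@bump_model M delta delta0 delta1 dsmall [::] isT) V0)); last exact: model_is_law.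
    apply: member.
      by apply: mid_range => //; exact: sqr_ge0.
    by move=> x; rewrite /bump_excess !big_nil /V0; ring.
  - apply: (risk (model_param a0 ab (bump_model delta0 delta1 dsmall rsK) md)); last exact: model_is_law.
    apply: member.
      by rewrite -[md]addr0; apply: mid_range => //; rewrite divr_ge0// ltW.
    move=> x; rewrite /bump_excess.
    have -> : \sum_(p <- rs) cell_bump M p.1 x ^+ 2 = 1.
      rewrite -(big_map fst xpredT (fun c => cell_bump M c x ^+ 2)) rscs big_enum/=.
      exact: bump_sqr_sum.
    by ring.
apply: le_trans; rewrite /delta.
have rate : n%:R `^ (- (4 * s / (d%:R + 4 * s))) <= 4 * q ^+ 2.
  have n0' : 0 < n%:R :> R by rewrite ltr0n.
  have ds : 0 < d%:R + 4 * s by rewrite ltr_wpDl// mulr_gt0.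
  set t := n%:R `^ (2 / (d%:R + 4 * s)).
  have t0 : 0 < t by rewrite powR_gt0.
  have -> : n%:R `^ (- (4 * s / (d%:R + 4 * s))) = t `^ (- (2 * s)).
    by rewrite /t -powRrM; congr (_ `^ _); field; rewrite gt_eqF.
  have -> : q ^+ 2 = M%:R `^ (- (2 * s)).
    by rewrite /q -powR_mulrn ?powR_ge0// -powRrM; congr (_ `^ _); ring.
  rewrite !powRN.
  have Ms0 : 0 < M%:R `^ (2 * s) :> R by rewrite powR_gt0.
  have ts0 : 0 < t `^ (2 * s) by rewrite powR_gt0.
  rewrite -[_^-1]mul1r ler_pdivrMr// mulrAC ler_pdivlMr// mul1r.
  apply: (@le_trans _ _ ((2 * t) `^ (2 * s))).
    by apply: ge0_ler_powR => //; rewrite ?nnegrE ?mulr_ge0// ltW.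
  rewrite powRM ?(ltW t0)// ler_wpM2r ?(ltW ts0)//.
  have -> : 4 = 2 `^ 2 :> R by rewrite powR_mulrn// -natrX.
  by apply: ler_powR; rewrite ?ler1n// ler_piMr.
rewrite exprMn.
have c2 : 0 <= c0 ^+ 2 / 16 by rewrite divr_ge0// sqr_ge0.
apply: (le_trans (ler_wpM2l c2 rate)).
rewrite (_ : c0 ^+ 2 / 16 * (4 * q ^+ 2) = c0 ^+ 2 * q ^+ 2 / 4)//.
by field.
Qed.

End lower_bounds.

(** * Second moments of two-sample sums *)

Section square_integrable.
Local Open Scope ereal_scope.
Context d (T : measurableType d) (R : realType) (P : probability T R).

Definition sqint (a : T -> R) :=
  measurable_fun setT a /\ \int[P]_x ((a x) ^+ 2)%:E < +oo.

Definition expect (a : T -> R) : R := fine (\int[P]_x (a x)%:E).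

Lemma sqint_sqr_integrable a : sqint a -> P.-integrable setT (fun x => ((a x) ^+ 2)%:E).
Proof.
move=> [ma a2]; apply/integrableP; split.
  by apply/measurable_EFinP; exact: measurable_funX.
by under eq_integral do rewrite gee0_abs ?lee_fin ?sqr_ge0//.
Qed.

Lemma cst_integrable (c : R) : P.-integrable setT (fun=> c%:E).
Proof. exact: finite_measure_integrable_cst. Qed.

Lemma sqint_integrable a : sqint a -> P.-integrable setT (fun x => (a x)%:E).
Proof.
move=> sa; have [ma _] := sa.
apply: (@le_integrable _ _ _ P setT measurableT _ (fun x => (1 + a x ^+ 2)%:E)).
- exact/measurable_EFinP.
- move=> x _; rewrite lee_fin [leRHS]ger0_norm; last by rewrite addr_ge0// sqr_ge0.
  by have := sqr_ge0 (a x - 1); have := sqr_ge0 (a x + 1); rewrite ler_norml => h1 h2; apply/andP; split; nra.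
- by have := integrableD measurableT (cst_integrable 1) (sqint_sqr_integrable sa).
Qed.

Lemma sqint_cst (c : R) : sqint (fun=> c).
Proof. by split => //; rewrite integral_probability_cst ltry. Qed.

Lemma sqintD a b : sqint a -> sqint b -> sqint (fun x => a x + b x)%R.
Proof.
move=> sa sb; have [ma _] := sa; have [mb _] := sb; split; first exact: measurable_funD.
apply: (@le_lt_trans _ _ (\int[P]_x ((2 * a x ^+ 2)%:E + (2 * b x ^+ 2)%:E))).
  apply: ge0_le_integral => //.
  - by move=> x _; rewrite lee_fin sqr_ge0.
  - by apply/measurable_EFinP; apply: measurable_funX; exact: measurable_funD.
  - by apply: emeasurable_funD; apply/measurable_EFinP; apply: measurable_funM => //; exact: measurable_funX.
  - by move=> x _; rewrite -EFinD lee_fin; have := sqr_ge0 (a x - b x); nra.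
have ia c s : sqint c -> P.-integrable setT (fun x => (s * c x ^+ 2)%:E).
  by move=> sc; apply: (integrableZl measurableT s (sqint_sqr_integrable sc)).
have := integrableD measurableT (ia _ 2%R sa) (ia _ 2%R sb) => /integrableP[_].
apply: le_lt_trans; apply: ge0_le_integral => //.
- by move=> x _; rewrite -EFinD lee_fin addr_ge0// mulr_ge0// sqr_ge0.
- by apply: emeasurable_funD; apply/measurable_EFinP; apply: measurable_funM => //; exact: measurable_funX.
- apply: measurableT_comp => //.
  by apply: emeasurable_funD; apply/measurable_EFinP; apply: measurable_funM => //; exact: measurable_funX.
- by move=> x _; exact: lee_abs.
Qed.

Lemma expectE a : sqint a -> \int[P]_x (a x)%:E = (expect a)%:E.
Proof.
by move=> sa; rewrite /expect fineK//; apply: (integrable_fin_num measurableT (sqint_integrable sa)).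
Qed.

Lemma expectD a b : sqint a -> sqint b -> expect (fun x => a x + b x)%R = (expect a + expect b)%R.
Proof.
move=> sa sb; apply: EFin_inj; rewrite -expectE; last exact: sqintD.
under eq_integral do rewrite EFinD.
by rewrite integralD// ?expectE//; exact: sqint_integrable.
Qed.

Lemma expect_cst (c : R) : expect (fun=> c) = c.
Proof. by rewrite /expect integral_probability_cst. Qed.

Lemma sqint_sum n (a : 'I_n -> T -> R) : (forall i, sqint (a i)) ->
  sqint (fun x => \sum_i a i x)%R /\ expect (fun x => \sum_i a i x)%R = (\sum_i expect (a i))%R.
Proof.
elim: n a => [|n IH] a sa.
  rewrite big_ord0 (_ : (fun x => _) = fun=> 0%R); last by apply/funext => x; rewrite big_ord0.
  by split; [exact: sqint_cst|exact: expect_cst].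
rewrite big_ord_recl (_ : (fun x => _) = (fun x => a ord0 x + \sum_i a (lift ord0 i) x)%R); last first.
  by apply/funext => x; rewrite big_ord_recl.
have [s1 s2] := IH _ (fun i => sa (lift ord0 i)).
by split; [exact: sqintD|rewrite expectD// s2].
Qed.

Definition var (a : T -> R) : R := (fine (\int[P]_x ((a x) ^+ 2)%:E) - expect a ^+ 2)%R.

(** Knowing E (c + a)^2 for every c lets independent summands be peeled off one
    at a time with nonnegative integrands only. *)
Lemma second_moment_shift a c : sqint a ->
  \int[P]_x ((c + a x) ^+ 2)%:E = (var a + (c + expect a) ^+ 2)%:E.
Proof.
move=> sa; have ia := sqint_integrable sa; have ia2 := sqint_sqr_integrable sa.
have -> : \int[P]_x ((c + a x) ^+ 2)%:E =
    \int[P]_x ((c ^+ 2)%:E + ((2 * c)%:E * (a x)%:E + (a x ^+ 2)%:E)).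
  by apply: eq_integral => x _; rewrite -EFinM -!EFinD; congr (_%:E); ring.
have ica : P.-integrable setT (fun x => (2 * c)%:E * (a x)%:E) by exact: integrableZl.
rewrite integralD//; last 2 first.
- exact: cst_integrable.
- exact: integrableD.
rewrite integralD// integral_probability_cst integralZl// expectE//.
have f2 : \int[P]_x ((a x) ^+ 2)%:E \is a fin_num by exact: integrable_fin_num.
rewrite -(fineK f2) -EFinM -!EFinD; congr (_%:E); rewrite /var; ring.
Qed.

Lemma var_ge0 a : sqint a -> (0 <= var a)%R.
Proof.
move=> sa; have := second_moment_shift (- expect a) sa.
rewrite addNr expr0n addr0 => h; rewrite -lee_fin -h.
by apply: integral_ge0 => x _; rewrite lee_fin sqr_ge0.
Qed.

(** By induction with c free: the summand that is integrated last joins the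
    constant. *)
Lemma iid_sum_sqr a n c : sqint a ->
  \int[powm P n]_t ((c + \sum_(i < n) a (tnth t i)) ^+ 2)%:E =
  (n%:R * var a + (c + n%:R * expect a) ^+ 2)%:E.
Proof.
move=> sa; have [ma _] := sa.
have mS k c' : measurable_fun [set: k.-tuple T] (fun t => ((c' + \sum_(i < k) a (tnth t i)) ^+ 2)%:E).
  apply/measurable_EFinP; apply: measurable_funX; apply: measurable_funD => //.
  by apply: measurable_sum => i; apply: measurableT_comp => //; exact: measurable_tnth.
elim: n c => [|n IH] c.
  by rewrite ge0_integral_powm0// big_ord0 !mul0r !addr0 add0r.
rewrite ge0_integral_powmS//; last by move=> t; rewrite lee_fin sqr_ge0.
transitivity (\int[P]_x (n%:R * var a + ((c + n%:R * expect a) + a x) ^+ 2)%:E).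
  apply: eq_integral => x _.
  transitivity (\int[powm P n]_t (((c + a x) + \sum_(i < n) a (tnth t i)) ^+ 2)%:E).
    apply: eq_integral => t _; rewrite big_ord_recl addrA.
    by under eq_bigr do rewrite tnthS.
  by rewrite IH; congr (_%:E); ring.
under eq_integral do rewrite EFinD.
rewrite ge0_integralD//; last 3 first.
- by move=> x _; rewrite lee_fin mulr_ge0// var_ge0.
- by move=> x _; rewrite lee_fin sqr_ge0.
- by apply/measurable_EFinP; apply: measurable_funX; exact: measurable_funD.
rewrite integral_probability_cst second_moment_shift// -EFinD -natr1; congr (_%:E); ring.
Qed.

Lemma iid_sum_sqr_le a n : sqint a ->
  \int[powm P n]_t ((\sum_(i < n) a (tnth t i)) ^+ 2)%:E <=
  n%:R%:E * \int[P]_x ((a x) ^+ 2)%:E + (n%:R ^+ 2 * expect a ^+ 2)%:E.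
Proof.
move=> sa; have [ma _] := sa.
have := iid_sum_sqr n 0 sa; under eq_integral do rewrite add0r.
move=> ->; have f2 : \int[P]_x ((a x) ^+ 2)%:E \is a fin_num.
  by apply: integrable_fin_num => //; exact: sqint_sqr_integrable.
rewrite add0r -(fineK f2) -EFinM -EFinD lee_fin exprMn lerD2r ler_wpM2l//.
by rewrite /var gerBl// sqr_ge0.
Qed.

End square_integrable.

Section two_samples.
Local Open Scope ereal_scope.
Context d (T : measurableType d) (R : realType) (P : probability T R).

Variable g : T -> T -> R.
Hypotheses (mg : measurable_fun setT (fun p : T * T => g p.1 p.2))
  (gC : forall x y, g x y = g y x).
Hypothesis sg : forall x, sqint P (g x).
Let g1 x := expect P (g x).

Let mg2 : measurable_fun setT (fun p : T * T => (g p.1 p.2 ^+ 2)%:E).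
Proof. by apply/measurable_EFinP; exact: measurable_funX. Qed.

Hypothesis sg1 : sqint P g1.

(** With the first sample fixed, the double sum is a sum of independent terms
    of the second sample, whose mean is a sum of independent terms of the first
    sample.  The second moment bound for sums is used for the inner sum, then,
    after exchanging the integrals, for both terms that it produces. *)
Lemma two_sample_second_moment n :
  \int[powm P n]_s \int[powm P n]_t
    ((\sum_(i < n) \sum_(j < n) g (tnth s i) (tnth t j)) ^+ 2)%:E <=
  (n%:R ^+ 2)%:E * \int[P]_x \int[P]_y (g x y ^+ 2)%:E +
  (2 * n%:R ^+ 3)%:E * \int[P]_x ((g1 x) ^+ 2)%:E +
  (n%:R ^+ 4 * expect P g1 ^+ 2)%:E.
Proof.
have mh : measurable_fun setT (fun p : n.-tuple T * T => (\sum_i g (tnth p.1 i) p.2)%R).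
  apply: measurable_sum => i.
  apply: (measurableT_comp mg (g := fun p : n.-tuple T * T => (tnth p.1 i, p.2))).
  apply/measurable_fun_pair => /=; last exact: measurable_snd.
  by apply: (measurableT_comp (measurable_tnth i)); exact: measurable_fst.
have mh2 : measurable_fun setT (fun p : n.-tuple T * T => ((\sum_i g (tnth p.1 i) p.2) ^+ 2)%:E).
  by apply/measurable_EFinP; exact: measurable_funX.
have mhh : measurable_fun setT (fun p : n.-tuple T * n.-tuple T =>
    ((\sum_(i < n) \sum_(j < n) g (tnth p.1 i) (tnth p.2 j)) ^+ 2)%:E).
  apply/measurable_EFinP; apply: measurable_funX; apply: measurable_sum => i; apply: measurable_sum => j.
  apply: (measurableT_comp mg (g := fun p : n.-tuple T * n.-tuple T => (tnth p.1 i, tnth p.2 j))).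
  apply/measurable_fun_pair => /=.
    by apply: (measurableT_comp (measurable_tnth i)); exact: measurable_fst.
  by apply: (measurableT_comp (measurable_tnth j)); exact: measurable_snd.
have mg1 : measurable_fun setT g1 by case: sg1.
have mg1s : measurable_fun setT (fun s : n.-tuple T => ((\sum_i g1 (tnth s i)) ^+ 2)%:E).
  apply/measurable_EFinP; apply: measurable_funX; apply: measurable_sum => i.
  by apply: measurableT_comp => //; exact: measurable_tnth.
have mF : measurable_fun setT (fun s : n.-tuple T => \int[P]_z ((\sum_i g (tnth s i) z) ^+ 2)%:E).
  apply: (@measurable_fun_fubini_tonelli_F _ _ _ _ _ P (fun p : n.-tuple T * T => ((\sum_i g (tnth p.1 i) p.2) ^+ 2)%:E)) => //.
  by move=> p; rewrite lee_fin sqr_ge0.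
have i0 (s : n.-tuple T) : 0 <= \int[P]_z ((\sum_i g (tnth s i) z) ^+ 2)%:E.
  by apply: integral_ge0 => z _; rewrite lee_fin sqr_ge0.
have n0 : (0 <= n%:R :> R)%R by [].
apply: (@le_trans _ _ (\int[powm P n]_s (n%:R%:E * \int[P]_z ((\sum_i g (tnth s i) z) ^+ 2)%:E
    + (n%:R ^+ 2)%:E * ((\sum_i g1 (tnth s i)) ^+ 2)%:E))).
  apply: ge0_le_integral => //.
  - by move=> s _; apply: integral_ge0 => t _; rewrite lee_fin sqr_ge0.
  - apply: (@measurable_fun_fubini_tonelli_F _ _ _ _ _ (powm P n) _ mhh).
    by move=> p; rewrite lee_fin sqr_ge0.
  - by apply: emeasurable_funD; apply: measurable_funeM.
  - move=> s _.
    have [ss ms] := @sqint_sum _ _ _ P n (fun i => g (tnth s i)) (fun i => sg _).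
    have := iid_sum_sqr_le n ss; rewrite ms EFinM; apply: le_trans.
    rewrite le_eqVlt; apply/orP; left; apply/eqP; apply: eq_integral => t _.
    by rewrite exchange_big.
rewrite ge0_integralD//; last 4 first.
- by move=> s _; rewrite mule_ge0.
- exact: measurable_funeM.
- by move=> s _; rewrite -EFinM lee_fin mulr_ge0// sqr_ge0.
- exact: measurable_funeM.
rewrite !ge0_integralZl//; last by move=> s _; rewrite lee_fin sqr_ge0.
have mgy : measurable_fun setT (fun y => \int[P]_x (g x y ^+ 2)%:E).
  apply: (@measurable_fun_fubini_tonelli_G _ _ _ _ _ P (fun p : T * T => (g p.1 p.2 ^+ 2)%:E)) => //.
  by move=> p; rewrite lee_fin sqr_ge0.
have gy0 y : 0 <= \int[P]_x (g x y ^+ 2)%:E by apply: integral_ge0 => z _; rewrite lee_fin sqr_ge0.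
have mg12 : measurable_fun setT (fun x => (g1 x ^+ 2)%:E).
  by apply/measurable_EFinP; exact: measurable_funX.
have first_part : \int[powm P n]_s \int[P]_z ((\sum_i g (tnth s i) z) ^+ 2)%:E <=
   n%:R%:E * \int[P]_x \int[P]_y (g x y ^+ 2)%:E + (n%:R ^+ 2)%:E * \int[P]_x ((g1 x) ^+ 2)%:E.
  rewrite (fubini_tonelli (m1 := powm P n) (m2 := P) (fun p : n.-tuple T * T => ((\sum_i g (tnth p.1 i) p.2) ^+ 2)%:E))//;
    last by move=> p; rewrite lee_fin sqr_ge0.
  apply: (@le_trans _ _ (\int[P]_z (n%:R%:E * \int[P]_x (g x z ^+ 2)%:E + (n%:R ^+ 2)%:E * (g1 z ^+ 2)%:E))).
    apply: ge0_le_integral => //.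
    - by move=> z _; apply: integral_ge0 => t _; rewrite lee_fin sqr_ge0.
    - apply: (@measurable_fun_fubini_tonelli_G _ _ _ _ _ (powm P n) _ mh2).
      by move=> p; rewrite lee_fin sqr_ge0.
    - by apply: emeasurable_funD; apply: measurable_funeM.
    - move=> z _; have := iid_sum_sqr_le n (sg z).
      rewrite EFinM; under [in leLHS]eq_integral do under eq_bigr do rewrite gC.
      by under [in leRHS]eq_integral do rewrite gC.
  rewrite ge0_integralD//; last 4 first.
  - by move=> s _; rewrite mule_ge0.
  - exact: measurable_funeM.
  - by move=> s _; rewrite -EFinM lee_fin mulr_ge0// sqr_ge0.
  - exact: measurable_funeM.
  rewrite !ge0_integralZl//; last by move=> s _; rewrite lee_fin sqr_ge0.
  rewrite -(fubini_tonelli (m1 := P) (m2 := P) (fun p : T * T => (g p.1 p.2 ^+ 2)%:E))//.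
  by move=> p; rewrite lee_fin sqr_ge0.
have second_part := iid_sum_sqr_le n sg1.
apply: (le_trans (leeD (lee_wpmul2l _ first_part) (lee_wpmul2l _ second_part))); rewrite ?lee_fin ?sqr_ge0//.
have a0 : 0 <= \int[P]_x \int[P]_y (g x y ^+ 2)%:E.
  by apply: integral_ge0 => x _; apply: integral_ge0 => y _; rewrite lee_fin sqr_ge0.
have b0 : 0 <= \int[P]_x ((g1 x) ^+ 2)%:E by apply: integral_ge0 => x _; rewrite lee_fin sqr_ge0.
move: (\int[P]_x \int[P]_y _) a0 (\int[P]_x ((g1 x) ^+ 2)%:E) b0 => A A0 B B0.
have c0 : 0 <= (n%:R ^+ 2 * expect P g1 ^+ 2)%:E by rewrite lee_fin mulr_ge0 ?sqr_ge0.
rewrite !ge0_muleDr// ?c0 ?mule_ge0 ?lee_fin ?sqr_ge0//.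
rewrite !muleA -!EFinM -addeA (addeA (_ * B)) -ge0_muleDl ?lee_fin ?mulr_ge0 ?sqr_ge0//.
rewrite -EFinD addeA le_eqVlt; apply/orP; left; apply/eqP.
congr (_%:E * _ + _%:E * _ + _%:E); ring.
Qed.

End two_samples.

(** * Conditional moments in the regression model *)

Section regression_law.
Local Open Scope ereal_scope.
Variables (R : realType) (d : nat) (theta : param R d) (P : probability ('rV[R]_d * R)%type R).
Local Notation X := 'rV[R]_d.
Local Notation lam := (lebesgue_rV R d).
Local Notation cube := (unit_cube R d).
Local Notation p := (density theta).
Local Notation Q := (noise theta).
Hypotheses (lawP : is_law theta P) (densp : is_density p).
Variable F : X -> R.
Hypotheses (mF : measurable_fun setT F) (regF : {in cube, regression theta =1 F}).

Let mc : measurable cube. Proof. exact: measurable_cube. Qed.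

Let pbar x : R := ((p \_ cube) x)%R.
Let pbar0 x : (0 <= pbar x)%R.
Proof. by rewrite /pbar patchE; case: ifPn => // /set_mem xc; case: densp => _ /(_ _ xc). Qed.

Let mpbar : measurable_fun setT pbar.
Proof. by case: densp => mp _ _; apply/(measurable_restrict p mc measurableT); rewrite setTI. Qed.

Let mpair x : measurable_fun [set: R] (pair x : R -> X * R).
Proof. exact: pair1_measurable. Qed.

Let fiber (x : X) : {measure set (X * R) -> \bar R}.
Proof.
pose m0 : {measure set (X * R) -> \bar R} := pushforward (Q x) (pair x).
exact: (m0 (mpair x)).
Defined.

(** The measure p(x) (delta_x * Q_x), cut off outside the cube. *)
Let k x : {measure set (X * R) -> \bar R} :=
  mscale (NngNum (pbar0 x)) (fiber x).

Let kE x C : k x C = (pbar x)%:E * Q x (xsection C x).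
Proof.
rewrite /k /mscale/=; congr (_ * Q x _).
by apply/seteqP; split => u; rewrite /xsection/= inE.
Qed.

Let mk C : measurable C -> measurable_fun setT (fun x => k x C).
Proof.
move=> mC; rewrite (_ : (fun x => _) = fun x => (pbar x)%:E * Q x (xsection C x)); last first.
  by apply/funext => x; rewrite kE.
apply: emeasurable_funM; first exact/measurable_EFinP.
by apply: measurable_fun_xsection_finite_kernel; rewrite inE.
Qed.

Let psi (z : X * R) := (z.1, (z.2 - F z.1)%R).
Let mpsi : measurable_fun setT psi.
Proof.
apply/measurable_fun_pair => /=; first exact: measurable_fst.
apply: measurable_funB; first exact: measurable_snd.
by apply: measurableT_comp => //; exact: measurable_fst.
Qed.

Let lawcube : P [set z | cube z.1] = 1.
Proof.
have := lawP mc (measurableT : measurable [set: R]) (fun x h => h).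
rewrite (_ : [set z | _] = [set z | cube z.1]); last by apply/seteqP; split => z //= [].
move=> ->; have [_ _ <-] := densp; apply: eq_integral => x _.
by rewrite (@prob_kernel _ _ _ _ _ Q x) mule1.
Qed.

(** [is_law] gives the law of (X, Y - F X) on the rectangles contained in the
    cube; the cube has probability 1, so this determines the law. *)
Lemma law_integral (G : X * R -> \bar R) : measurable_fun setT G -> (forall z, 0 <= G z) ->
  \int[P]_z G (z.1, (z.2 - F z.1)%R) =
  \int[lam]_(x in cube) ((p x)%:E * \int[Q x]_u G (x, u)).
Proof.
move=> mG G0.
pose nu0 : {measure set (X * R) -> \bar R} := pushforward P psi.
pose nu := nu0 mpsi.
have nuE C : measurable C -> nu C = mixture_meas lam mc mk C.
  move: C; apply: measure_eq_rectangles.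
    by rewrite /nu/= /pushforward preimage_setT probability_setT ltry.
  move=> A B mA mB; rewrite /nu/= /pushforward.
  have -> : P (psi @^-1` (A `*` B)) = P [set z | (A `&` cube) z.1 /\ B (z.2 - regression theta z.1)%R].
    have E0 : [set z : X * R | (A `&` cube) z.1 /\ B (z.2 - regression theta z.1)%R] =
       (psi @^-1` (A `*` B)) `&` [set z | cube z.1].
      apply/seteqP; split => z /=.
        by move=> [[Az cz] Bz]; split => //; split => //; rewrite /psi/= -regF// inE.
      by move=> [[Az Bz] cz]; split => //; rewrite regF// inE.
    have mA1 : measurable (psi @^-1` (A `*` B)).
      by rewrite -[X in measurable X]setTI; apply: mpsi => //; exact: measurableX.
    have mA2 : measurable [set z : X * R | cube z.1].
      by rewrite -[X in measurable X]setTI; exact: (measurable_fst measurableT).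
    rewrite E0 [LHS](@measureDI _ _ _ P _ [set z : X * R | cube z.1])//.
    rewrite (@subset_measure0 _ _ _ P _ (~` [set z : X * R | cube z.1])) ?add0e//.
    - exact: measurableD.
    - exact: measurableC.
    - by apply: (etrans (probability_setC P mA2)); rewrite lawcube subee.
  have mAc : measurable (A `&` cube) by exact: measurableI.
  rewrite (lawP mAc mB (@subIsetr _ A cube)).
  rewrite /mixture_meas/= /mixture_measure setIC integral_mkcondr; apply: eq_integral => x xc.
    rewrite kE /pbar patchE [in RHS]patchE xc; case: ifPn => xA.
      congr (_ * Q x _); apply/seteqP; split => u; rewrite /xsection/= inE /=.
        by split => //; rewrite inE in xA.
      by case.
    rewrite (_ : xsection _ _ = set0) ?measure0 ?mule0//.
    apply/seteqP; split => // u; rewrite /xsection/= inE /= => -[Ax _].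
    by move: xA; rewrite notin_setE.
transitivity (\int[nu]_z G z).
  by rewrite /nu ge0_integral_pushforward.
rewrite (@ge0_integral_mixture _ _ _ _ _ lam cube mc k nu mk nuE)//.
apply: eq_integral => x xc; rewrite /k ge0_integral_mscale//=.
rewrite /pbar patchE xc; congr (_ * _).
by rewrite ge0_integral_pushforward.
Qed.

End regression_law.
Section cube_projection.
Variables (R : realType) (d : nat).
Local Notation X := 'rV[R]_d.
Local Notation cube := (unit_cube R d).

(** The sigma-algebra is generated by the coordinates. *)
Lemma measurable_fun_rV dS (S : measurableType dS) (h : S -> X) :
  (forall i, measurable_fun setT (fun z => h z ord0 i)) -> measurable_fun setT h.
Proof.
move=> mh; pose G : set (set X) :=
  \big[setU/set0]_(i < d) preimage_set_system setT (fun x : X => x ord0 i) measurable.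
apply: (@measurability _ _ _ _ setT h G) => //.
move=> _ [A GA <-]; rewrite setTI; move: A GA; rewrite /G.
elim/big_ind : _ => //; first by move=> A B hA hB C [/hA|/hB].
move=> i _ C [B mB <-]; rewrite setTI.
by rewrite -[X in measurable X]setTI; exact: (mh i).
Qed.

Definition cube_proj (x : X) : X := \row_i clamp (x ord0 i).

Lemma cube_proj_cube x : cube (cube_proj x).
Proof. by move=> i; rewrite mxE clamp_itv. Qed.

Lemma cube_proj_id x : cube x -> cube_proj x = x.
Proof. by move=> xc; apply/rowP => i; rewrite mxE clamp_id//; exact: xc. Qed.

Lemma cell_index_proj M c x : cell_index M c (cube_proj x) = cell_index M c x.
Proof.
apply/ffunP => i; apply: val_inj; rewrite /= !cell_indexE /level mxE.
by rewrite (clamp_id (clamp_itv _)).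
Qed.

Lemma measurable_cube_proj : measurable_fun setT cube_proj.
Proof.
apply: measurable_fun_rV => i.
apply: (eq_measurable_fun (fun x : X => clamp (x ord0 i))).
  by move=> x _; rewrite mxE.
by apply: measurableT_comp; [exact: measurable_clamp|exact: measurable_coord].
Qed.

End cube_projection.

Section model_moments.
Local Open Scope ereal_scope.
Variables (R : realType) (d : nat) (s : R) (U : set 'rV[R]_d) (pm pp Ls vm vp C4 : R).
Variables (theta : param R d) (P : probability ('rV[R]_d * R)%type R).
Local Notation X := 'rV[R]_d.
Local Notation lam := (lebesgue_rV R d).
Local Notation cube := (unit_cube R d).
Local Notation p := (density theta).
Local Notation Q := (noise theta).
Local Notation V := (variance_level theta).
Hypotheses (s0 : (0 < s)%R) (s1 : (s <= 1)%R) (hU : cube `<=` U) (Ls0 : (0 < Ls)%R) (pp0 : (0 < pp)%R) (vm0 : (0 < vm)%R) (C40 : (0 <= C4)%R).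
Hypotheses (lawP : is_law theta P) (inTheta : Theta s U pm pp Ls vm vp C4 theta).

(** Constant along the retraction onto the cube, so that measurability and the
    oscillation bound hold on the whole space rather than almost surely. *)
Definition regression_ext (x : X) : R := regression theta (cube_proj x).
Local Notation F := regression_ext.

Let mc : measurable cube. Proof. exact: measurable_cube. Qed.
Let densp : is_density p. Proof. by have [[]] := inTheta. Qed.
Let mp : measurable_fun cube p. Proof. by case: densp. Qed.
Let p0 x : cube x -> (0 <= p x)%R. Proof. by case: densp => _ + _; exact. Qed.

Lemma regression_hoelder x y : cube x -> cube y ->
  (`|regression theta x - regression theta y| <= Ls * eucl_norm (x - y) `^ s)%R.
Proof.
have [_ [F' [FE _ hF]] _ _] := inTheta.
move=> xc yc; rewrite -!FE ?inE//.
by apply: (@hoelder_norm_dist R d s s0 s1 U F' Ls hF); exact: hU.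
Qed.

Lemma measurable_regression_ext : measurable_fun setT F.
Proof.
apply: (@measurable_comp _ _ _ _ _ _ cube (regression theta) setT (@cube_proj R d)) => //.
- by move=> _ [x _ <-]; exact: cube_proj_cube.
- exact: (@hoelder_measurable R d _ Ls s s0 regression_hoelder).
- exact: measurable_cube_proj.
Qed.

Lemma regression_ext_osc M x y : (0 < M)%N ->
  cell_index M (no_shift d) x = cell_index M (no_shift d) y ->
  (`|F x - F y| <= Ls * (d%:R / M%:R) `^ s)%R.
Proof.
move=> M0 xy; apply: (le_trans (regression_hoelder (cube_proj_cube x) (cube_proj_cube y))).
rewrite ler_wpM2l ?(ltW Ls0)// ge0_ler_powR ?nnegrE ?(ltW s0)//.
- by rewrite /eucl_norm sqrtr_ge0.
- by apply: (@same_cell_dist R d M (no_shift d)) => //; rewrite ?cell_index_proj//; exact: cube_proj_cube.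
Qed.

Let lawI (G : X * R -> \bar R) : measurable_fun setT G -> (forall z, 0 <= G z) ->
  \int[P]_z G (z.1, (z.2 - F z.1)%R) =
  \int[lam]_(x in cube) ((p x)%:E * \int[Q x]_u G (x, u)).
Proof.
move=> mG G0; apply: (law_integral lawP densp measurable_regression_ext) => //.
by move=> x; rewrite inE => xc; rewrite /F cube_proj_id.
Qed.

Let good x := [/\ (\int[Q x]_u u%:E = 0)%E,
              (\int[Q x]_u (u ^+ 2)%:E = V%:E)%E &
              (\int[Q x]_u (u ^+ 4)%:E <= C4%:E)%E].

(** The moment conditions hold almost surely for the design, hence almost
    everywhere on the set where the density does not vanish. *)
Let ae_good : {ae lam, forall x, cube x -> good x \/ p x = 0%R}.
Proof.
have [_ _ [N [mN N0 hN]] _] := inTheta.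
have mNc : measurable (N `&` cube) by exact: measurableI.
have : ae_eq lam (N `&` cube) (fun x => (p x)%:E) (cst 0).
  apply/ae_eq_integral_abs => //.
    by apply/measurable_EFinP; apply: measurable_funS mp => //; exact: subIsetr.
  rewrite -[RHS]N0 /design_law; apply: eq_integral => x; rewrite inE => -[_ xc].
  by rewrite gee0_abs// lee_fin p0.
apply: filterS => x h xc.
have [gx|ngx] := pselect (good x); [by left|right].
by apply: EFin_inj; apply: h; split => //; apply: hN => /=.
Qed.

Let noise_shift x c : good x -> \int[Q x]_u ((u + c) ^+ 2)%:E = (V + c ^+ 2)%:E.
Proof.
move=> [m1 m2 _].
have Q1 : Q x setT = 1 by exact: prob_kernel.
pose q : probability R R := as_probability Q1.
have sid : sqint q (fun u : R => u).
  by split; [exact: measurable_id|rewrite m2 ltry].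
have := second_moment_shift c sid.
have mE : expect q (fun u : R => u) = 0%R by exact: (congr1 fine m1).
have vE : var q (fun u : R => u) = V.
  by rewrite /var mE expr0n/= subr0; exact: (congr1 fine m2).
rewrite mE vE addr0 => <-.
by apply: eq_integral => u _; rewrite addrC.
Qed.

Let mfun (G : X * R -> \bar R) : measurable_fun setT G -> (forall z, 0 <= G z) ->
  measurable_fun cube (fun x => (p x)%:E * \int[Q x]_u G (x, u)).
Proof.
move=> mG G0; apply: emeasurable_funM; first exact/measurable_EFinP.
by apply: measurable_funTS; exact: measurable_fun_integral_finite_kernel.
Qed.

Let law_ae (G H : X * R -> \bar R) : measurable_fun setT G -> measurable_fun setT H ->
  (forall z, 0 <= G z) -> (forall z, 0 <= H z) ->
  (forall x, good x -> \int[Q x]_u G (x, u) <= \int[Q x]_u H (x, u)) ->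
  \int[P]_z G (z.1, (z.2 - F z.1)%R) <= \int[P]_z H (z.1, (z.2 - F z.1)%R).
Proof.
move=> mG mH G0 H0 GH; rewrite !lawI//; apply: ae_ge0_le_integral => //.
- by move=> x xc; rewrite mule_ge0 ?lee_fin ?p0//; exact: integral_ge0.
- exact: mfun.
- by move=> x xc; rewrite mule_ge0 ?lee_fin ?p0//; exact: integral_ge0.
- exact: mfun.
apply: filterS ae_good => x h xc; case: (h xc) => [gx|->]; last by rewrite !mul0e.
by apply: lee_wpmul2l; [rewrite lee_fin p0|exact: GH].
Qed.

Let measurable_ext (phi : X -> R) : measurable_fun setT phi ->
  measurable_fun setT (fun z : X * R => phi z.1).
Proof. by move=> mphi; apply: measurableT_comp => //; exact: measurable_fst. Qed.

(** The test function phi localizes in x, and the shift t absorbs the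
    difference between the regression function and any function of x. *)
Lemma conditional_second_moment (phi t : X -> R) : measurable_fun setT phi ->
  measurable_fun setT t -> (forall x, 0 <= phi x)%R ->
  \int[P]_z (phi z.1 * (z.2 - F z.1 + t z.1) ^+ 2)%:E =
  \int[P]_z (phi z.1 * (V + t z.1 ^+ 2))%:E.
Proof.
move=> mphi mt phi0.
have V0 : (0 <= V)%R.
  by have [_ _ _ /andP[vV _]] := inTheta; apply: le_trans vV; exact: ltW.
pose G (z : X * R) := (phi z.1 * (z.2 + t z.1) ^+ 2)%:E.
pose H (z : X * R) := (phi z.1 * (V + t z.1 ^+ 2))%:E.
have mG : measurable_fun setT G.
  apply/measurable_EFinP; apply: measurable_funM; first exact: measurable_ext.
  by apply: measurable_funX; apply: measurable_funD; [exact: measurable_snd|exact: measurable_ext].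
have mH : measurable_fun setT H.
  apply/measurable_EFinP; apply: measurable_funM; first exact: measurable_ext.
  by apply: measurable_funD => //; apply: measurable_funX; exact: measurable_ext.
have G0 z : 0 <= G z by rewrite lee_fin mulr_ge0// sqr_ge0.
have H0 z : 0 <= H z by rewrite lee_fin mulr_ge0// addr_ge0// sqr_ge0.
have GH x : good x -> \int[Q x]_u G (x, u) = \int[Q x]_u H (x, u).
  move=> gx; rewrite /G /H /=.
  under eq_integral do rewrite EFinM.
  rewrite ge0_integralZl//; last 3 first.
  - by apply/measurable_EFinP; apply: measurable_funX; exact: measurable_funD.
  - by move=> u _; rewrite lee_fin sqr_ge0.
  - by rewrite lee_fin.
  rewrite noise_shift// integral_cst//= (@prob_kernel _ _ _ _ _ Q x) mule1.
  by rewrite EFinM.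
apply/eqP; rewrite eq_le; apply/andP; split.
  by apply: (@law_ae G H) => // x gx; rewrite GH.
by apply: (@law_ae H G) => // x gx; rewrite GH.
Qed.

Lemma conditional_fourth_moment (phi : X -> R) : measurable_fun setT phi ->
  (forall x, 0 <= phi x)%R ->
  \int[P]_z (phi z.1 * (z.2 - F z.1) ^+ 4)%:E <= \int[P]_z (phi z.1 * C4)%:E.
Proof.
move=> mphi phi0.
apply: (@law_ae (fun z => (phi z.1 * z.2 ^+ 4)%:E) (fun z => (phi z.1 * C4)%:E)).
- apply/measurable_EFinP; apply: measurable_funM; first exact: measurable_ext.
  by apply: measurable_funX; exact: measurable_snd.
- by apply/measurable_EFinP; apply: measurable_funM => //; exact: measurable_ext.
- by move=> z; rewrite lee_fin mulr_ge0// exprn_even_ge0.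
- by move=> z; rewrite lee_fin mulr_ge0.
move=> x [_ _ m4] /=.
rewrite integral_cst//= (@prob_kernel _ _ _ _ _ Q x) mule1 [leRHS]EFinM.
under eq_integral do rewrite EFinM.
rewrite ge0_integralZl//; last 3 first.
- by apply/measurable_EFinP; exact: measurable_funX.
- by move=> u _; rewrite lee_fin exprn_even_ge0.
- by rewrite lee_fin.
by apply: lee_wpmul2l; rewrite ?lee_fin.
Qed.

Lemma cell_probability M c j : (0 < M)%N ->
  P [set z | cell_index M c z.1 = j] <= (pp * (M%:R^-1) ^+ d)%:E.
Proof.
move=> M0; have [[_ pae] _ _ _] := inTheta.
have mj := @measurable_cell R d M c j.
pose G (z : X * R) : \bar R := (\1_[set x | cell_index M c x = j] z.1)%:E.
have -> : P [set z | cell_index M c z.1 = j] = \int[P]_z G (z.1, (z.2 - F z.1)%R).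
  transitivity (\int[P]_z (\1_[set z : X * R | cell_index M c z.1 = j] z)%:E) => //.
  rewrite integral_indic// ?setIT//.
  by have := @measurable_fst _ _ X R measurableT _ mj; rewrite setTI.
rewrite lawI//; last 2 first.
- by apply/measurable_EFinP; apply: measurable_ext; exact: measurable_indic.
- by move=> z; rewrite lee_fin.
apply: (@le_trans _ _ (\int[lam]_(x in cube) (pp%:E * (\1_[set x | cell_index M c x = j] x)%:E))).
  apply: ae_ge0_le_integral => //.
  - by move=> x xc; rewrite mule_ge0 ?lee_fin ?p0//; apply: integral_ge0 => u _; rewrite lee_fin.
  - apply: (@mfun G); last by move=> z; rewrite lee_fin.
    by apply/measurable_EFinP; apply: measurable_ext; exact: measurable_indic.
  - by move=> x xc; rewrite mule_ge0 ?lee_fin// ltW.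
  - by apply: measurable_funeM; apply/measurable_EFinP; apply: measurable_funTS; exact: measurable_indic.
  apply: filterS pae => x h xc.
  rewrite /G /= integral_cst//= (@prob_kernel _ _ _ _ _ Q x) mule1.
  by rewrite lee_wpmul2r ?lee_fin//; have /andP[] := h xc.
rewrite ge0_integralZl//; last 2 first.
- by apply/measurable_EFinP; apply: measurable_funTS; exact: measurable_indic.
- by rewrite lee_fin ltW.
rewrite integral_indic// EFinM; apply: lee_wpmul2l; first by rewrite lee_fin ltW.
by rewrite setIC; exact: lebesgue_cell.
Qed.

End model_moments.

(** * Moments of a pair of observations *)

Section real_inequalities.
Variable R : realType.
Implicit Types a b c v : R.

Lemma sqr_add3 a b c : (a + b + c) ^+ 2 <= 3 * (a ^+ 2 + b ^+ 2 + c ^+ 2).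
Proof. by have := sqr_ge0 (a - b); have := sqr_ge0 (b - c); have := sqr_ge0 (a - c); lra. Qed.

Lemma sqr_half_sub a b : 0 <= (a - b) ^+ 2 / 2 <= a ^+ 2 + b ^+ 2.
Proof. by have := sqr_ge0 (a + b); have := sqr_ge0 (a - b); move=> h1 h2; apply/andP; split; lra. Qed.

Lemma half_sub_bound a b v : 0 <= v -> `|(a - b) ^+ 2 / 2 - v| <= a ^+ 2 + b ^+ 2 + v.
Proof.
move=> v0; have /andP[h1 h2] := sqr_half_sub a b.
by rewrite ler_norml; apply/andP; split; lra.
Qed.

Lemma pow4_add a b : (a + b) ^+ 4 <= 8 * (a ^+ 4 + b ^+ 4).
Proof.
rewrite -(subr_ge0).
have -> : 8 * (a ^+ 4 + b ^+ 4) - (a + b) ^+ 4 =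
  (a - b) ^+ 2 * (7 * a ^+ 2 + 10 * a * b + 7 * b ^+ 2) by ring.
rewrite mulr_ge0 ?sqr_ge0//.
by have := sqr_ge0 (a + b); have := sqr_ge0 a; have := sqr_ge0 b; lra.
Qed.

End real_inequalities.

Section pair_moments.
Local Open Scope ereal_scope.
Variables (R : realType) (d M : nat) (P : probability ('rV[R]_d * R)%type R).
Local Notation X := 'rV[R]_d.
Local Notation Z := (X * R)%type.
Local Notation J := (cell_index M (no_shift d)).
Variables (F : X -> R) (V rho C4 kap : R).
Hypotheses (M0 : (0 < M)%N) (V0 : (0 <= V)%R) (rho0 : (0 <= rho)%R) (C40 : (0 <= C4)%R) (kap0 : (0 <= kap)%R).
Hypotheses (mF : measurable_fun setT F)
  (osc : forall x y, J x = J y -> (`|F x - F y| <= rho)%R)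
  (moment2 : forall phi t : X -> R, measurable_fun setT phi -> measurable_fun setT t ->
     (forall x, 0 <= phi x)%R ->
     \int[P]_z (phi z.1 * (z.2 - F z.1 + t z.1) ^+ 2)%:E =
     \int[P]_z (phi z.1 * (V + t z.1 ^+ 2))%:E)
  (moment4 : forall phi : X -> R, measurable_fun setT phi -> (forall x, 0 <= phi x)%R ->
     \int[P]_z (phi z.1 * (z.2 - F z.1) ^+ 4)%:E <= \int[P]_z (phi z.1 * C4)%:E)
  (cellp : forall j, P [set z | J z.1 = j] <= kap%:E).

(** Responses are centred at the value of F at the grid point of their cell: the
    centre cancels in the difference of two responses of the same cell, and the
    remaining moments do not depend on the size of F. *)
Definition cell_offset (x : X) : R := (F x - F (grid_point R (J x)))%R.
Definition residual (z : Z) : R := (z.2 - F (grid_point R (J z.1)))%R.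
Definition same_cell (x y : X) : R := (J x == J y)%:R.
Definition cell_mass (x : X) : R := fine (P [set z | J z.1 = J x]).
Local Notation r := cell_offset.
Local Notation e := residual.
Local Notation N := cell_mass.

Lemma residualE z : e z = (z.2 - F z.1 + r z.1)%R.
Proof. by rewrite /e /r; ring. Qed.

Lemma cell_offset_bound x : (`|r x| <= rho)%R.
Proof. by apply: osc; rewrite cell_grid_point. Qed.

Lemma offset_same x y : J x = J y -> (r x - r y = F x - F y)%R.
Proof. by rewrite /r => ->; ring. Qed.

Lemma residual_same z z' : J z.1 = J z'.1 -> (e z - e z' = z.2 - z'.2)%R.
Proof. by rewrite /e => ->; ring. Qed.

Lemma measurable_ext (phi : X -> R) : measurable_fun setT phi ->
  measurable_fun setT (fun z : Z => phi z.1).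
Proof. by move=> mphi; apply: measurableT_comp => //; exact: measurable_fst. Qed.

Lemma measurable_offset : measurable_fun setT r.
Proof.
apply: measurable_funB => //.
exact: (@measurable_fun_cell R d M (no_shift d) _ _ (fun j => F (grid_point R j))).
Qed.

Lemma measurable_residual : measurable_fun setT e.
Proof.
apply: measurable_funB; first exact: measurable_snd.
exact: (measurable_ext (@measurable_fun_cell R d M (no_shift d) _ _ (fun j => F (grid_point R j)))).
Qed.

Lemma measurable_same1 x : measurable_fun setT (same_cell x).
Proof. exact: (@measurable_fun_cell R d M (no_shift d) _ _ (fun j => (J x == j)%:R : R)). Qed.

Lemma measurable_mass : measurable_fun setT N.
Proof. exact: (@measurable_fun_cell R d M (no_shift d) _ _ (fun j => fine (P [set z | J z.1 = j]))). Qed.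

Lemma measurable_same dS (S : measurableType dS) (f g : S -> X) :
  measurable_fun setT f -> measurable_fun setT g -> measurable_fun setT (fun p => same_cell (f p) (g p)).
Proof.
move=> mf mg.
have -> : (fun p => same_cell (f p) (g p)) =
    (fun p => \sum_j (J (f p) == j)%:R * (J (g p) == j)%:R)%R.
  apply/funext => p; rewrite (bigD1 (J (f p)))//= eqxx mul1r big1 ?addr0.
    by rewrite /same_cell eq_sym.
  by move=> j jf; rewrite eq_sym (negbTE jf) mul0r.
have cj (h : S -> X) j : measurable_fun setT h -> measurable_fun setT (fun p => (J (h p) == j)%:R : R).
  by move=> mh; exact: (measurableT_comp (@measurable_fun_cell R d M (no_shift d) _ _ (fun i => (i == j)%:R : R)) mh).
by apply: measurable_sum => j; apply: measurable_funM; exact: cj.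
Qed.

Lemma same_cell_ge0 x y : (0 <= same_cell x y)%R. Proof. by []. Qed.
Lemma same_cell_sym x y : same_cell x y = same_cell y x. Proof. by rewrite /same_cell eq_sym. Qed.
Lemma same_cell_sqr x y : (same_cell x y ^+ 2 = same_cell x y)%R.
Proof. by rewrite /same_cell; case: (_ == _); rewrite ?expr1n ?expr0n. Qed.
Lemma same_cell_mono x y a b : (J x = J y -> a <= b)%R -> (same_cell x y * a <= same_cell x y * b)%R.
Proof. by rewrite /same_cell; case: eqP => [xy /(_ xy)|_ _]; rewrite ?mul1r ?mul0r. Qed.

Lemma mass_ge0 x : (0 <= N x)%R. Proof. by apply: fine_ge0. Qed.

Let mcell j : measurable [set z : Z | J z.1 = j].
Proof. by have := @measurable_fst _ _ X R measurableT _ (@measurable_cell R d M (no_shift d) j); rewrite setTI. Qed.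

Lemma massE x : P [set z | J z.1 = J x] = (N x)%:E.
Proof. by rewrite /N fineK// fin_num_measure. Qed.

Lemma mass_le x : (N x <= kap)%R.
Proof. by rewrite -lee_fin -massE. Qed.

Lemma mass_le1 x : (N x <= 1)%R.
Proof. by rewrite -lee_fin -massE probability_le1. Qed.

Lemma integral_same x (c : R) : (0 <= c)%R -> \int[P]_z (same_cell x z.1 * c)%:E = (N x * c)%:E.
Proof.
move=> c0; rewrite EFinM -massE.
transitivity (\int[P]_z (c%:E * (\1_[set z : Z | J z.1 = J x] z)%:E)).
  apply: eq_integral => z _; rewrite EFinM muleC; congr (_ * _%:E).
  by rewrite /same_cell indicE; congr (nat_of_bool _)%:R; apply/eqP/idP; rewrite inE.
rewrite ge0_integralZl ?lee_fin//; last by apply/measurable_EFinP; exact: measurable_indic.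
by rewrite integral_indic// setIT muleC.
Qed.

(** The probability that two independent observations share a cell. *)
Definition match_prob : R := fine (\int[P]_z (N z.1)%:E).

Lemma match_probE : \int[P]_z (N z.1)%:E = match_prob%:E.
Proof.
rewrite /match_prob fineK// ge0_fin_numE; last by apply: integral_ge0 => z _; rewrite lee_fin mass_ge0.
apply: (@le_lt_trans _ _ (\int[P]_z 1)); last by rewrite integral_probability_cst ltry.
apply: ge0_le_integral => //.
- by move=> z _; rewrite lee_fin mass_ge0.
- by apply/measurable_EFinP; apply: measurable_ext; exact: measurable_mass.
- by move=> z _; rewrite lee_fin mass_le1.
Qed.

Let le_int (f g : Z -> R) : measurable_fun setT f -> measurable_fun setT g ->
  (forall z, 0 <= f z)%R -> (forall z, f z <= g z)%R ->
  \int[P]_z (f z)%:E <= \int[P]_z (g z)%:E.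
Proof.
move=> mf mg f0 fg; apply: ge0_le_integral => //.
- by move=> z _; rewrite lee_fin.
- exact/measurable_EFinP.
- exact/measurable_EFinP.
- by move=> z _; rewrite lee_fin.
Qed.

Let intZ (f : Z -> R) (c : R) : measurable_fun setT f -> (forall z, 0 <= f z)%R -> (0 <= c)%R ->
  \int[P]_z (c * f z)%:E = c%:E * \int[P]_z (f z)%:E.
Proof.
move=> mf f0 c0; under eq_integral do rewrite EFinM.
rewrite ge0_integralZl ?lee_fin//; first exact/measurable_EFinP.
by move=> z _; rewrite lee_fin.
Qed.

Let intD (f g : Z -> R) : measurable_fun setT f -> measurable_fun setT g ->
  (forall z, 0 <= f z)%R -> (forall z, 0 <= g z)%R ->
  \int[P]_z (f z + g z)%:E = \int[P]_z (f z)%:E + \int[P]_z (g z)%:E.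
Proof.
move=> mf mg f0 g0; under eq_integral do rewrite EFinD.
by rewrite ge0_integralD//; [move=> z _; rewrite lee_fin|exact/measurable_EFinP|move=> z _; rewrite lee_fin|exact/measurable_EFinP].
Qed.

Lemma match_prob_ge0 : (0 <= match_prob)%R.
Proof. by apply: fine_ge0; apply: integral_ge0 => z _; rewrite lee_fin mass_ge0. Qed.

Let mN : measurable_fun setT (fun z : Z => N z.1).
Proof. by apply: measurable_ext; exact: measurable_mass. Qed.

Lemma match_prob_le1 : (match_prob <= 1)%R.
Proof.
rewrite -lee_fin -match_probE -[leRHS](integral_probability_cst P); apply: le_int => // z.
- exact: mass_ge0.
- exact: mass_le1.
Qed.

Lemma match_prob_le : (match_prob <= kap)%R.
Proof.
rewrite -lee_fin -match_probE -[leRHS](integral_probability_cst P); apply: le_int => // z.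
- exact: mass_ge0.
- exact: mass_le.
Qed.

Lemma integral_mass_sqr : \int[P]_z (N z.1 ^+ 2)%:E <= (kap * match_prob)%:E.
Proof.
rewrite EFinM -match_probE -intZ//; last by move=> z; exact: mass_ge0.
apply: le_int => //.
- exact: measurable_funX.
- by apply: measurable_funM.
- by move=> z; exact: sqr_ge0.
- by move=> z; rewrite expr2 ler_wpM2r ?mass_ge0 ?mass_le.
Qed.

Let cells := {ffun 'I_d -> 'I_M.+1}.

(** Cauchy-Schwarz: the cell masses sum to 1. *)
Lemma match_prob_lower : (1 <= #|cells|%:R * match_prob)%R.
Proof.
pose n (j : cells) : R := fine (P [set z | J z.1 = j]).
have nE j : P [set z | J z.1 = j] = (n j)%:E by rewrite /n fineK// fin_num_measure.
pose ind (j : cells) (z : Z) : R := (J z.1 == j)%:R.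
have mind j : measurable_fun setT (ind j).
  exact: (measurable_ext (@measurable_fun_cell R d M (no_shift d) _ _ (fun i => (i == j)%:R : R))).
have indE j : \int[P]_z (ind j z)%:E = (n j)%:E.
  transitivity (\int[P]_z (\1_[set z : Z | J z.1 = j] z)%:E).
    apply: eq_integral => z _; congr (_%:E).
    by rewrite /ind indicE; congr (nat_of_bool _)%:R; apply/eqP/idP; rewrite inE.
  by rewrite integral_indic// setIT; exact: nE.
have sumw (w : cells -> R) : (forall j, 0 <= w j)%R ->
    \int[P]_z (w (J z.1))%:E = (\sum_j w j * n j)%:E.
  move=> w0; transitivity (\int[P]_z \sum_j (w j * ind j z)%:E).
    apply: eq_integral => z _; rewrite sumEFin; congr (_%:E).
    rewrite (bigD1 (J z.1))//= /ind eqxx mulr1 big1 ?addr0// => j jz.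
    by rewrite eq_sym (negbTE jz) mulr0.
  rewrite ge0_integral_sum//; last 2 first.
  - by move=> j; apply/measurable_EFinP; apply: measurable_funM => //; exact: mind.
  - by move=> j z _; rewrite lee_fin mulr_ge0.
  rewrite -sumEFin; apply: eq_bigr => j _; rewrite intZ// indE//.
have n0 j : (0 <= n j)%R by exact: fine_ge0.
have s1 : (\sum_j n j = 1)%R.
  apply: EFin_inj; rewrite -(integral_probability_cst P 1).
  rewrite (sumw (fun=> 1%R))//; congr (_%:E); apply: eq_bigr => j _; by rewrite mul1r.
have -> : match_prob = (\sum_j n j * n j)%R by apply: EFin_inj; rewrite -match_probE -sumw.
set k := #|cells|%:R.
have k0 : (0 < k :> R)%R by rewrite ltr0n; apply/card_gt0P; exists [ffun=> ord0].
have : (0 <= \sum_j (n j - k^-1) ^+ 2)%R by apply: sumr_ge0 => j _; exact: sqr_ge0.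
have -> : (\sum_j (n j - k^-1) ^+ 2 = \sum_j n j * n j - k^-1)%R.
  transitivity (\sum_j n j * n j - 2 * k^-1 * \sum_j n j + \sum_(j : cells) k^-1 ^+ 2)%R.
    rewrite mulr_sumr -sumrB -big_split/=; apply: eq_bigr => j _; ring.
  rewrite s1 sumr_const -mulr_natr -/k; field.
  by rewrite gt_eqF.
rewrite subr_ge0 => h; rewrite mulrC -ler_pdivrMr// div1r//.
Qed.

(** A bound for the conditional fourth moment of the residuals. *)
Definition fourth_bound : R := (8 * (C4 + rho ^+ 4))%R.
Lemma fourth_bound_ge0 : (0 <= fourth_bound)%R. Proof. by rewrite /fourth_bound mulr_ge0// addr_ge0// exprn_ge0. Qed.

Lemma residual_moment4 (phi : X -> R) : measurable_fun setT phi -> (forall x, 0 <= phi x)%R ->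
  \int[P]_z (phi z.1 * e z ^+ 4)%:E <= fourth_bound%:E * \int[P]_z (phi z.1)%:E.
Proof.
move=> mphi phi0.
have mphi' := measurable_ext mphi.
have mA : measurable_fun setT (fun z : Z => phi z.1 * (z.2 - F z.1) ^+ 4)%R.
  apply: measurable_funM => //; apply: measurable_funX; apply: measurable_funB; first exact: measurable_snd.
  exact: measurable_ext.
have A0 (z : Z) : (0 <= phi z.1 * (z.2 - F z.1) ^+ 4)%R by rewrite mulr_ge0// exprn_even_ge0.
apply: (@le_trans _ _ (\int[P]_z (8 * (phi z.1 * (z.2 - F z.1) ^+ 4) + 8 * rho ^+ 4 * phi z.1)%:E)).
  apply: le_int.
  - by apply: measurable_funM => //; apply: measurable_funX; exact: measurable_residual.
  - by apply: measurable_funD; apply: measurable_funM.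
  - by move=> z; rewrite mulr_ge0// exprn_even_ge0.
  - move=> z; rewrite residualE.
    have -> : (8 * (phi z.1 * (z.2 - F z.1) ^+ 4) + 8 * rho ^+ 4 * phi z.1 =
      phi z.1 * (8 * ((z.2 - F z.1) ^+ 4 + rho ^+ 4)))%R by ring.
    rewrite ler_wpM2l//; apply: (le_trans (pow4_add _ _)); rewrite ler_wpM2l// lerD2l.
    rewrite -(@ger0_norm _ (r z.1 ^+ 4)) ?exprn_even_ge0// normrX lerXn2r ?nnegrE//.
    exact: cell_offset_bound.
rewrite intD; last 4 first.
- by apply: measurable_funM.
- by apply: measurable_funM.
- by move=> z; rewrite mulr_ge0.
- by move=> z; rewrite mulr_ge0// mulr_ge0// exprn_ge0.
rewrite !intZ ?mulr_ge0 ?exprn_ge0//.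
have := moment4 mphi phi0; under [leRHS]eq_integral do rewrite mulrC.
rewrite intZ// => h.
apply: (le_trans (leeD (lee_wpmul2l _ h) (lexx _))); first by rewrite lee_fin.
rewrite muleA -EFinM -ge0_muleDl ?lee_fin ?mulr_ge0 ?exprn_ge0//.
by rewrite -EFinD /fourth_bound mulrDr.
Qed.

Lemma residual_moment2_same x c : \int[P]_z (same_cell x z.1 * (e z + c) ^+ 2)%:E =
  \int[P]_z (same_cell x z.1 * (V + (r z.1 + c) ^+ 2))%:E.
Proof.
transitivity (\int[P]_z (same_cell x z.1 * (z.2 - F z.1 + (r z.1 + c)) ^+ 2)%:E).
  by apply: eq_integral => z _; congr (_ * _ ^+ 2)%:E; rewrite residualE; ring.
apply: (moment2 (t := fun y => r y + c)%R); first exact: measurable_same1.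
- by apply: measurable_funD => //; exact: measurable_offset.
- by move=> y; exact: same_cell_ge0.
Qed.

(** Summed over pairs, this kernel gives the numerator of the estimator minus V
    times its denominator. *)
Definition pair_dev (z z' : Z) : R := (same_cell z.1 z'.1 * ((e z - e z') ^+ 2 / 2 - V))%R.
Local Notation g := pair_dev.

Let ms1 x : measurable_fun setT (fun z : Z => same_cell x z.1).
Proof. by apply: measurable_ext; exact: measurable_same1. Qed.
Let me : measurable_fun setT e. Proof. exact: measurable_residual. Qed.
Let mr : measurable_fun setT (fun z : Z => r z.1).
Proof. by apply: measurable_ext; exact: measurable_offset. Qed.

Lemma pair_dev_sym z z' : g z z' = g z' z.
Proof. by rewrite /g same_cell_sym -[(e z - e z')%R]opprB sqrrN. Qed.

Lemma measurable_pair_dev : measurable_fun setT (fun p : Z * Z => g p.1 p.2).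
Proof.
apply: measurable_funM.
  apply: measurable_same; apply: measurableT_comp.
  - exact: measurable_fst.
  - exact: measurable_fst.
  - exact: measurable_fst.
  - exact: measurable_snd.
apply: measurable_funB => //; apply: measurable_funM => //; apply: measurable_funX.
by apply: measurable_funB; apply: measurableT_comp.
Qed.

Lemma measurable_pair_dev1 z : measurable_fun setT (g z).
Proof.
apply: measurable_funM => //; apply: measurable_funB => //; apply: measurable_funM => //.
by apply: measurable_funX; apply: measurable_funB.
Qed.

Lemma pair_dev_sqr z : \int[P]_z' (g z z' ^+ 2)%:E <=
  (3 * (N z.1 * (e z ^+ 4 + V ^+ 2 + fourth_bound)))%:E.
Proof.
have c0 : (0 <= 3 * (e z ^+ 4 + V ^+ 2))%R by rewrite mulr_ge0// addr_ge0 ?sqr_ge0 ?exprn_even_ge0.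
have me4 : measurable_fun setT (fun z' => same_cell z.1 z'.1 * e z' ^+ 4)%R.
  by apply: measurable_funM => //; exact: measurable_funX.
apply: (@le_trans _ _ (\int[P]_z' (same_cell z.1 z'.1 * (3 * (e z ^+ 4 + V ^+ 2)) + 3 * (same_cell z.1 z'.1 * e z' ^+ 4))%:E)).
  apply: le_int.
  - by apply: measurable_funX; exact: measurable_pair_dev1.
  - by apply: measurable_funD; apply: measurable_funM.
  - by move=> z'; exact: sqr_ge0.
  - move=> z'; rewrite /g exprMn same_cell_sqr.
    have -> : (same_cell z.1 z'.1 * (3 * (e z ^+ 4 + V ^+ 2)) + 3 * (same_cell z.1 z'.1 * e z' ^+ 4) =
      same_cell z.1 z'.1 * (3 * ((e z ^+ 2) ^+ 2 + (e z' ^+ 2) ^+ 2 + V ^+ 2)))%R by ring.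
    rewrite ler_wpM2l//; apply: le_trans (sqr_add3 _ _ _).
    rewrite -[leLHS](real_normK (num_real _)) lerXn2r ?nnegrE ?addr_ge0 ?sqr_ge0//.
    exact: half_sub_bound.
rewrite intD; last 4 first.
- by apply: measurable_funM.
- by apply: measurable_funM.
- by move=> z'; rewrite mulr_ge0.
- by move=> z'; rewrite mulr_ge0// mulr_ge0// exprn_even_ge0.
rewrite integral_same// intZ//; last by move=> z'; rewrite mulr_ge0// exprn_even_ge0.
have := residual_moment4 (measurable_same1 z.1) (fun y => same_cell_ge0 z.1 y).
have := integral_same z.1 (@ler01 R); under eq_integral do rewrite mulr1.
move=> ->; rewrite mulr1 -EFinM => h.
apply: (le_trans (leeD (lexx _) (lee_wpmul2l _ h))); first by rewrite lee_fin.
by rewrite -EFinM -EFinD lee_fin le_eqVlt; apply/orP; left; apply/eqP; ring.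
Qed.

Lemma sqint_pair_dev z : sqint P (g z).
Proof.
split; first exact: measurable_pair_dev1.
by apply: le_lt_trans (pair_dev_sqr z) _; rewrite ltry.
Qed.

Lemma integral_pair_dev_sqr :
  \int[P]_z \int[P]_z' (g z z' ^+ 2)%:E <= (3 * (2 * fourth_bound + V ^+ 2) * match_prob)%:E.
Proof.
have N4 : measurable_fun setT (fun z : Z => N z.1 * e z ^+ 4)%R.
  by apply: measurable_funM => //; exact: measurable_funX.
have N40 (z : Z) : (0 <= N z.1 * e z ^+ 4)%R by rewrite mulr_ge0 ?mass_ge0// exprn_even_ge0.
have VK : (0 <= V ^+ 2 + fourth_bound)%R by rewrite addr_ge0 ?sqr_ge0 ?fourth_bound_ge0.
apply: (@le_trans _ _ (\int[P]_z (3 * (N z.1 * e z ^+ 4) + 3 * (V ^+ 2 + fourth_bound) * N z.1)%:E)).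
  apply: ge0_le_integral => //.
  - by move=> z _; apply: integral_ge0 => z' _; rewrite lee_fin sqr_ge0.
  - apply: (@measurable_fun_fubini_tonelli_F _ _ _ _ _ P (fun p : Z * Z => (g p.1 p.2 ^+ 2)%:E)).
      by apply/measurable_EFinP; apply: measurable_funX; exact: measurable_pair_dev.
    by move=> p; rewrite lee_fin sqr_ge0.
  - by apply/measurable_EFinP; apply: measurable_funD; apply: measurable_funM.
  - move=> z _; apply: (le_trans (pair_dev_sqr z)).
    by rewrite lee_fin le_eqVlt; apply/orP; left; apply/eqP; ring.
rewrite intD; last 4 first.
- by apply: measurable_funM.
- by apply: measurable_funM.
- by move=> z; rewrite mulr_ge0.
- by move=> z; rewrite mulr_ge0 ?mass_ge0// mulr_ge0.
rewrite !intZ ?mulr_ge0//; last by move=> z; exact: mass_ge0.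
have h := residual_moment4 measurable_mass mass_ge0; rewrite match_probE in h *.
apply: (le_trans (leeD (lee_wpmul2l _ h) (lexx _))); first by rewrite lee_fin.
by rewrite -!EFinM -EFinD lee_fin le_eqVlt; apply/orP; left; apply/eqP; ring.
Qed.

Local Notation g1 := (fun z => expect P (g z)).

Lemma integral_same_residual2 x : \int[P]_z (same_cell x z.1 * e z ^+ 2)%:E <= (N x * (V + rho ^+ 2))%:E.
Proof.
have := residual_moment2_same x 0; under eq_integral do rewrite addr0; move=> ->.
rewrite -integral_same ?addr_ge0 ?sqr_ge0//; apply: le_int.
- by apply: measurable_funM => //; apply: measurable_funD => //; apply: measurable_funX; exact: measurable_funD.
- by apply: measurable_funM.
- by move=> z; rewrite mulr_ge0// addr_ge0// sqr_ge0.
- move=> z; rewrite ler_wpM2l// lerD2l addr0 -(real_normK (num_real (r z.1))).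
  by rewrite lerXn2r ?nnegrE//; exact: cell_offset_bound.
Qed.

Lemma measurable_mean_pair_dev : measurable_fun setT g1.
Proof.
have mG : measurable_fun setT (fun p : Z * Z => (g p.1 p.2)%:E).
  by apply/measurable_EFinP; exact: measurable_pair_dev.
have -> : g1 = (fun z => fine (\int[P]_z' (g z z')%:E)) by [].
apply: (measurableT_comp (f := @fine R)) => //.
have -> : (fun z => \int[P]_z' (g z z')%:E) =
   (fun z => \int[P]_z' ((fun p : Z * Z => (g p.1 p.2)%:E)^\+ (z, z')) -
             \int[P]_z' ((fun p : Z * Z => (g p.1 p.2)%:E)^\- (z, z'))).
  apply/funext => z; rewrite integralE; congr (_ - _); apply: eq_integral => z' _.
    by rewrite !funeposE.
  by rewrite !funenegE.
have mp := @measurable_fun_fubini_tonelli_F _ _ Z Z R P ((fun p : Z * Z => (g p.1 p.2)%:E)^\+)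
  (measurable_funepos mG) (fun=> funepos_ge0 _ _).
have mn := @measurable_fun_fubini_tonelli_F _ _ Z Z R P ((fun p : Z * Z => (g p.1 p.2)%:E)^\-)
  (measurable_funeneg mG) (fun=> funeneg_ge0 _ _).
by apply: emeasurable_funB; [exact: mp|exact: mn].
Qed.

Lemma mean_pair_dev_bound z : (`|g1 z| <= N z.1 * (e z ^+ 2 + 2 * V + rho ^+ 2))%R.
Proof.
rewrite -lee_fin -abse_EFin -expectE; last exact: sqint_pair_dev.
apply: (le_trans (le_abse_integral _ _ _)) => //.
  by apply/measurable_EFinP; exact: measurable_pair_dev1.
have c0 : (0 <= e z ^+ 2 + V)%R by rewrite addr_ge0// sqr_ge0.
apply: (@le_trans _ _ (\int[P]_z' (same_cell z.1 z'.1 * (e z ^+ 2 + V) + same_cell z.1 z'.1 * e z' ^+ 2)%:E)).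
  apply: (le_int (f := fun z' => `|g z z'|)%R).
  - by apply: measurableT_comp => //; exact: measurable_pair_dev1.
  - by apply: measurable_funD; apply: measurable_funM => //; exact: measurable_funX.
  - by [].
  - move=> z'; rewrite -mulrDr /g normrM (ger0_norm (same_cell_ge0 _ _)) ler_wpM2l//.
    by apply: (le_trans (half_sub_bound _ _ V0)); lra.
rewrite intD; last 4 first.
- by apply: measurable_funM.
- by apply: measurable_funM => //; exact: measurable_funX.
- by move=> z'; rewrite mulr_ge0.
- by move=> z'; rewrite mulr_ge0// sqr_ge0.
rewrite integral_same//; apply: (le_trans (leeD (lexx _) (integral_same_residual2 z.1))).
by rewrite -EFinD lee_fin le_eqVlt; apply/orP; left; apply/eqP; ring.
Qed.

Lemma integral_mean_pair_dev_sqr :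
  \int[P]_z (g1 z ^+ 2)%:E <= (3 * (fourth_bound + 4 * V ^+ 2 + rho ^+ 4) * kap * match_prob)%:E.
Proof.
have mN2 : measurable_fun setT (fun x => N x ^+ 2)%R.
  by apply: measurable_funX; exact: measurable_mass.
have mN2' := measurable_ext mN2.
have N4 : measurable_fun setT (fun z : Z => N z.1 ^+ 2 * e z ^+ 4)%R.
  by apply: measurable_funM => //; exact: measurable_funX.
have N40 (z : Z) : (0 <= N z.1 ^+ 2 * e z ^+ 4)%R by rewrite mulr_ge0 ?sqr_ge0// exprn_even_ge0.
have c0 : (0 <= 3 * (4 * V ^+ 2 + rho ^+ 4))%R.
  by rewrite mulr_ge0// addr_ge0 ?exprn_ge0// mulr_ge0// sqr_ge0.
apply: (@le_trans _ _ (\int[P]_z (3 * (N z.1 ^+ 2 * e z ^+ 4) + 3 * (4 * V ^+ 2 + rho ^+ 4) * N z.1 ^+ 2)%:E)).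
  apply: le_int.
  - by apply: measurable_funX; exact: measurable_mean_pair_dev.
  - by apply: measurable_funD; apply: measurable_funM.
  - by move=> z; exact: sqr_ge0.
  - move=> z; have -> : (3 * (N z.1 ^+ 2 * e z ^+ 4) + 3 * (4 * V ^+ 2 + rho ^+ 4) * N z.1 ^+ 2 =
      N z.1 ^+ 2 * (3 * ((e z ^+ 2) ^+ 2 + (2 * V) ^+ 2 + (rho ^+ 2) ^+ 2)))%R by ring.
    apply: (@le_trans _ _ ((N z.1 * (e z ^+ 2 + 2 * V + rho ^+ 2)) ^+ 2)%R).
      rewrite -[leLHS](real_normK (num_real _)) lerXn2r ?nnegrE//; last exact: mean_pair_dev_bound.
      by rewrite mulr_ge0 ?mass_ge0// addr_ge0 ?sqr_ge0// addr_ge0 ?sqr_ge0// mulr_ge0.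
    by rewrite exprMn ler_wpM2l ?sqr_ge0//; exact: sqr_add3.
rewrite intD; last 4 first.
- by apply: measurable_funM.
- by apply: measurable_funM.
- by move=> z; rewrite mulr_ge0.
- by move=> z; rewrite mulr_ge0 ?sqr_ge0.
rewrite !intZ//; last by move=> z; exact: sqr_ge0.
have h := residual_moment4 mN2 (fun x => sqr_ge0 (N x)).
have hN := integral_mass_sqr.
apply: (le_trans (leeD (lee_wpmul2l _ (le_trans h (lee_wpmul2l _ hN))) (lee_wpmul2l _ hN))); rewrite ?lee_fin ?fourth_bound_ge0//.
by rewrite le_eqVlt; apply/orP; left; apply/eqP; ring.
Qed.

Lemma sqint_mean_pair_dev : sqint P g1.
Proof.
split; first exact: measurable_mean_pair_dev.
by apply: le_lt_trans integral_mean_pair_dev_sqr _; rewrite ltry.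
Qed.

(** Links the nonnegative kernel, to which Tonelli applies, with the signed
    one. *)
Lemma integral_pair_diff z : \int[P]_z' (same_cell z.1 z'.1 * (e z - e z') ^+ 2)%:E =
  (2 * (g1 z + V * N z.1))%:E.
Proof.
have mS : measurable_fun setT (fun z' => same_cell z.1 z'.1 * (e z - e z') ^+ 2)%R.
  by apply: measurable_funM => //; apply: measurable_funX; exact: measurable_funB.
have VN := integral_same z.1 V0.
have sV : sqint P (fun z' => same_cell z.1 z'.1 * V)%R.
  split; first exact: measurable_funM.
  under eq_integral do rewrite exprMn same_cell_sqr.
  by rewrite integral_same ?sqr_ge0// ltry.
have -> : (V * N z.1 = expect P (fun z' => same_cell z.1 z'.1 * V))%R.
  by rewrite /expect VN/= mulrC.
rewrite -expectD//; last exact: sqint_pair_dev.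
rewrite EFinM -expectE; last by apply: sqintD => //; exact: sqint_pair_dev.
rewrite -intZ//; last 2 first.
- by apply: measurable_funD; [exact: measurable_pair_dev1|exact: measurable_funM].
- by move=> z'; rewrite /g -mulrDr subrK mulr_ge0// divr_ge0// sqr_ge0.
by apply: eq_integral => z' _; congr (_%:E); rewrite /g; field.
Qed.

(** The expectation of (e - e')^2 over matching pairs is that of
    2 V + (r - r')^2, where r - r' is an increment of the regression function
    inside a cell. *)
Lemma mean_pair_dev_bias : (`|expect P g1| <= rho ^+ 2 / 2 * match_prob)%R.
Proof.
have sg1 := sqint_mean_pair_dev.
have sVN : sqint P (fun z : Z => V * N z.1)%R.
  split; first exact: measurable_funM.
  under eq_integral do rewrite exprMn.
  rewrite intZ ?sqr_ge0//; [|exact: measurable_funX|by move=> z; exact: sqr_ge0].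
  apply: le_lt_trans (lee_wpmul2l _ integral_mass_sqr) _; first by rewrite lee_fin sqr_ge0.
  by rewrite -EFinM ltry.
have mVN : expect P (fun z : Z => V * N z.1)%R = (V * match_prob)%R.
  by rewrite /expect intZ ?match_probE// => z; exact: mass_ge0.
have mm : measurable_fun setT (fun p : Z * Z => same_cell p.1.1 p.2.1).
  apply: measurable_same; apply: measurableT_comp.
  - exact: measurable_fst.
  - exact: measurable_fst.
  - exact: measurable_fst.
  - exact: measurable_snd.
have mp1 (f : Z -> R) : measurable_fun setT f -> measurable_fun setT (fun p : Z * Z => f p.1).
  by move=> mf; apply: measurableT_comp => //; exact: measurable_fst.
have mp2 (f : Z -> R) : measurable_fun setT f -> measurable_fun setT (fun p : Z * Z => f p.2).
  by move=> mf; apply: measurableT_comp => //; exact: measurable_snd.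
have tot : (2 * (expect P g1 + V * match_prob))%:E =
    \int[P]_z \int[P]_z' (same_cell z.1 z'.1 * (2 * V + (r z.1 - r z'.1) ^+ 2))%:E.
  rewrite -mVN -expectD// EFinM -expectE; last exact: sqintD.
  have q0 z : (0 <= g1 z + V * N z.1)%R.
    rewrite -(@pmulr_rge0 _ 2)// -lee_fin -integral_pair_diff.
    by apply: integral_ge0 => z' _; rewrite lee_fin mulr_ge0// sqr_ge0.
  rewrite -intZ//; last first.
    by apply: measurable_funD; [exact: measurable_mean_pair_dev|exact: measurable_funM].
  under eq_integral do rewrite -integral_pair_diff.
  (* the inner noise is integrated out first, then, by Tonelli, the outer one *)
  transitivity (\int[P]_z \int[P]_z' (same_cell z.1 z'.1 * (V + (r z'.1 - e z) ^+ 2))%:E).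
    apply: eq_integral => z _; have := residual_moment2_same z.1 (- e z)%R => <-.
    by apply: eq_integral => z' _; congr (_ * _)%:E; rewrite -sqrrN opprB.
  rewrite (fubini_tonelli (m1 := P) (m2 := P) (fun p : Z * Z => (same_cell p.1.1 p.2.1 * (V + (r p.2.1 - e p.1) ^+ 2))%:E)); last 2 first.
  - apply/measurable_EFinP; apply: measurable_funM => //; apply: measurable_funD => //.
    by apply: measurable_funX; apply: measurable_funB; [exact: (mp2 (fun z : Z => r z.1))|exact: mp1].
  - by move=> p; rewrite lee_fin mulr_ge0// addr_ge0// sqr_ge0.
  apply: eq_integral => z _ /=.
  transitivity (\int[P]_z' (same_cell z.1 z'.1 * V + same_cell z.1 z'.1 * (e z' - r z.1) ^+ 2)%:E).
    by apply: eq_integral => z' _; congr (_%:E); rewrite same_cell_sym -(opprB (e z')) sqrrN mulrDr.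
  rewrite intD; last 4 first.
  - exact: measurable_funM.
  - by apply: measurable_funM => //; apply: measurable_funX; exact: measurable_funB.
  - by move=> z'; rewrite mulr_ge0.
  - by move=> z'; rewrite mulr_ge0// sqr_ge0.
  rewrite residual_moment2_same -intD; last 4 first.
  - exact: measurable_funM.
  - apply: measurable_funM => //; apply: measurable_funD => //.
    by apply: measurable_funX; exact: measurable_funD.
  - by move=> z'; rewrite mulr_ge0.
  - by move=> z'; rewrite mulr_ge0// addr_ge0// sqr_ge0.
  by apply: eq_integral => z' _; congr (_%:E); rewrite -(opprB (r z'.1)) sqrrN; ring.
have innerE (c : R) (z : Z) : (0 <= c)%R -> \int[P]_z' (same_cell z.1 z'.1 * c)%:E = (c * N z.1)%:E.
  by move=> c0; rewrite integral_same// mulrC.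
have minner : measurable_fun setT (fun z : Z => \int[P]_z' (same_cell z.1 z'.1 * (2 * V + (r z.1 - r z'.1) ^+ 2))%:E).
  apply: (@measurable_fun_fubini_tonelli_F _ _ _ _ _ P (fun p : Z * Z => (same_cell p.1.1 p.2.1 * (2 * V + (r p.1.1 - r p.2.1) ^+ 2))%:E)).
    apply/measurable_EFinP; apply: measurable_funM => //; apply: measurable_funD => //.
    by apply: measurable_funX; apply: measurable_funB; [exact: (mp1 (fun z : Z => r z.1))|exact: (mp2 (fun z : Z => r z.1))].
  by move=> p; rewrite lee_fin mulr_ge0// addr_ge0 ?sqr_ge0// mulr_ge0.
have mfib (z : Z) : measurable_fun setT (fun z' : Z => same_cell z.1 z'.1 * (2 * V + (r z.1 - r z'.1) ^+ 2))%R.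
  apply: measurable_funM => //; apply: measurable_funD => //.
  by apply: measurable_funX; apply: measurable_funB.
have outer (c : R) : (0 <= c)%R -> \int[P]_z (c * N z.1)%:E = (c * match_prob)%:E.
  by move=> c0; rewrite intZ ?match_probE// => z; exact: mass_ge0.
have V2 : (0 <= 2 * V)%R by rewrite mulr_ge0.
have V2r : (0 <= 2 * V + rho ^+ 2)%R by rewrite addr_ge0 ?sqr_ge0.
have lower : (2 * V * match_prob)%:E <= (2 * (expect P g1 + V * match_prob))%:E.
  rewrite tot -outer//; apply: ge0_le_integral => //.
  - by move=> z _; rewrite lee_fin mulr_ge0 ?mass_ge0.
  - by apply/measurable_EFinP; apply: measurable_funM.
  - move=> z _; rewrite -innerE//; apply: le_int => //.
    + exact: measurable_funM.
    + by move=> z'; rewrite mulr_ge0.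
    + by move=> z'; rewrite ler_wpM2l// lerDl sqr_ge0.
have upper : (2 * (expect P g1 + V * match_prob))%:E <= ((2 * V + rho ^+ 2) * match_prob)%:E.
  rewrite tot -outer//; apply: ge0_le_integral => //.
  - by move=> z _; apply: integral_ge0 => z' _; rewrite lee_fin mulr_ge0// addr_ge0 ?sqr_ge0.
  - by apply/measurable_EFinP; apply: measurable_funM.
  - move=> z _; rewrite -innerE//; apply: le_int => //.
    + exact: measurable_funM.
    + by move=> z'; rewrite mulr_ge0// addr_ge0 ?sqr_ge0.
    + move=> z'; apply: same_cell_mono => Jz; rewrite lerD2l offset_same//.
      rewrite -(real_normK (num_real (F z.1 - F z'.1)%R)) lerXn2r ?nnegrE//; exact: osc.
move: lower upper; rewrite !lee_fin ler_norml => h1 h2.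
have h3 : (0 <= rho ^+ 2 * match_prob)%R by rewrite mulr_ge0 ?sqr_ge0 ?match_prob_ge0.
by apply/andP; split; lra.
Qed.

Definition pair_cnt (z z' : Z) : R := (same_cell z.1 z'.1 - match_prob)%R.

Lemma pair_cnt_sym z z' : pair_cnt z z' = pair_cnt z' z.
Proof. by rewrite /pair_cnt same_cell_sym. Qed.

Lemma measurable_pair_cnt : measurable_fun setT (fun p : Z * Z => pair_cnt p.1 p.2).
Proof.
apply: measurable_funB => //; apply: measurable_same; apply: measurableT_comp.
- exact: measurable_fst.
- exact: measurable_fst.
- exact: measurable_fst.
- exact: measurable_snd.
Qed.

Lemma sqint_same x : sqint P (fun z => same_cell x z.1) /\ expect P (fun z => same_cell x z.1) = N x.
Proof.
have := integral_same x (@ler01 R); under eq_integral do rewrite mulr1; rewrite mulr1 => h.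
split; last by rewrite /expect h.
by split => //; under eq_integral do rewrite same_cell_sqr; rewrite h ltry.
Qed.

Lemma sqint_pair_cnt z : sqint P (pair_cnt z).
Proof.
by apply: sqintD; [case: (sqint_same z.1)|exact: sqint_cst].
Qed.

Lemma mean_pair_cnt z : expect P (pair_cnt z) = (N z.1 - match_prob)%R.
Proof.
have [h1 h2] := sqint_same z.1.
by rewrite /pair_cnt expectD ?h2 ?expect_cst//; exact: sqint_cst.
Qed.

Lemma integral_pair_cnt_sqr :
  \int[P]_z \int[P]_z' (pair_cnt z z' ^+ 2)%:E <= (4 * match_prob)%:E.
Proof.
have m2 : (0 <= 2 * match_prob)%R by rewrite mulr_ge0// match_prob_ge0.
apply: (@le_trans _ _ (\int[P]_z (2 * N z.1 + 2 * match_prob)%:E)).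
  apply: ge0_le_integral => //.
  - by move=> z _; apply: integral_ge0 => z' _; rewrite lee_fin sqr_ge0.
  - apply: (@measurable_fun_fubini_tonelli_F _ _ _ _ _ P (fun p : Z * Z => (pair_cnt p.1 p.2 ^+ 2)%:E)).
      by apply/measurable_EFinP; apply: measurable_funX; exact: measurable_pair_cnt.
    by move=> p; rewrite lee_fin sqr_ge0.
  - by apply/measurable_EFinP; apply: measurable_funD => //; apply: measurable_funM.
  - move=> z _; apply: (@le_trans _ _ (\int[P]_z' (same_cell z.1 z'.1 * 2 + 2 * match_prob)%:E)).
      apply: le_int.
      + by apply: measurable_funX; apply: measurable_funB.
      + by apply: measurable_funD => //; exact: measurable_funM.
      + by move=> z'; exact: sqr_ge0.
      + move=> z'; rewrite /pair_cnt; have m0 := match_prob_ge0; have m1 := match_prob_le1.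
        have mm : (match_prob * match_prob <= match_prob)%R by rewrite ler_piMr.
        by rewrite /same_cell; case: (_ == _) => /=; nra.
    rewrite intD//; [|exact: measurable_funM|by move=> z'; rewrite mulr_ge0].
    by rewrite integral_same// integral_probability_cst -EFinD mulrC.
rewrite intD//; [|by apply: measurable_funM|by move=> z; rewrite mulr_ge0 ?mass_ge0].
rewrite intZ//; last by move=> z; exact: mass_ge0.
by rewrite match_probE integral_probability_cst -EFinM -EFinD lee_fin; lra.
Qed.

Lemma integral_mean_pair_cnt_sqr :
  \int[P]_z (expect P (pair_cnt z) ^+ 2)%:E <= (4 * kap * match_prob)%:E.
Proof.
under eq_integral do rewrite mean_pair_cnt.
have mk : (match_prob * match_prob <= kap * match_prob)%R by rewrite ler_wpM2r ?match_prob_ge0 ?match_prob_le.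
apply: (@le_trans _ _ (\int[P]_z (2 * N z.1 ^+ 2 + 2 * match_prob ^+ 2)%:E)).
  apply: le_int.
  - by apply: measurable_funX; exact: measurable_funB.
  - by apply: measurable_funD => //; apply: measurable_funM => //; exact: measurable_funX.
  - by move=> z; exact: sqr_ge0.
  - by move=> z; have := sqr_ge0 (N z.1 + match_prob); lra.
rewrite intD//; [|by apply: measurable_funM => //; exact: measurable_funX
  |by move=> z; rewrite mulr_ge0 ?sqr_ge0|by move=> z; rewrite mulr_ge0 ?sqr_ge0].
rewrite intZ//; [|exact: measurable_funX|by move=> z; exact: sqr_ge0].
rewrite integral_probability_cst.
apply: (le_trans (leeD (lee_wpmul2l _ integral_mass_sqr) (lexx _))); first by rewrite lee_fin.
by rewrite -EFinM -EFinD lee_fin expr2; lra.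
Qed.

Lemma sqint_mean_pair_cnt : sqint P (fun z => expect P (pair_cnt z)).
Proof.
split; last by apply: le_lt_trans integral_mean_pair_cnt_sqr _; rewrite ltry.
by apply: (eq_measurable_fun (fun z : Z => N z.1 - match_prob)%R); [move=> z _; rewrite mean_pair_cnt|exact: measurable_funB].
Qed.

Lemma mean_mean_pair_cnt : expect P (fun z => expect P (pair_cnt z)) = 0%R.
Proof.
have -> : (fun z => expect P (pair_cnt z)) = (fun z : Z => N z.1 - match_prob)%R.
  by apply/funext => z; rewrite mean_pair_cnt.
have sN : sqint P (fun z : Z => N z.1).
  by split => //; apply: le_lt_trans integral_mass_sqr _; rewrite ltry.
rewrite (@expectD _ _ _ P (fun z : Z => N z.1) (fun=> - match_prob)%R)//; last exact: sqint_cst.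
by rewrite expect_cst /expect match_probE subrr.
Qed.

End pair_moments.

(** * The paired estimator *)

Section clipping.
Variable R : realType.
Implicit Types a b x y v : R.

Definition clip a b x : R := Num.min (Num.max x a) b.

Lemma clip_itv a b x : a <= b -> a <= clip a b x <= b.
Proof.
move=> ab; rewrite /clip /Order.max /Order.min.
by case: (ltP x a) => h1; case: ltP => h2; apply/andP; split; lra.
Qed.

Lemma clip_contract a b x v : a <= v <= b -> `|clip a b x - v| <= `|x - v|.
Proof.
move=> /andP[av vb]; have := ler_norm (x - v); have := ler_norm (v - x); rewrite distrC.
rewrite /clip /Order.max /Order.min ler_norml => h1 h2.
by case: (ltP x a) => h3; case: ltP => h4; apply/andP; split; lra.
Qed.

Lemma measurable_clip a b : measurable_fun setT (clip a b).
Proof. by apply: measurable_minr => //; exact: measurable_maxr. Qed.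

(** Either the denominator exceeds half its expected value B, and the error is
    at most 2 / B times that of the numerator; or it deviates by B / 2, and the
    error is at most the length of the clipping interval. *)
Lemma clip_ratio_bound (num cnt v a b B : R) : a <= v <= b -> 0 < B -> 0 <= cnt ->
  (clip a b (num / cnt) - v) ^+ 2 <=
  4 / B ^+ 2 * (num - v * cnt) ^+ 2 + 4 * (b - a) ^+ 2 / B ^+ 2 * (cnt - B) ^+ 2.
Proof.
move=> avb B0 c0; have /andP[av vb] := avb.
have B2 : 0 < B ^+ 2 by rewrite exprn_gt0.
have iB : 0 <= B ^- 2 by rewrite invr_ge0 ltW.
have c1 : 0 <= 4 / B ^+ 2 by rewrite mulr_ge0.
have c2 : 0 <= 4 * (b - a) ^+ 2 / B ^+ 2 by rewrite mulr_ge0// mulr_ge0// sqr_ge0.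
have [cB|cB] := leP (B / 2) cnt.
  have c0' : 0 < cnt by apply: lt_le_trans cB; rewrite divr_gt0.
  apply: (@le_trans _ _ (4 / B ^+ 2 * (num - v * cnt) ^+ 2)); last first.
    by rewrite lerDl mulr_ge0 ?sqr_ge0.
  apply: (@le_trans _ _ ((num / cnt - v) ^+ 2)).
    rewrite -[leLHS](real_normK (num_real _)) -[leRHS](real_normK (num_real _)).
    by rewrite lerXn2r ?nnegrE//; exact: clip_contract.
  have -> : num / cnt - v = (num - v * cnt) / cnt by field; rewrite gt_eqF.
  rewrite expr_div_n [leLHS]mulrC ler_wpM2r ?sqr_ge0//.
  have -> : 4 / B ^+ 2 = (B / 2) ^- 2 by field; rewrite gt_eqF.
  by rewrite lef_pV2 ?posrE ?exprn_gt0 ?divr_gt0// lerXn2r ?nnegrE// ltW// divr_gt0.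
apply: (@le_trans _ _ (4 * (b - a) ^+ 2 / B ^+ 2 * (cnt - B) ^+ 2)); last first.
  by rewrite lerDr mulr_ge0 ?sqr_ge0.
apply: (@le_trans _ _ ((b - a) ^+ 2)).
  have /andP[h1 h2] := clip_itv (num / cnt) (le_trans av vb).
  rewrite -[leLHS](real_normK (num_real _)) lerXn2r ?nnegrE// ?subr_ge0 ?(le_trans av vb)//.
  by rewrite ler_norml; apply/andP; split; lra.
have -> : 4 * (b - a) ^+ 2 / B ^+ 2 * (cnt - B) ^+ 2 = (b - a) ^+ 2 * (4 * (cnt - B) ^+ 2 / B ^+ 2) by ring.
rewrite ler_peMr ?sqr_ge0// ler_pdivlMr// mul1r.
have -> : 4 * (cnt - B) ^+ 2 = (2 * (B - cnt)) ^+ 2 by ring.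
by rewrite lerXn2r ?nnegrE ?(ltW B0)//; lra.
Qed.

End clipping.

Section estimator.
Variables (R : realType) (d M m : nat) (vm vp : R).
Local Notation X := 'rV[R]_d.
Local Notation Z := (X * R)%type.

Definition pair_count (w : (m + m).-tuple Z) : R :=
  \sum_(i < m) \sum_(j < m) same_cell M (tnth w (lshift m i)).1 (tnth w (rshift m j)).1.

Lemma pair_count_ge0 w : 0 <= pair_count w.
Proof. by apply: sumr_ge0 => i _; apply: sumr_ge0. Qed.

Definition pair_sum (w : (m + m).-tuple Z) : R :=
  \sum_(i < m) \sum_(j < m) same_cell M (tnth w (lshift m i)).1 (tnth w (rshift m j)).1 *
    (((tnth w (lshift m i)).2 - (tnth w (rshift m j)).2) ^+ 2 / 2).

Definition paired_estimator (w : (m + m).-tuple Z) : R :=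
  clip vm vp (pair_sum w / pair_count w).

Let mt1 i : measurable_fun setT (fun w : (m + m).-tuple Z => (tnth w i).1).
Proof. by apply: measurableT_comp; [exact: measurable_fst|exact: measurable_tnth]. Qed.
Let mt2 i : measurable_fun setT (fun w : (m + m).-tuple Z => (tnth w i).2).
Proof. by apply: measurableT_comp; [exact: measurable_snd|exact: measurable_tnth]. Qed.

Lemma measurable_paired_estimator : measurable_fun setT paired_estimator.
Proof.
apply: (measurableT_comp (measurable_clip vm vp)).
apply: measurable_funM.
  apply: measurable_sum => i; apply: measurable_sum => j; apply: measurable_funM.
    exact: measurable_same.
  by apply: measurable_funM => //; apply: measurable_funX; exact: measurable_funB.
(* the counts are nonnegative, so that inversion is a power function on them *)
apply: (eq_measurable_fun (fun w => pair_count w `^ (- 1))).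
  by move=> w _; rewrite powR_inv1// pair_count_ge0.
apply: (measurableT_comp (f := fun x : R => x `^ (- 1))); first exact: measurable_powR.
by apply: measurable_sum => i; apply: measurable_sum => j; exact: measurable_same.
Qed.

Local Open Scope ereal_scope.
Variable P : probability Z R.
Variables (F : X -> R) (V rho C4 kap : R).
Hypotheses (m0 : (0 < m)%N) (M0 : (0 < M)%N) (V0 : (0 <= V)%R) (rho0 : (0 <= rho)%R) (C40 : (0 <= C4)%R) (kap0 : (0 <= kap)%R)
  (Vv : (vm <= V <= vp)%R).
Local Notation J := (cell_index M (no_shift d)).
Hypotheses (mF : measurable_fun setT F)
  (osc : forall x y, J x = J y -> (`|F x - F y| <= rho)%R)
  (moment2 : forall phi t : X -> R, measurable_fun setT phi -> measurable_fun setT t ->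
     (forall x, 0 <= phi x)%R ->
     \int[P]_z (phi z.1 * (z.2 - F z.1 + t z.1) ^+ 2)%:E =
     \int[P]_z (phi z.1 * (V + t z.1 ^+ 2))%:E)
  (moment4 : forall phi : X -> R, measurable_fun setT phi -> (forall x, 0 <= phi x)%R ->
     \int[P]_z (phi z.1 * (z.2 - F z.1) ^+ 4)%:E <= \int[P]_z (phi z.1 * C4)%:E)
  (cellp : forall j, P [set z | J z.1 = j] <= kap%:E).
Local Notation mu := (match_prob M P).
Local Notation dev := (pair_dev M F V).
Local Notation cnt := (pair_cnt M P).

Let mu_gt0 : (0 < mu)%R.
Proof.
have := match_prob_lower M P; rewrite ltNge; apply: contraL => mu0.
by rewrite -ltNge; apply: (@le_lt_trans _ _ 0%R) => //; rewrite mulr_ge0_le0.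
Qed.

(** The bound on the squared error is quadratic in the sum of [pair_dev] and in
    the sum of [pair_cnt], and both are covered by [two_sample_second_moment]. *)
Lemma paired_risk :
  \int[powm P (m + m)]_w ((paired_estimator w - V) ^+ 2)%:E <=
  (4 * (3 * (2 * fourth_bound rho C4 + V ^+ 2) / (m%:R ^+ 2 * mu) +
        2 * (3 * (fourth_bound rho C4 + 4 * V ^+ 2 + rho ^+ 4)) * kap / (m%:R * mu) + rho ^+ 4 / 4)
   + 4 * (vp - vm) ^+ 2 * (4 / (m%:R ^+ 2 * mu) + 8 * kap / (m%:R * mu)))%:E.
Proof.
have m0' : (0 < m%:R :> R)%R by rewrite ltr0n.
pose B := (m%:R ^+ 2 * mu)%R.
have B0 : (0 < B)%R by rewrite mulr_gt0// exprn_gt0.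
have B2 : (0 <= 4 / B ^+ 2)%R by rewrite divr_ge0// sqr_ge0.
have D2 : (0 <= 4 * (vp - vm) ^+ 2 / B ^+ 2)%R by rewrite divr_ge0 ?sqr_ge0// mulr_ge0// sqr_ge0.
pose T g (p : m.-tuple Z * m.-tuple Z) : R := ((\sum_(i < m) \sum_(j < m) g (tnth p.1 i) (tnth p.2 j)) ^+ 2)%R.
have mT g : measurable_fun setT (fun p : Z * Z => g p.1 p.2 : R) -> measurable_fun setT (EFin \o T g).
  move=> mg; apply/measurable_EFinP; apply: measurable_funX; apply: measurable_sum => i; apply: measurable_sum => j.
  apply: (measurableT_comp mg (g := fun p : m.-tuple Z * m.-tuple Z => (tnth p.1 i, tnth p.2 j))).
  apply/measurable_fun_pair => /=.
    by apply: (measurableT_comp (measurable_tnth i)); exact: measurable_fst.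
  by apply: (measurableT_comp (measurable_tnth j)); exact: measurable_snd.
have T0 g p : (0 <= T g p)%R by exact: sqr_ge0.
have mdev := mT _ (measurable_pair_dev M F V).
have mcnt := mT _ (measurable_pair_cnt M P).
have mest : measurable_fun setT (fun w => ((paired_estimator w - V) ^+ 2)%:E).
  apply/measurable_EFinP; apply: measurable_funX; apply: measurable_funB => //.
  exact: measurable_paired_estimator.
have mestc : measurable_fun setT (fun p : m.-tuple Z * m.-tuple Z =>
    ((paired_estimator [tuple of p.1 ++ p.2] - V) ^+ 2)%:E).
  exact: (measurableT_comp mest (@measurable_cat_tuple _ _ m m)).
rewrite ge0_integral_powm_cat//; last by move=> w; rewrite lee_fin sqr_ge0.
have mint (G : m.-tuple Z * m.-tuple Z -> \bar R) : measurable_fun setT G -> (forall p, 0 <= G p) ->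
   measurable_fun setT (fun s => \int[powm P m]_u G (s, u)).
  by move=> mG G0; exact: (@measurable_fun_fubini_tonelli_F _ _ _ _ _ (powm P m) G).
have mfib (G : m.-tuple Z * m.-tuple Z -> \bar R) s : measurable_fun setT G -> measurable_fun setT (fun u => G (s, u)).
  by move=> mG; apply: measurableT_comp => //; exact: pair1_measurable.
apply: (@le_trans _ _ ((4 / B ^+ 2)%:E * \int[powm P m]_s \int[powm P m]_u (T dev (s, u))%:E +
   (4 * (vp - vm) ^+ 2 / B ^+ 2)%:E * \int[powm P m]_s \int[powm P m]_u (T cnt (s, u))%:E)).
  have i0 g s : 0 <= \int[powm P m]_u (T g (s, u))%:E by apply: integral_ge0 => u _; rewrite lee_fin.
  have iT g : measurable_fun setT (EFin \o T g) -> measurable_fun setT (fun s => \int[powm P m]_u (T g (s, u))%:E).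
    by move=> mg; apply: (mint (EFin \o T g)) => // p; rewrite lee_fin.
  rewrite -!ge0_integralZl ?lee_fin//; last 2 first.
  - exact: iT.
  - exact: iT.
  rewrite -ge0_integralD//; last 4 first.
  - by move=> s _; rewrite mule_ge0.
  - by apply: measurable_funeM; exact: iT.
  - by move=> s _; rewrite mule_ge0.
  - by apply: measurable_funeM; exact: iT.
  apply: ge0_le_integral => //.
  - by move=> s _; apply: integral_ge0 => u _; rewrite lee_fin sqr_ge0.
  - apply: (mint (fun p => ((paired_estimator [tuple of p.1 ++ p.2] - V) ^+ 2)%:E)).
      exact: mestc.
    by move=> p; rewrite lee_fin sqr_ge0.
  - by apply: emeasurable_funD; apply: measurable_funeM; exact: iT.
  move=> s _; rewrite -!ge0_integralZl ?lee_fin//; last 4 first.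
  - exact: (mfib (EFin \o T cnt)).
  - by move=> u _; rewrite lee_fin.
  - exact: (mfib (EFin \o T dev)).
  - by move=> u _; rewrite lee_fin.
  rewrite -ge0_integralD//; last 4 first.
  - by move=> u _; rewrite -EFinM lee_fin mulr_ge0.
  - by apply: measurable_funeM; exact: (mfib (EFin \o T dev)).
  - by move=> u _; rewrite -EFinM lee_fin mulr_ge0.
  - by apply: measurable_funeM; exact: (mfib (EFin \o T cnt)).
  apply: ge0_le_integral => //.
  - by move=> u _; rewrite lee_fin sqr_ge0.
  - apply: (mfib (fun p => ((paired_estimator [tuple of p.1 ++ p.2] - V) ^+ 2)%:E)).
    exact: mestc.
  - by apply: emeasurable_funD; apply: measurable_funeM; [exact: (mfib (EFin \o T dev))|exact: (mfib (EFin \o T cnt))].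
  move=> u _; rewrite -!EFinM -EFinD lee_fin; set w := [tuple of s ++ u].
  have wl i : tnth w (lshift m i) = tnth s i by rewrite tnth_lshift.
  have wr i : tnth w (rshift m i) = tnth u i by rewrite tnth_rshift.
  have c0 := pair_count_ge0 w.
  apply: (le_trans (clip_ratio_bound (pair_sum w) Vv B0 c0)).
  rewrite le_eqVlt; apply/orP; left; apply/eqP; congr (_ * _ ^+ 2 + _ * _ ^+ 2)%R.
    rewrite /pair_sum /pair_count mulr_sumr -sumrB; apply: eq_bigr => i _.
    rewrite mulr_sumr -sumrB; apply: eq_bigr => j _.
    rewrite wl wr /pair_dev /same_cell; case: eqP => Jij; last by rewrite !mul0r mulr0 subr0.
    by rewrite !mul1r mulr1 (residual_same F Jij).
  rewrite /pair_count /B.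
  have -> : (m%:R ^+ 2 * mu = \sum_(i < m) \sum_(j < m) mu)%R.
    by rewrite !sumr_const !card_ord -mulrnA -[RHS]mulr_natl natrM.
  rewrite -sumrB; apply: eq_bigr => i _; rewrite -sumrB; apply: eq_bigr => j _.
  by rewrite wl wr.
have hd := two_sample_second_moment (measurable_pair_dev M F V) (pair_dev_sym M F V)
  (fun z => sqint_pair_dev M0 V0 rho0 C40 mF osc moment4 z)
  (sqint_mean_pair_dev M0 V0 rho0 C40 kap0 mF osc moment2 moment4 cellp) m.
have hc := two_sample_second_moment (measurable_pair_cnt M P) (pair_cnt_sym M P)
  (fun z => sqint_pair_cnt M P z) (sqint_mean_pair_cnt kap0 cellp) m.
rewrite (mean_mean_pair_cnt kap0 cellp) expr0n mulr0 adde0 in hc.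
have a1 := integral_pair_dev_sqr M0 V0 rho0 C40 mF osc moment4.
have a2 := integral_mean_pair_dev_sqr M0 V0 rho0 C40 kap0 mF osc moment2 moment4 cellp.
have a3 := mean_pair_dev_bias M0 V0 rho0 C40 kap0 mF osc moment2 moment4 cellp.
have a4 := integral_pair_cnt_sqr M P.
have a5 := integral_mean_pair_cnt_sqr kap0 cellp.
have m2 : (0 <= m%:R ^+ 2 :> R)%R by exact: sqr_ge0.
have m3 : (0 <= 2 * m%:R ^+ 3 :> R)%R by rewrite mulr_ge0// exprn_ge0.
have a3' : (m%:R ^+ 4 * expect P (fun z => expect P (dev z)) ^+ 2 <= m%:R ^+ 4 * (rho ^+ 2 / 2 * mu) ^+ 2)%R.
  rewrite ler_wpM2l ?exprn_ge0// -(real_normK (num_real (expect P (fun z => expect P (dev z))))).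
  by rewrite lerXn2r ?nnegrE// mulr_ge0 ?(ltW mu_gt0)// divr_ge0 ?sqr_ge0.
have a3'' := a3'; rewrite -lee_fin in a3''.
have {}hd := le_trans hd (leeD (leeD (lee_wpmul2l (_ : 0 <= (m%:R ^+ 2)%:E) a1) (lee_wpmul2l (_ : 0 <= (2 * m%:R ^+ 3)%:E) a2)) a3'').
have {}hc := le_trans hc (leeD (lee_wpmul2l (_ : 0 <= (m%:R ^+ 2)%:E) a4) (lee_wpmul2l (_ : 0 <= (2 * m%:R ^+ 3)%:E) a5)).
apply: (le_trans (leeD (lee_wpmul2l _ (hd _ _)) (lee_wpmul2l _ (hc _ _)))); rewrite ?lee_fin//.
rewrite le_eqVlt; apply/orP; left; apply/eqP.
by rewrite /B; field; rewrite !gt_eqF.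
Qed.

End estimator.

(** * The rate *)

Section rate.
Variables (R : realType) (s : R) (d n M : nat).
Hypotheses (s0 : 0 < s) (n1 : (1 < n)%N) (M0 : (0 < M)%N)
  (Mn : n%:R ^+ 2 <= M%:R ^+ d * M%:R `^ (4 * s) :> R)
  (Mle : M%:R <= 2 * n%:R `^ (2 / (d%:R + 4 * s)) :> R).
Local Notation rate := (minimax_rate s d n).
Local Notation w := (n%:R `^ (- (4 * s / (d%:R + 4 * s)))).

Let n0 : 0 < n%:R :> R. Proof. by rewrite ltr0n ltnW. Qed.
Let M0' : 0 < M%:R :> R. Proof. by rewrite ltr0n. Qed.
Let ds : 0 < d%:R + 4 * s. Proof. by rewrite ltr_wpDl// mulr_gt0. Qed.

Lemma minimax_rate_gt0 : 0 < rate.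
Proof. by rewrite /minimax_rate lt_max powR_gt0. Qed.

Lemma inv_n_le_rate : n%:R^-1 <= rate ^+ 2.
Proof.
have -> : n%:R^-1 = (n%:R `^ (- 2^-1)) ^+ 2 :> R.
  by rewrite -powR_mulrn ?powR_ge0// -powRrM mulNr mulVf// powR_inv1// ltW.
rewrite lerXn2r ?nnegrE ?powR_ge0// ?(ltW minimax_rate_gt0)//.
by rewrite /minimax_rate le_max lexx.
Qed.

Lemma w_le_rate : w ^+ 2 <= rate ^+ 2.
Proof.
rewrite lerXn2r ?nnegrE ?powR_ge0 ?(ltW minimax_rate_gt0)//.
by rewrite /minimax_rate le_max lexx orbT.
Qed.

(** The upper bound on M controls the variance; the lower one controls the bias,
    in [oscillation_le_rate]. *)
Lemma cells_le_rate : M%:R ^+ d / n%:R ^+ 2 <= 2 ^+ d * rate ^+ 2.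
Proof.
apply: (@le_trans _ _ (2 ^+ d * w ^+ 2)); last by rewrite ler_wpM2l ?exprn_ge0 ?w_le_rate.
rewrite ler_pdivrMr ?exprn_gt0//.
apply: (@le_trans _ _ ((2 * n%:R `^ (2 / (d%:R + 4 * s))) ^+ d)).
  by rewrite lerXn2r ?nnegrE ?mulr_ge0 ?powR_ge0// ltW.
rewrite exprMn -[leRHS]mulrA ler_wpM2l ?exprn_ge0//.
rewrite -!powR_mulrn ?powR_ge0 ?(ltW n0)// -!powRrM -powRD; last by rewrite (gt_eqF n0) implybT.
rewrite le_eqVlt; apply/orP; left; apply/eqP; congr (_ `^ _).
by field; rewrite gt_eqF.
Qed.

Lemma half_sample : n%:R <= 3 * n./2%:R :> R.
Proof.
rewrite -natrM ler_nat -{1}(odd_double_half n).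
have : (0 < n./2)%N by rewrite half_gt0.
by case: (odd n); lia.
Qed.

Let m0 : 0 < n./2%:R :> R. Proof. by rewrite ltr0n half_gt0. Qed.

Lemma inv_half_le_rate : n./2%:R^-1 <= 3 * rate ^+ 2.
Proof.
apply: (@le_trans _ _ (3 * n%:R^-1)); last by rewrite ler_wpM2l// inv_n_le_rate.
by rewrite -div1r ler_pdivrMr// mulrAC ler_pdivlMr// mul1r half_sample.
Qed.

Lemma pairs_le_rate : (2 * M%:R) ^+ d / n./2%:R ^+ 2 <= 9 * 4 ^+ d * rate ^+ 2.
Proof.
apply: (@le_trans _ _ (9 * 2 ^+ d * (M%:R ^+ d / n%:R ^+ 2))).
  rewrite exprMn ler_pdivrMr ?exprn_gt0//.
  have -> : 9 * 2 ^+ d * (M%:R ^+ d / n%:R ^+ 2) * n./2%:R ^+ 2 =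
     2 ^+ d * M%:R ^+ d * ((3 * n./2%:R) ^+ 2 / n%:R ^+ 2) :> R by ring.
  rewrite ler_peMr ?mulr_ge0 ?exprn_ge0//.
  rewrite ler_pdivlMr ?exprn_gt0// mul1r lerXn2r ?nnegrE ?mulr_ge0 ?(ltW n0)//.
  exact: half_sample.
have -> : 9 * 4 ^+ d * rate ^+ 2 = 9 * 2 ^+ d * (2 ^+ d * rate ^+ 2).
  have -> : 4 ^+ d = 2 ^+ d * 2 ^+ d :> R by rewrite -exprMn; congr (_ ^+ _); ring.
  by ring.
by rewrite ler_wpM2l ?mulr_ge0 ?exprn_ge0// cells_le_rate.
Qed.

Lemma oscillation_le_rate : ((d%:R / M%:R) `^ s) ^+ 4 <= (d%:R `^ s) ^+ 4 * 2 ^+ d * rate ^+ 2.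
Proof.
rewrite powRM ?invr_ge0// exprMn -mulrA ler_wpM2l ?exprn_ge0 ?powR_ge0//.
apply: le_trans cells_le_rate.
have -> : (M%:R^-1 `^ s) ^+ 4 = (M%:R `^ (4 * s))^-1.
  rewrite -(powR_inv1 (ltW M0')) -powRrM -powR_mulrn ?powR_ge0// -powRrM -powRN.
  by congr (_ `^ _); ring.
rewrite -div1r ler_pdivrMr ?powR_gt0// mulrAC ler_pdivlMr ?exprn_gt0// mul1r.
exact: Mn.
Qed.

End rate.

Section upper_bound.
Variables (R : realType) (s : R) (d : nat) (U : set 'rV[R]_d) (pm pp Ls vm vp C4 : R).
Hypotheses (s0 : 0 < s) (s1 : s <= 1) (hU : unit_cube R d `<=` U)
  (pp0 : 0 < pp) (Ls0 : 0 < Ls) (vm0 : 0 < vm) (vmp : vm < vp) (C40 : 0 <= C4).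
Local Notation Z := ('rV[R]_d * R)%type.

Let rmax := Ls * d%:R `^ s.
Let A := 3 * (2 * fourth_bound rmax C4 + vp ^+ 2).
Let B := 3 * (fourth_bound rmax C4 + 4 * vp ^+ 2 + rmax ^+ 4).
Let D := vp - vm.
Let Cq := 4 * (A * (9 * 4 ^+ d) + 2 * B * (pp * 2 ^+ d * 3) + rmax ^+ 4 * 2 ^+ d / 4) +
  4 * D ^+ 2 * (4 * (9 * 4 ^+ d) + 8 * (pp * 2 ^+ d * 3)).

Let rmax0 : 0 <= rmax. Proof. by rewrite mulr_ge0 ?powR_ge0// ltW. Qed.

Lemma fourth_bound_mono (r1 r2 : R) : 0 <= r1 -> r1 <= r2 -> fourth_bound r1 C4 <= fourth_bound r2 C4.
Proof.
move=> r10 r12; rewrite /fourth_bound ler_wpM2l// lerD2l lerXn2r ?nnegrE//.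
exact: le_trans r12.
Qed.

Lemma double_half_le n : (n./2 + n./2 <= n)%N.
Proof. by rewrite addnn -{2}(odd_double_half n) leq_addl. Qed.

Definition split_index n : 'I_(n./2 + n./2) -> 'I_n := widen_ord (double_half_le n).

Definition estimator M n (t : n.-tuple Z) : R :=
  @paired_estimator R d M n./2 vm vp [tuple tnth t (split_index i) | i < n./2 + n./2].

Lemma measurable_estimator M n : measurable_fun setT (@estimator M n).
Proof.
apply: measurableT_comp; first exact: measurable_paired_estimator.
apply/measurable_fun_tnthP => i /=.
apply: (eq_measurable_fun (fun t : n.-tuple Z => tnth t (split_index i))).
  by move=> t _; rewrite /= tnth_mktuple.
exact: measurable_tnth.
Qed.

Lemma risk_arith (V rho x y w : R) : 0 < V -> V <= vp -> 0 <= rho -> rho <= rmax ->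
  0 <= x -> 0 <= y -> 0 <= w ->
  x <= 9 * 4 ^+ d * w -> y <= pp * 2 ^+ d * 3 * w -> rho ^+ 4 <= rmax ^+ 4 * 2 ^+ d * w ->
  4 * (3 * (2 * fourth_bound rho C4 + V ^+ 2) * x + 2 * (3 * (fourth_bound rho C4 + 4 * V ^+ 2 + rho ^+ 4)) * y + rho ^+ 4 / 4)
   + 4 * D ^+ 2 * (4 * x + 8 * y) <= Cq * w.
Proof.
move=> V0 Vp rho0 rr x0 y0 w0 xw yw rw.
have kk := fourth_bound_mono rho0 rr.
have k0 : 0 <= fourth_bound rho C4 by apply: fourth_bound_ge0.
have VV : V ^+ 2 <= vp ^+ 2 by rewrite lerXn2r ?nnegrE ?(le_trans (ltW V0)) ?(ltW V0).
have r4 : rho ^+ 4 <= rmax ^+ 4 by rewrite lerXn2r ?nnegrE.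
have AA : 3 * (2 * fourth_bound rho C4 + V ^+ 2) <= A by rewrite /A; lra.
have BB : 2 * (3 * (fourth_bound rho C4 + 4 * V ^+ 2 + rho ^+ 4)) <= 2 * B by rewrite /B; lra.
have A0 : 0 <= 3 * (2 * fourth_bound rho C4 + V ^+ 2).
  by rewrite mulr_ge0// addr_ge0 ?sqr_ge0// mulr_ge0.
have B0 : 0 <= 2 * (3 * (fourth_bound rho C4 + 4 * V ^+ 2 + rho ^+ 4)).
  by rewrite !mulr_ge0// addr_ge0 ?exprn_ge0// addr_ge0// mulr_ge0// sqr_ge0.
have h1 := ler_pM A0 x0 AA xw; have h2 := ler_pM B0 y0 BB yw.
have D0 : 0 <= 4 * D ^+ 2 by rewrite mulr_ge0// sqr_ge0.
have h3 : 4 * D ^+ 2 * (4 * x + 8 * y) <= 4 * D ^+ 2 * (4 * (9 * 4 ^+ d * w) + 8 * (pp * 2 ^+ d * 3 * w)).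
  by rewrite ler_wpM2l//; lra.
have -> : Cq * w = 4 * (A * (9 * 4 ^+ d * w) + 2 * B * (pp * 2 ^+ d * 3 * w) + rmax ^+ 4 * 2 ^+ d * w / 4) +
  4 * D ^+ 2 * (4 * (9 * 4 ^+ d * w) + 8 * (pp * 2 ^+ d * 3 * w)) by rewrite /Cq; ring.
by apply: lerD => //; rewrite ler_wpM2l// lerD// ?lerD// ler_wpM2r.
Qed.

Lemma estimator_risk n M theta (P : probability Z R) : (1 < n)%N -> (0 < M)%N ->
  n%:R ^+ 2 <= M%:R ^+ d * M%:R `^ (4 * s) :> R ->
  M%:R <= 2 * n%:R `^ (2 / (d%:R + 4 * s)) :> R ->
  Theta s U pm pp Ls vm vp C4 theta -> is_law theta P ->
  (rms_risk P (@estimator M n) (variance_level theta) <=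
     (Num.sqrt Cq * minimax_rate s d n)%:E)%E.
Proof.
move=> n1 M0 Mn Mle inT lawP.
have M0' : 0 < M%:R :> R by rewrite ltr0n.
set V := variance_level theta; set rate := minimax_rate s d n.
have [_ _ _ Vv] := inT; have /andP[vV Vp] := Vv.
have V0 : 0 < V by apply: lt_le_trans vV.
pose rho := Ls * (d%:R / M%:R) `^ s; pose kap := pp * (M%:R^-1) ^+ d.
have rho0 : 0 <= rho by rewrite mulr_ge0 ?powR_ge0// ltW.
have kap0 : 0 <= kap by rewrite mulr_ge0 ?(ltW pp0)// exprn_ge0// invr_ge0.
have m0 : (0 < n./2)%N by rewrite half_gt0.
have rate0 : 0 < rate by exact: minimax_rate_gt0.
have mF := measurable_regression_ext s0 s1 hU inT.
have osc := fun x y => @regression_ext_osc R d s U pm pp Ls vm vp C4 theta s0 s1 hU Ls0 inT M x y M0.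
have mom2 := conditional_second_moment s0 s1 hU vm0 lawP inT.
have mom4 := conditional_fourth_moment s0 s1 hU C40 lawP inT.
have cellp := fun j => cell_probability s0 s1 hU pp0 lawP inT (no_shift d) j M0.
have pr := paired_risk m0 M0 (ltW V0) rho0 C40 kap0 Vv mF osc mom2 mom4 cellp.
rewrite rms_riskE; apply: root_le.
- by rewrite mulr_ge0 ?sqrtr_ge0// ltW.
- by apply: integral_ge0 => z _; rewrite lee_fin sqr_ge0.
have -> : (\int[iid P n]_t ((@estimator M n t - V) ^+ 2)%:E =
    \int[powm P (n./2 + n./2)]_w ((@paired_estimator R d M n./2 vm vp w - V) ^+ 2)%:E)%E.
  rewrite -(ge0_integral_powm_widen P (double_half_le n)
    (G := fun w => ((@paired_estimator R d M n./2 vm vp w - V) ^+ 2)%:E))//.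
  - apply/measurable_EFinP; apply: measurable_funX; apply: measurable_funB => //.
    exact: measurable_paired_estimator.
  - by move=> w; rewrite lee_fin sqr_ge0.
apply: (le_trans pr); rewrite lee_fin [leRHS]exprMn.
set mu := match_prob M P.
have two0 : 0 < (2 * M%:R) ^+ d :> R by rewrite exprn_gt0// mulr_gt0.
have mu_low : 1 <= (2 * M%:R) ^+ d * mu.
  apply: (le_trans (match_prob_lower M P)); rewrite ler_wpM2r ?match_prob_ge0//.
  rewrite card_ffun !card_ord natrX lerXn2r ?nnegrE ?mulr_ge0//.
  by rewrite -natrM ler_nat mul2n -addnn -add1n leq_add2r.
have mu0 : 0 < mu by rewrite -(pmulr_rgt0 _ two0); apply: lt_le_trans mu_low.
have imu : mu^-1 <= (2 * M%:R) ^+ d by rewrite -div1r ler_pdivrMr.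
have mm0 : 0 < n./2%:R :> R by rewrite ltr0n.
pose x := (n./2%:R ^+ 2 * mu)^-1; pose y := kap / (n./2%:R * mu).
have x0 : 0 <= x by rewrite invr_ge0 mulr_ge0 ?sqr_ge0// ltW.
have y0 : 0 <= y by rewrite divr_ge0// mulr_ge0// ltW.
have xw : x <= 9 * 4 ^+ d * rate ^+ 2.
  have hp := pairs_le_rate s0 n1 M0 Mn Mle.
  apply: le_trans hp.
  by rewrite /x invfM mulrC ler_wpM2r// invr_ge0 sqr_ge0.
have yw : y <= pp * 2 ^+ d * 3 * rate ^+ 2.
  have -> : y = kap * mu^-1 * n./2%:R^-1 by rewrite /y invfM; ring.
  rewrite -[leRHS]mulrA; apply: ler_pM.
  - by rewrite mulr_ge0// invr_ge0 ltW.
  - by rewrite invr_ge0 ltW.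
  - apply: (@le_trans _ _ (kap * (2 * M%:R) ^+ d)); first by rewrite ler_wpM2l.
    rewrite /kap -mulrA ler_wpM2l ?(ltW pp0)// -exprMn mulrCA mulVf ?mulr1// gt_eqF//.
  - exact: (inv_half_le_rate s0 n1 M0 Mn Mle).
have rw : rho ^+ 4 <= rmax ^+ 4 * 2 ^+ d * rate ^+ 2.
  have h := oscillation_le_rate s0 n1 M0 Mn Mle.
  apply: (@le_trans _ _ (Ls ^+ 4 * ((d%:R `^ s) ^+ 4 * 2 ^+ d * rate ^+ 2))).
    by rewrite /rho exprMn ler_wpM2l ?exprn_ge0 ?(ltW Ls0).
  by rewrite /rmax exprMn !mulrA.
have rr : rho <= rmax.
  rewrite /rho /rmax ler_wpM2l ?(ltW Ls0)// ge0_ler_powR ?nnegrE ?(ltW s0) ?divr_ge0//.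
  by rewrite ler_pdivrMr// ler_peMr// ler1n.
have fin := risk_arith V0 Vp rho0 rr x0 y0 (sqr_ge0 _) xw yw rw.
have Cq0 : 0 <= Cq.
  have A0 : 0 <= A by rewrite mulr_ge0// addr_ge0 ?sqr_ge0// mulr_ge0// fourth_bound_ge0.
  have B0 : 0 <= B.
    by rewrite mulr_ge0// addr_ge0 ?exprn_ge0// addr_ge0 ?fourth_bound_ge0// mulr_ge0// sqr_ge0.
  have ppd : 0 <= pp * 2 ^+ d * 3 by rewrite mulr_ge0// mulr_ge0 ?exprn_ge0// ltW.
  have fd : 0 <= 9 * 4 ^+ d :> R by rewrite mulr_ge0// exprn_ge0.
  have rd : 0 <= rmax ^+ 4 * 2 ^+ d / 4 by rewrite divr_ge0// mulr_ge0 ?exprn_ge0.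
  rewrite /Cq; apply: addr_ge0; apply: mulr_ge0 => //.
  - by rewrite addr_ge0// addr_ge0// mulr_ge0// mulr_ge0.
  - by rewrite mulr_ge0// sqr_ge0.
  - by rewrite addr_ge0// mulr_ge0.
rewrite sqr_sqrtr//; apply: le_trans fin; rewrite -/V -/mu le_eqVlt; apply/orP; left; apply/eqP.
by rewrite /x /y /D !mulrA.
Qed.

(** Covers n = 1, where each half of the sample is empty. *)
Lemma clipped_risk n theta (P : probability Z R) (Vh : n.-tuple Z -> R) :
  measurable_fun setT Vh -> (forall t, vm <= Vh t <= vp) ->
  Theta s U pm pp Ls vm vp C4 theta ->
  (rms_risk P Vh (variance_level theta) <= (vp - vm)%:E)%E.
Proof.
move=> mV Vh_itv [_ _ _ /andP[v1 v2]]; rewrite rms_riskE; apply: root_le.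
- by rewrite subr_ge0 ltW.
- by apply: integral_ge0 => z _; rewrite lee_fin sqr_ge0.
rewrite -[leRHS](integral_probability_cst (iid P n)); apply: ge0_le_integral => //.
- by move=> t _; rewrite lee_fin sqr_ge0.
- by apply/measurable_EFinP; apply: measurable_funX; exact: measurable_funB.
- move=> t _; rewrite lee_fin -[leLHS](real_normK (num_real _)).
  have /andP[u1 u2] := Vh_itv t.
  rewrite lerXn2r ?nnegrE ?subr_ge0 ?(ltW vmp)//.
  by rewrite ler_norml; apply/andP; split; lra.
Qed.

Lemma upper_bound : exists2 C : R, 0 < C & forall n, (0 < n)%N ->
  (minimax_risk s U pm pp Ls vm vp C4 n <= (C * minimax_rate s d n)%:E)%E.
Proof.
exists (Num.sqrt Cq + (vp - vm)).
  by rewrite ltr_wpDl ?sqrtr_ge0// subr_gt0.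
move=> n n0; have [M [M0 Mn Mle]] := @choose_resolution R s d n s0 n0.
have rate0 : 0 < minimax_rate s d n by rewrite /minimax_rate lt_max powR_gt0// ltr0n.
have sup_bound (Vh : n.-tuple Z -> R) c : 0 <= c -> measurable_fun setT Vh ->
   (forall theta (P : probability Z R), Theta s U pm pp Ls vm vp C4 theta -> is_law theta P ->
      (rms_risk P Vh (variance_level theta) <= c%:E)%E) ->
   c <= (Num.sqrt Cq + (vp - vm)) * minimax_rate s d n ->
   (minimax_risk s U pm pp Ls vm vp C4 n <= ((Num.sqrt Cq + (vp - vm)) * minimax_rate s d n)%:E)%E.
  move=> c0 mV risk cle; apply: ge_ereal_inf; eexists; first by exists Vh.
  apply: ge_ereal_sup => _ [theta [P [inT lawP ->]]].
  by apply: (le_trans (risk _ _ inT lawP)); rewrite lee_fin.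
have vpm : 0 <= vp - vm by rewrite subr_ge0 ltW.
have est_itv t : vm <= @estimator M n t <= vp by apply: clip_itv; exact: ltW.
have [n1|n1] := leqP n 1.
  refine (sup_bound (@estimator M n) (vp - vm) vpm (@measurable_estimator M n) _ _).
    by move=> theta P inT _; apply: clipped_risk => //; exact: measurable_estimator.
  have -> : n = 1%N by apply/eqP; rewrite eqn_leq n1 n0.
  by rewrite /minimax_rate !powR1 maxxx mulr1 lerDr sqrtr_ge0.
apply: (sup_bound (@estimator M n) (Num.sqrt Cq * minimax_rate s d n) _ (@measurable_estimator M n)).
- by rewrite mulr_ge0 ?sqrtr_ge0// ltW.
- by move=> theta P inT lawP; exact: estimator_risk.
- by rewrite ler_wpM2r ?(ltW rate0)// lerDl.
Qed.

End upper_bound.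

(** If no parameter is admissible the supremum is -oo, and the assumption holds
    vacuously for every rho, which is absurd. *)
Lemma minimax_lower (R : realType) (s : R) (d : nat) (U : set 'rV[R]_d)
    (pm pp Ls vm vp C4 c : R) (n : nat) :
  (forall (Vh : n.-tuple ('rV[R]_d * R)%type -> R) (rho : R), measurable_fun setT Vh ->
     (forall theta P, Theta s U pm pp Ls vm vp C4 theta -> is_law theta P ->
       (rms_risk P Vh (variance_level theta) <= rho%:E)%E) -> c <= rho) ->
  (c%:E <= minimax_risk s U pm pp Ls vm vp C4 n)%E.
Proof.
move=> lower; apply/ereal_infP => _ [Vh mV ->].
set S := [set q | _]; have ubS q : S q -> (q <= ereal_sup S)%E by exact: ereal_sup_ubound.
have ub theta (P : probability ('rV[R]_d * R)%type R) :
    Theta s U pm pp Ls vm vp C4 theta -> is_law theta P ->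
    (rms_risk P Vh (variance_level theta) <= ereal_sup S)%E.
  by move=> inT lawP; apply: ubS; exists theta, P.
case E : (ereal_sup S) => [rho||].
- by rewrite lee_fin; apply: (lower Vh rho mV) => theta P inT lawP; rewrite -E; exact: ub.
- exact: leey.
- have : c <= c - 1; last by move=> h; exfalso; move: h; rewrite leNgt gtrDl oppr_lt0 ltr01.
  apply: (lower Vh _ mV) => theta P inT lawP.
  by apply: (le_trans (ub theta P inT lawP)); rewrite E leNye.
Qed.

Theorem theorem1p3 (R : realType) (s : R) (d : nat) (U : set 'rV[R]_d)
    (pm pp Ls vm vp C4 : R)
    (hs0 : 0 < s) (hs1 : s <= 1) (hd : (1 <= d)%N)
    (hUo : open U) (hU : unit_cube R d `<=` U)
    (hpm0 : 0 < pm) (hpm1 : pm < 1) (hpp : 1 < pp)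
    (hLs : 0 < Ls) (hvm : 0 < vm) (hv : vm < vp) (hC4 : vm ^+ 2 < C4) :
  exists2 C : R, 0 < C & forall n : nat, (1 <= n)%N ->
    ((C^-1 * minimax_rate s d n)%:E <= minimax_risk s U pm pp Ls vm vp C4 n)%E /\
    (minimax_risk s U pm pp Ls vm vp C4 n <= (C * minimax_rate s d n)%:E)%E.
Proof.
have C40 : 0 < C4 by apply: lt_trans hC4; rewrite exprn_gt0.
have vp0 : 0 < vp by exact: lt_trans hv.
(* b lies halfway between a and the largest admissible atom b1; the noise is
     the response minus the regression function, of modulus at most
     b + zeta = b1 *)
pose a := Num.sqrt vm; pose b1 := Num.min (Num.sqrt vp) (Num.sqrt (Num.sqrt C4)).
have a0 : 0 < a by rewrite sqrtr_gt0.
have a2 : a ^+ 2 = vm by rewrite sqr_sqrtr// ltW.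
have b10 : 0 <= b1 by rewrite le_min !sqrtr_ge0.
have b12 : b1 ^+ 2 <= vp.
  rewrite -[leRHS](sqr_sqrtr (ltW vp0)) lerXn2r ?nnegrE ?sqrtr_ge0//.
  by rewrite ge_min lexx.
have b14 : b1 ^+ 4 <= C4.
  have -> : C4 = Num.sqrt (Num.sqrt C4) ^+ 4.
    by rewrite (exprM _ 2 2) !sqr_sqrtr ?sqrtr_ge0// ltW.
  by rewrite lerXn2r ?nnegrE ?sqrtr_ge0// ge_min lexx orbT.
have ab1 : a < b1.
  rewrite lt_min !ltr_sqrt ?sqrtr_gt0// hv/=.
  by rewrite -(@ltr_pXn2r _ 2) ?nnegrE ?sqrtr_ge0 ?(ltW hvm)// sqr_sqrtr// ltW.
pose b := (a + b1) / 2; pose zeta := (b1 - a) / 2.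
have ab : a < b by rewrite /b; lra.
have bb1 : b <= b1 by rewrite /b; lra.
have b0 : 0 <= b by rewrite (le_trans (ltW a0))// ltW.
have zeta0 : 0 < zeta by rewrite /zeta; lra.
have bz : b + zeta = b1 by rewrite /b /zeta; field.
have va : vm <= a ^+ 2 by rewrite a2.
have vb : b ^+ 2 <= vp by apply: le_trans b12; rewrite lerXn2r ?nnegrE.
have bC : b ^+ 4 <= C4 by apply: le_trans b14; rewrite lerXn2r ?nnegrE.
have bzC : (b + zeta) ^+ 4 <= C4 by rewrite bz.
have [c1 c10 low1] := nonparametric_lower_bound a0 ab U hs0 hs1 hpm1 hpp hLs va vb zeta0 bzC.
have low2 := fun n Vh rho => @parametric_lower_bound R d a b a0 ab s U pm pp Ls vm vp C4 n Vh rho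
  hs0 hs1 hpm1 hpp hLs va vb bC.
have [Cu Cu0 up] := @upper_bound R s d U pm pp Ls vm vp C4 hs0 hs1 hU (lt_trans ltr01 hpp) hLs hvm hv (ltW C40).
have g0 : 0 < gap a b / 32 by rewrite divr_gt0// gap_gt0.
pose c := Num.min c1 (gap a b / 32).
have c0 : 0 < c by rewrite lt_min c10 g0.
exists (Num.max Cu c^-1); first by rewrite lt_max Cu0.
move=> n n0; have rate0 : 0 < minimax_rate s d n by rewrite /minimax_rate lt_max powR_gt0// ltr0n.
split; last first.
  by apply: (le_trans (up n n0)); rewrite lee_fin ler_wpM2r ?(ltW rate0)// le_max lexx.
apply: minimax_lower => // Vh rho mV risk.
apply: (@le_trans _ _ (c * minimax_rate s d n)).
  rewrite ler_wpM2r ?(ltW rate0)// -[leRHS]invrK lef_pV2 ?posrE ?invr_gt0//; last by rewrite lt_max Cu0.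
  by rewrite le_max lexx orbT.
rewrite /minimax_rate maxr_pMr ?(ltW c0)// ge_max; apply/andP; split.
- apply: le_trans (low2 n Vh rho n0 mV risk).
  by rewrite ler_wpM2r ?powR_ge0// ge_min lexx orbT.
- apply: le_trans (low1 n Vh rho n0 mV risk).
  by rewrite ler_wpM2r ?powR_ge0// ge_min lexx.
Qed.
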